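(* The cyclic structure on the operad of objects $\mathrm{ob}(\mathsf{PaRB})$ (given by relabelling the boundary edges of planar unrooted trivalent trees), together with the assignments on the generating morphisms, for $s_0=(01)$, $$s_0^*\tau=\tau,\qquad s_0^*\beta_{12}=\bigl(1_\mu\circ_2\tau^{-1}\bigr)\cdot\beta_{12}^{-1},\qquad s_0^*\alpha_{123}=\alpha_{231}^{-1},$$ extends uniquely to a cyclic operad structure on the operad in groupoids $\mathsf{PaRB}$.
   Context: **Cyclic operads.** Permutations are composed right to left and symmetric groups act on the right, so $(\sigma\rho)^*=\rho^*\sigma^*$; in a groupoid $g\cdot f$ means first $f$, then $g$. Let $\Sigma_n^+=\mathrm{Aut}(\{0,1,\dots,n\})$, let $\Sigma_n\subseteq\Sigma_n^+$ be the subgroup fixing $0$, and $z_{n+1}=(0\,1\cdots n)\in\Sigma_n^+$. A cyclic structure on a one-coloured symmetric operad $\mathcal O=\{\mathcal O(n)\}_{n\ge0}$ (partial compositions $\circ_i$, unit $1\in\mathcal O(1)$) consists of right $\Sigma_n^+$-actions on $\mathcal O(n)$ extending the $\Sigma_n$-actions, such that $z_2^*1=1$ and, for $x\in\mathcal O(n)$, $y\in\mathcal O(m)$, $n,m\ge1$, $z_{n+m}^*(x\circ_iy)=z_{n+1}^*(x)\circ_{i-1}y$ for $2\le i\le n$ and $z_{n+m}^*(x\circ_1y)=z_{m+1}^*(y)\circ_m z_{n+1}^*(x)$ (for $m=0$ the latter is replaced by $z_n^*(x\circ_1y)=((z_{n+1}^2)^*x)\circ_ny$). **Parenthesised ribbon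 braids.** $\mathsf B_n$ is the braid group with generators $\beta_i$ (strand in position $i$ crosses over strand in position $i+1$); the ribbon braid group is $\mathsf{RB}_n=\mathsf B_n\ltimes\mathbb Z^n$ ($\mathsf B_n$ permutes coordinates; the $i$th coordinate counts framing twists of the $i$th ribbon). The operad in groupoids $\mathsf{CoRB}$ has $\mathsf{CoRB}(0)=\varnothing$; for $n\ge1$ its objects are the elements of $\Sigma_n$ and morphisms $\sigma_1\to\sigma_2$ are ribbon braids with underlying permutation $\sigma_2\sigma_1^{-1}$; operadic composition inserts ribbon braids into ribbons: $(\gamma_1,[\tau_1,\dots,\tau_n])\circ_i(\gamma_2,[\tau_1',\dots,\tau_m'])=(\gamma_1\circ_i(\mathbf R_m^{\tau_i}\cdot\gamma_2),[\tau_1,\dots,\tau_{i-1},\tau_i+\tau'_1,\dots,\tau_i+\tau'_m,\tau_{i+1},\dots,\tau_n])$ with $\mathbf R_m=(\beta_1\cdots\beta_{m-1})^m$ the full twist. $\mathsf{PaRB}(0)=\varnothing$, and for $n\ge1$ the objects of $\mathsf{PaRB}(n)$ are planar rooted binary trees with root labelled $0$ and leaves labelled bijectively by $1,\dots,n$ (fully parenthesised words in $1,\dots,n$, each used once; the single object in arity 1 is the unit); morphisms between two such are the morphisms in $\mathsf{CoRB}(n)$ between the underlying permutations (read off from the order of the letters). Composition is grafting on objects and as in $\mathsf{CoRB}$ on morphisms. Write $\mu=(12)$, $\mu_{21}=(21)=(12)^*\mu$ for the two objects in arity 2; $\tau$ for the positive twist generating $\mathrm{Aut}_{\mathsf{PaRB}(1)}\cong\mathbb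 Z$; $\beta_{12}\colon\mu\to\mu_{21}$ for the braid generator; $\alpha_{123}\colon\mu\circ_1\mu=(12)3\to1(23)=\mu\circ_2\mu$ for the morphism with trivial underlying ribbon braid (associator). $\alpha_{231}$ denotes $\alpha_{123}$ with its inputs relabelled, in order, by $2,3,1$. These morphisms generate $\mathsf{PaRB}$ under operadic and categorical composition, inverses and symmetric group actions. **Cyclic structure on objects.** $\mathrm{ob}(\mathsf{PaRB})$ is the free cyclic operad on the right $\Sigma_2^+$-set $A_2^+\backslash\Sigma_2^+$ with $A_2^+=\langle(012)\rangle$, placed in arity two; its two elements are $\mu$ and $\mu_{21}$, with $(012)^*\mu=\mu$ and $(01)^*\mu=(12)^*\mu=\mu_{21}$. Concretely, objects in arity $n$ are planar unrooted trivalent trees with boundary edges labelled by $\{0,\dots,n\}$ (the edge labelled $0$ being regarded as the root), and $\Sigma_n^+$ relabels the boundary edges. *)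

(* Defs.v *)
From HB Require Import structures.
From mathcomp Require Import all_boot all_order all_fingroup all_algebra.
From mathcomp Require Import generic_quotient zify boolp.

Set Implicit Arguments.
Unset Strict Implicit.
Unset Printing Implicit Defensive.

Local Open Scope group_scope.
Local Open Scope quotient_scope.

(* Permutations.  MathComp multiplies permutations from left to right,
   (s * t) x = t (s x), so the composite written "sigma rho" when composing
   from right to left is [rho * sigma] here.  Positions and operadic inputs
   are elements of 'I_n: the ordinal i stands for the input number i + 1. *)

(* The letter (i, true) is the generator beta_(i+1), whose
   strand in position i crosses over the strand in position i + 1 (positions
   counted from 0); (i, false) is its inverse.  In a product g * f, and hence
   in a word read from left to right, the rightmost factor comes first.       *)

Definition word (n : nat) : Type := seq ('I_n.-1 * bool).

Inductive braid_rel (n : nat) : word n -> word n -> Prop :=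
| braid_refl u : braid_rel u u
| braid_sym u v : braid_rel u v -> braid_rel v u
| braid_trans u v w : braid_rel u v -> braid_rel v w -> braid_rel u w
| braid_cat u u' v v' :
    braid_rel u u' -> braid_rel v v' -> braid_rel (u ++ v) (u' ++ v')
| braid_cancel i b : braid_rel [:: (i, b); (i, ~~ b)] [::]
| braid_far (i j : 'I_n.-1) : i.+1 < j ->
    braid_rel [:: (i, true); (j, true)] [:: (j, true); (i, true)]
| braid_braid (i j : 'I_n.-1) : j = i.+1 :> nat ->
    braid_rel [:: (i, true); (j, true); (i, true)]
              [:: (j, true); (i, true); (j, true)].

Definition braid_eqb n (u v : word n) : bool := `[< braid_rel u v >].

Lemma braid_eqb_equiv n : equiv_class_of (@braid_eqb n).
Proof.
split=> [u|u v|v u w].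
- exact/asboolP/braid_refl.
- by apply/asboolP/asboolP; apply: braid_sym.
- by move=> /asboolP uv /asboolP vw; apply/asboolP/(braid_trans uv vw).
Qed.

Canonical braid_equiv n : equiv_rel (word n) :=
  EquivRelPack (braid_eqb_equiv n).

Definition braid (n : nat) : Type := {eq_quot braid_equiv n}.
HB.instance Definition _ n : EqQuotient _ (@braid_equiv n) (braid n) :=
  EqQuotient.on (braid n).
HB.instance Definition _ n := Choice.on (braid n).

Definition wbraid n (w : word n) : braid n := \pi_(braid n) w.

Lemma wbraidP n (u v : word n) : wbraid u = wbraid v <-> braid_rel u v.
Proof.
split=> [/eqP|uv]; first by rewrite piE => /asboolP.
by apply/eqP; rewrite piE; apply/asboolP.
Qed.

Lemma wbraid_repr n (x : braid n) : wbraid (repr x) = x.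
Proof. exact: reprK. Qed.

Definition winv n (w : word n) : word n := rev [seq (a.1, ~~ a.2) | a <- w].

Lemma winvK n : involutive (@winv n).
Proof.
move=> w; rewrite /winv map_rev revK -map_comp -[RHS]map_id.
by apply: eq_map => -[i b] /=; rewrite negbK.
Qed.

Lemma winv_cat n (u v : word n) : winv (u ++ v) = winv v ++ winv u.
Proof. by rewrite /winv map_cat rev_cat. Qed.

Lemma braid_winvr n (w : word n) : braid_rel (w ++ winv w) [::].
Proof.
elim: w => [|[i b] w IH]; first exact: braid_refl.
rewrite -cat1s winv_cat -catA (catA w).
apply: braid_trans (braid_cancel i b).
apply: (braid_cat (braid_refl _)).
exact: (braid_cat IH (braid_refl (winv [:: (i, b)]))).
Qed.

Lemma braid_winvl n (w : word n) : braid_rel (winv w ++ w) [::].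
Proof. by rewrite -{2}(winvK w); apply: braid_winvr. Qed.

Lemma braid_winv n (u v : word n) :
  braid_rel u v -> braid_rel (winv u) (winv v).
Proof.
move=> uv; rewrite -[winv u]cats0.
apply: braid_trans (braid_cat (braid_refl _) (braid_sym (braid_winvr v))) _.
rewrite catA; apply: (@braid_trans _ _ ([::] ++ winv v)); last exact: braid_refl.
apply: braid_cat (braid_refl _).
apply: braid_trans (braid_winvl u).
exact: braid_cat (braid_refl _) (braid_sym uv).
Qed.

Definition braid_one n : braid n := wbraid [::].
Definition braid_mul n (x y : braid n) : braid n := wbraid (repr x ++ repr y).
Definition braid_inv n (x : braid n) : braid n := wbraid (winv (repr x)).

Lemma repr_wbraid n (u : word n) : braid_rel (repr (wbraid u)) u.
Proof. by apply/wbraidP; rewrite wbraid_repr. Qed.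

Lemma wbraid_cat n (u v : word n) :
  wbraid (u ++ v) = braid_mul (wbraid u) (wbraid v).
Proof. by apply/wbraidP/braid_sym/braid_cat; apply: repr_wbraid. Qed.

Lemma wbraid_inv n (u : word n) : wbraid (winv u) = braid_inv (wbraid u).
Proof. exact/wbraidP/braid_winv/braid_sym/repr_wbraid. Qed.

Lemma braid_mulA n : associative (@braid_mul n).
Proof.
move=> x y z; rewrite -(wbraid_repr x) -(wbraid_repr y) -(wbraid_repr z).
by rewrite -!wbraid_cat catA.
Qed.

Lemma braid_mul1x n : left_id (braid_one n) (@braid_mul n).
Proof. by move=> x; rewrite -(wbraid_repr x) -wbraid_cat. Qed.

Lemma braid_mulx1 n : right_id (braid_one n) (@braid_mul n).
Proof. by move=> x; rewrite -(wbraid_repr x) -wbraid_cat cats0. Qed.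

Lemma braid_mulVx n : left_inverse (braid_one n) (@braid_inv n) (@braid_mul n).
Proof.
move=> x; rewrite -(wbraid_repr x) -wbraid_inv -wbraid_cat.
exact/wbraidP/braid_winvl.
Qed.

Lemma braid_mulxV n : right_inverse (braid_one n) (@braid_inv n) (@braid_mul n).
Proof.
move=> x; rewrite -(wbraid_repr x) -wbraid_inv -wbraid_cat.
exact/wbraidP/braid_winvr.
Qed.

HB.instance Definition _ n := isGroup.Build (braid n)
  (@braid_mulA n) (@braid_mul1x n) (@braid_mulx1 n)
  (@braid_mulVx n) (@braid_mulxV n).

Definition sigma n (i : 'I_n.-1) : braid n := wbraid [:: (i, true)].

(* Underlying permutations: a position is sent to the position at which the
   strand starting there ends.                                                *)

Lemma letter_ltS n (i : 'I_n.-1) : i.+1 < n.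
Proof. by case: n i => [|n] []. Qed.

Definition letter_perm n (i : 'I_n.-1) : 'S_n :=
  tperm (widen_ord (leq_pred n) i) (Ordinal (letter_ltS i)).

Definition word_perm n (w : word n) : 'S_n :=
  foldr (fun a s => s * letter_perm a.1) 1 w.

Definition braid_perm n (x : braid n) : 'S_n := word_perm (repr x).

Lemma word_perm_cat n (u v : word n) :
  word_perm (u ++ v) = word_perm v * word_perm u.
Proof. by elim: u => [|a u IH] /=; rewrite ?mulg1 // IH mulgA. Qed.

Lemma letter_permE n (i : 'I_n.-1) (p : 'I_n) :
  letter_perm i p = (if p == i :> nat then i.+1 else
                     if p == i.+1 :> nat then i : nat else p) :> nat.
Proof.
rewrite /letter_perm; case: tpermP => [->|->|] /=.
- by rewrite eqxx.
- by rewrite -[i.+1 == i]/(i.+1 == i :> nat) eqn_leq ltnn eqxx.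
move=> /eqP; rewrite -val_eqE /= => /negbTE -> /eqP.
by rewrite -val_eqE /= => /negbTE ->.
Qed.

Lemma word_perm_rel n (u v : word n) :
  braid_rel u v -> word_perm u = word_perm v.
Proof.
elim=> {u v} //.
- by move=> u v w _ -> _ ->.
- by move=> u u' v v' _ uu' _ vv'; rewrite !word_perm_cat uu' vv'.
- by move=> i b; rewrite /= !mul1g /letter_perm tperm2.
- move=> i j ij; rewrite /= !mul1g; apply/permP => p; rewrite !permM.
  apply: val_inj; rewrite /= !letter_permE.
  have ? : (i : nat) < j by apply: ltn_trans ij.
  by do ![case: eqP => //=]; move: ij => /ltP ? *; exfalso; lia.
- move=> i j ij; rewrite /= !mul1g; apply/permP => p; rewrite !permM.
  apply: val_inj; rewrite /= !letter_permE ij.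
  by do ![case: eqP => //=] => *; exfalso; lia.
Qed.

Lemma braid_perm_wbraid n (w : word n) : braid_perm (wbraid w) = word_perm w.
Proof. exact/word_perm_rel/repr_wbraid. Qed.

Lemma wbraidM n (u v : word n) : wbraid (u ++ v) = wbraid u * wbraid v.
Proof. exact: wbraid_cat. Qed.

Lemma wbraidV n (u : word n) : wbraid (winv u) = (wbraid u)^-1.
Proof. exact: wbraid_inv. Qed.

Lemma braid_perm1 n : braid_perm (1 : braid n) = 1.
Proof. exact: braid_perm_wbraid. Qed.

Lemma braid_permM n (x y : braid n) :
  braid_perm (x * y) = braid_perm y * braid_perm x.
Proof. by rewrite [LHS]braid_perm_wbraid word_perm_cat. Qed.

Lemma braid_permV n (x : braid n) : braid_perm x^-1 = (braid_perm x)^-1.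
Proof.
apply: (mulgI (braid_perm x)).
by rewrite -braid_permM mulVg mulgV braid_perm1.
Qed.

(* Ribbon braid groups B_n |>< Z^n: [rtwist x p] counts the framing twists of
   the ribbon that starts in position p.                                      *)

Record ribbon (n : nat) := Ribbon {
  rbraid : braid n;
  rtwist : {ffun 'I_n -> int}
}.

Definition ribbon_pair n (x : ribbon n) := (rbraid x, rtwist x).
Definition pair_ribbon n (x : braid n * {ffun 'I_n -> int}) : ribbon n :=
  Ribbon x.1 x.2.
Lemma ribbon_pairK n : cancel (@ribbon_pair n) (@pair_ribbon n).
Proof. by case. Qed.
HB.instance Definition _ n :=
  Choice.copy (ribbon n) (can_type (@ribbon_pairK n)).

Definition ribbon_one n : ribbon n := Ribbon 1 [ffun=> 0%R].
Definition ribbon_mul n (x y : ribbon n) : ribbon n :=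
  Ribbon (rbraid x * rbraid y)
    [ffun p => (rtwist y p + rtwist x (braid_perm (rbraid y) p))%R].
Definition ribbon_inv n (x : ribbon n) : ribbon n :=
  Ribbon (rbraid x)^-1
    [ffun p => (- rtwist x ((braid_perm (rbraid x))^-1%g p))%R].

Lemma ribbon_mulA n : associative (@ribbon_mul n).
Proof.
move=> x y z; congr Ribbon; rewrite /= ?mulgA //.
by apply/ffunP => p; rewrite !ffunE /= braid_permM permM GRing.addrA.
Qed.

Lemma ribbon_mul1x n : left_id (ribbon_one n) (@ribbon_mul n).
Proof.
case=> x t; congr Ribbon; rewrite /= ?mul1g //.
by apply/ffunP => p; rewrite !ffunE GRing.addr0.
Qed.

Lemma ribbon_mulx1 n : right_id (ribbon_one n) (@ribbon_mul n).
Proof.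
case=> x t; congr Ribbon; rewrite /= ?mulg1 //.
by apply/ffunP => p; rewrite !ffunE braid_perm1 perm1 GRing.add0r.
Qed.

Lemma ribbon_mulVx n :
  left_inverse (ribbon_one n) (@ribbon_inv n) (@ribbon_mul n).
Proof.
case=> x t; congr Ribbon; rewrite /= ?mulVg //.
by apply/ffunP => p; rewrite !ffunE permK GRing.subrr.
Qed.

Lemma ribbon_mulxV n :
  right_inverse (ribbon_one n) (@ribbon_inv n) (@ribbon_mul n).
Proof.
case=> x t; congr Ribbon; rewrite /= ?mulgV //.
by apply/ffunP => p; rewrite !ffunE /= braid_permV GRing.addNr.
Qed.

HB.instance Definition _ n := isGroup.Build (ribbon n)
  (@ribbon_mulA n) (@ribbon_mul1x n) (@ribbon_mulx1 n)
  (@ribbon_mulVx n) (@ribbon_mulxV n).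

Definition ribbon_perm n (x : ribbon n) : 'S_n := braid_perm (rbraid x).

Lemma ribbon_perm1 n : ribbon_perm (1 : ribbon n) = 1.
Proof. exact: braid_perm1. Qed.

Lemma ribbon_permM n (x y : ribbon n) :
  ribbon_perm (x * y) = ribbon_perm y * ribbon_perm x.
Proof. exact: braid_permM. Qed.

Lemma ribbon_permV n (x : ribbon n) : ribbon_perm x^-1 = (ribbon_perm x)^-1.
Proof. exact: braid_permV. Qed.

(* Words are produced with indices in nat and then read as words in the
   generators of [braid N]; an index that is too large would be dropped, which
   never happens below. *)
Definition to_word N (s : seq (nat * bool)) : word N :=
  pmap (fun a : nat * bool => omap (fun i => (i, a.2)) (insub a.1)) s.

(* The crossing (i, b), when the strand that starts in position q before this
   crossing is replaced by m parallel strands.  The strand in position q meets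
   another strand only if i = q, and the block then moves one step to the
   right, or if i + 1 = q, and it moves one step to the left. *)
Definition cable_letter (m q : nat) (a : nat * bool) : seq (nat * bool) :=
  let: (i, b) := a in
  if i.+1 < q then [:: (i, b)]
  else if i.+1 == q then [seq (k, b) | k <- rev (iota i m)]
  else if i == q then [seq (k, b) | k <- iota i m]
  else [:: ((i + m).-1, b)].

Fixpoint cable_word n m (p : 'I_n) (w : word n) : word (n + m).-1 :=
  if w is a :: w' then
    to_word _ (cable_letter m (word_perm w' p) (nat_of_ord a.1, a.2))
      ++ cable_word m p w'
  else [::].

(* The strand that starts in position p is replaced by m parallel strands. *)
Definition cable n m (p : 'I_n) (x : braid n) : braid (n + m).-1 :=
  wbraid (cable_word m p (repr x)).

Definition shift_word n m (p : 'I_n) (w : word m) : word (n + m).-1 :=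
  to_word _ [seq ((p + a.1)%N, a.2) | a : 'I_m.-1 * bool <- w].

(* A braid on m strands, placed in the positions p, .., p + m - 1. *)
Definition shift n m (p : 'I_n) (y : braid m) : braid (n + m).-1 :=
  wbraid (shift_word p (repr y)).

Definition full_twist m : braid m := (\prod_(i < m.-1) sigma i) ^+ m.

Definition expgz (G : groupType) (x : G) (k : int) : G :=
  match k with Posz j => x ^+ j | Negz j => x ^- j.+1 end.

Definition circ_twist n m (p : 'I_n) (t : {ffun 'I_n -> int})
    (t' : {ffun 'I_m -> int}) : {ffun 'I_(n + m).-1 -> int} :=
  [ffun r : 'I_(n + m).-1 =>
    if r < p then odflt 0%R (omap t (insub (r : nat)))
    else if r < p + m then
      (t p + odflt 0%R (omap t' (insub (r - p)%N)))%R
    else odflt 0%R (omap t (insub (r - m).+1))].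

(* x o_i y, where p is the position in which the ribbon of the input i
   starts. *)
Definition ribbon_circ n m (p : 'I_n) (x : ribbon n) (y : ribbon m) :
    ribbon (n + m).-1 :=
  Ribbon (cable m p (rbraid x) *
          shift p (expgz (full_twist m) (rtwist x p) * rbraid y))
         (circ_twist p (rtwist x) (rtwist y)).

Lemma to_word_cat N s s' : to_word N (s ++ s') = to_word N s ++ to_word N s'.
Proof. exact: pmap_cat. Qed.

Lemma to_word1 N k b (lt_k : k < N.-1) :
  to_word N [:: (k, b)] = [:: (Ordinal lt_k, b)].
Proof. by rewrite /to_word /= insubT. Qed.

Definition swapn (k x : nat) : nat :=
  if x == k then k.+1 else if x == k.+1 then k else x.

Definition word_act (s : seq (nat * bool)) (x : nat) : nat :=
  foldr (fun a => swapn a.1) x s.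

Lemma word_act_cat s s' x : word_act (s ++ s') x = word_act s (word_act s' x).
Proof. exact: foldr_cat. Qed.

Lemma word_perm_act N (s : seq (nat * bool)) (r : 'I_N) :
  all (fun a => a.1 < N.-1) s ->
  word_perm (to_word N s) r = word_act s r :> nat.
Proof.
elim: s => [|[k b] s IH] /=; first by rewrite perm1.
case/andP=> lt_k /IH {}IH.
by rewrite /to_word /= insubT /= permM letter_permE IH.
Qed.

Lemma word_act_up i b m x :
  word_act [seq (k, b) | k <- iota i m] x =
    if x == i + m then i else if i <= x < i + m then x.+1 else x.
Proof.
elim: m i => [|m IH] i /=; first by rewrite addn0; do ![case: ifP]; lia.
by rewrite IH /swapn; do ![case: ifP]; lia.
Qed.

Lemma word_act_down i b m x :
  word_act [seq (k, b) | k <- rev (iota i m)] x =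
    if x == i then i + m else if i < x <= i + m then x.-1 else x.
Proof.
elim: m i x => [|m IH] i x /=; first by rewrite addn0; do ![case: ifP]; lia.
rewrite rev_cons map_rcons -cats1 word_act_cat IH /= /swapn.
by do ![case: ifP]; lia.
Qed.

Definition outer_pos (m q r : nat) : nat := if r < q then r else (r + m).-1.

Lemma cable_letter_inner m q a k : k < m ->
  word_act (cable_letter m q a) (q + k) = swapn a.1 q + k.
Proof.
case: a => i b lt_km /=; rewrite /swapn.
case: ltnP => [?|?] /=; first by rewrite /swapn; do ![case: ifP]; lia.
case: eqP => [?|?] /=; first by rewrite word_act_down; do ![case: ifP]; lia.
case: eqP => [?|?] /=; first by rewrite word_act_up; do ![case: ifP]; lia.
by rewrite /swapn; do ![case: ifP]; lia.
Qed.

Lemma cable_letter_outer m q a r : r != q ->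
  word_act (cable_letter m q a) (outer_pos m q r) =
  outer_pos m (swapn a.1 q) (swapn a.1 r).
Proof.
move/eqP=> neq_rq; case: a => i b; rewrite /= /swapn /outer_pos.
case: ltnP => [?|?] /=; first by rewrite /swapn; do ![case: ifP]; lia.
case: eqP => [?|?] /=; first by rewrite word_act_down; do ![case: ifP]; lia.
case: eqP => [?|?] /=; first by rewrite word_act_up; do ![case: ifP]; lia.
by rewrite /swapn; do ![case: ifP]; lia.
Qed.

Lemma cable_letter_lt n m (q : nat) (a : nat * bool) : q < n -> a.1 < n.-1 ->
  all (fun c => c.1 < (n + m).-1.-1) (cable_letter m q a).
Proof.
case: a => i b /= lt_q lt_i; case: ltnP => [?|?] /=; first by rewrite andbT; lia.
case: eqP => [?|?] /=.
  by rewrite all_map all_rev; apply/allP => k; rewrite mem_iota /=; lia.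
case: eqP => [?|?] /=; last by rewrite andbT; lia.
by rewrite all_map; apply/allP => k; rewrite mem_iota /=; lia.
Qed.

Lemma cable_word_inner n m (p : 'I_n) (w : word n) (r : 'I_(n + m).-1) k :
  k < m -> r = p + k :> nat ->
  word_perm (cable_word m p w) r = word_perm w p + k :> nat.
Proof.
move=> lt_km def_r; elim: w => [|[i b] w IH] /=; first by rewrite !perm1.
rewrite -[if _ then _ else _]/(cable_letter m (word_perm w p) (nat_of_ord i, b)).
rewrite word_perm_cat !permM word_perm_act ?cable_letter_lt ?ltn_ord // IH.
by rewrite cable_letter_inner // letter_permE.
Qed.

Lemma cable_word_outer n m (p q : 'I_n) (w : word n) (r : 'I_(n + m).-1) :
  q != p -> r = outer_pos m p q :> nat ->
  word_perm (cable_word m p w) r =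
    outer_pos m (word_perm w p) (word_perm w q) :> nat.
Proof.
move=> neq_qp def_r; elim: w => [|[i b] w IH] /=; first by rewrite !perm1.
rewrite -[if _ then _ else _]/(cable_letter m (word_perm w p) (nat_of_ord i, b)).
rewrite word_perm_cat !permM word_perm_act ?cable_letter_lt ?ltn_ord // IH.
rewrite cable_letter_outer ?letter_permE //.
by rewrite val_eqE (inj_eq perm_inj).
Qed.

Lemma cable_word_cat n m (p : 'I_n) (u v : word n) :
  cable_word m p (u ++ v) =
  cable_word m (word_perm v p) u ++ cable_word m p v.
Proof.
elim: u => [//|a u IH]; rewrite cat_cons /= word_perm_cat permM IH.
by rewrite catA.
Qed.

Section Generators.
Variable N : nat.
Implicit Types (i j k l m : nat) (s : seq (nat * bool)).

Definition gen k : braid N := wbraid (to_word N [:: (k, true)]).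

Lemma gen_out k : N.-1 <= k -> gen k = 1.
Proof. by move=> le_k; rewrite /gen /to_word /= insubF // ltnNge le_k. Qed.

Lemma gen_inv k : wbraid (to_word N [:: (k, false)]) = (gen k)^-1.
Proof.
rewrite /gen -wbraidV; congr wbraid.
by rewrite /to_word /=; case: insubP.
Qed.

Lemma wbraid_to_word_cat s s' :
  wbraid (to_word N (s ++ s')) = wbraid (to_word N s) * wbraid (to_word N s').
Proof. by rewrite to_word_cat wbraidM. Qed.

Lemma gen_far k l : k.+1 < l -> gen k * gen l = gen l * gen k.
Proof.
move=> lt_kl; case: (ltnP l N.-1) => [lt_l|?]; last first.
  by rewrite (@gen_out l) // mulg1 mul1g.
have lt_k : k < N.-1 by lia.
rewrite /gen !to_word1 -!wbraidM; apply/wbraidP.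
exact: braid_far.
Qed.

Lemma gen_braid k : k.+1 < N.-1 ->
  gen k * gen k.+1 * gen k = gen k.+1 * gen k * gen k.+1.
Proof.
move=> lt_k1; have lt_k : k < N.-1 by lia.
rewrite /gen !to_word1 -!wbraidM; apply/wbraidP.
exact: braid_braid.
Qed.

Definition up i m : braid N := wbraid (to_word N [seq (k, true) | k <- iota i m]).
Definition down i m : braid N :=
  wbraid (to_word N [seq (k, true) | k <- rev (iota i m)]).

Lemma upS i m : up i m.+1 = up i m * gen (i + m).
Proof. by rewrite /up -addn1 iotaD map_cat wbraid_to_word_cat. Qed.

Lemma downS i m : down i m.+1 = gen (i + m) * down i m.
Proof. by rewrite /down -addn1 iotaD rev_cat map_cat wbraid_to_word_cat. Qed.

Lemma far_up l i m : (l.+1 < i) || (i + m < l) ->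
  gen l * up i m = up i m * gen l.
Proof.
elim: m => [|m IH] far; first by rewrite mulg1 mul1g.
rewrite upS mulgA IH -?mulgA; last by lia.
congr (_ * _); case/orP: far => far; first by rewrite gen_far //; lia.
by rewrite -gen_far //; lia.
Qed.

Lemma far_down l i m : (l.+1 < i) || (i + m < l) ->
  gen l * down i m = down i m * gen l.
Proof.
elim: m => [|m IH] far; first by rewrite mulg1 mul1g.
rewrite downS -mulgA -IH ?mulgA; last by lia.
congr (_ * _); case/orP: far => far; first by rewrite gen_far //; lia.
by rewrite -gen_far //; lia.
Qed.

Lemma up_slide i m : i + m < N.-1 ->
  gen i * up i.+1 m * up i m = up i.+1 m * up i m * gen (i + m).
Proof.
elim: m => [|m IH] lt_im; first by rewrite !mulg1 !mul1g addn0.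
have far : gen (i + m).+1 * up i m = up i m * gen (i + m).+1.
  by apply: far_up; lia.
have braid : gen (i + m) * gen (i + m).+1 * gen (i + m)
           = gen (i + m).+1 * gen (i + m) * gen (i + m).+1.
  by apply: gen_braid; lia.
rewrite !upS addSn addnS; move: IH; set a := gen (i + m); set b := gen _.+1.
move=> IH.
transitivity (gen i * up i.+1 m * (b * up i m) * a); first by rewrite !mulgA.
rewrite far !mulgA IH; last by lia.
rewrite -!mulgA (mulgA a) braid !mulgA; do 2!congr (_ * _).
by rewrite -!mulgA far.
Qed.

Lemma down_slide i m : i + m < N.-1 ->
  down i m * down i.+1 m * gen i = gen (i + m) * down i m * down i.+1 m.
Proof.
elim: m => [|m IH] lt_im; first by rewrite !mulg1 !mul1g addn0.
have far : gen (i + m).+1 * down i m = down i m * gen (i + m).+1.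
  by apply: far_down; lia.
have braid : gen (i + m) * gen (i + m).+1 * gen (i + m)
           = gen (i + m).+1 * gen (i + m) * gen (i + m).+1.
  by apply: gen_braid; lia.
rewrite !downS addSn addnS; move: IH; set a := gen (i + m); set b := gen _.+1.
move=> IH.
transitivity (a * (down i m * b) * down i.+1 m * gen i).
  by rewrite !mulgA.
rewrite -far -!mulgA (mulgA (down i m)) IH; last by lia.
rewrite !mulgA braid -!mulgA; do 2!congr (_ * _).
by rewrite !mulgA far.
Qed.

Lemma up_down i m : i + m < N.-1 ->
  up i m * gen (i + m) * down i m = down i.+1 m * gen i * up i.+1 m.
Proof.
elim: m => [|m IH] lt_im; first by rewrite !mulg1 !mul1g addn0.
have far : gen (i + m).+1 * up i m = up i m * gen (i + m).+1.
  by apply: far_up; lia.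
have far' : gen (i + m).+1 * down i m = down i m * gen (i + m).+1.
  by apply: far_down; lia.
have braid : gen (i + m) * gen (i + m).+1 * gen (i + m)
           = gen (i + m).+1 * gen (i + m) * gen (i + m).+1.
  by apply: gen_braid; lia.
rewrite !upS !downS addSn addnS; move: IH; set a := gen (i + m).
set b := gen _.+1 => IH.
transitivity (up i m * (a * b * a) * down i m); first by rewrite !mulgA.
rewrite braid.
transitivity (up i m * b * a * (b * down i m)); first by rewrite !mulgA.
rewrite far' -far.
transitivity (b * (up i m * a * down i m) * b); first by rewrite !mulgA.
by rewrite IH ?mulgA //; lia.
Qed.

Lemma wbraid_far (s s' : seq (nat * bool)) :
  allrel (fun a c : nat * bool => (a.1.+1 < c.1) || (c.1.+1 < a.1)) s s' ->
  wbraid (to_word N (s ++ s')) = wbraid (to_word N (s' ++ s)).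
Proof.
have far1 a c : (a.1.+1 < c.1) || (c.1.+1 < a.1) ->
  commute (wbraid (to_word N [:: a])) (wbraid (to_word N [:: c])).
  have letterE b k : wbraid (to_word N [:: (k, b)]) =
      if b then gen k else (gen k)^-1.
    by case: b => //; rewrite gen_inv.
  case: a c => i b [j d] /= far; rewrite !letterE.
  have com : commute (gen i) (gen j).
    by case/orP: far => /gen_far.
  case: b d => [] [] //; [exact/commuteV|exact/commute_sym/commuteV|].
  exact/commuteV/commute_sym/commuteV.
rewrite !wbraid_to_word_cat.
elim: s => [|a s IH]; first by rewrite mulg1 mul1g.
rewrite allrel_consl => /andP[far_a /IH {}IH].
rewrite -cat1s !wbraid_to_word_cat -mulgA IH !mulgA; congr (_ * _).
elim: s' far_a {IH} => [|c s' IH']; first by rewrite mulg1 mul1g.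
move=> /andP[far_ac /IH' {}IH'].
rewrite -[c :: s']cat1s !wbraid_to_word_cat mulgA far1 // -mulgA IH'.
by rewrite !mulgA.
Qed.
End Generators.

Lemma to_word_nat n (w : word n) :
  to_word n [seq (nat_of_ord a.1, a.2) | a : 'I_n.-1 * bool <- w] = w.
Proof.
elim: w => //= -[i b] w; rewrite /to_word /= => ->.
by rewrite insubT ?ltn_ord //= => lt_i; congr ((_, _) :: _); apply: val_inj.
Qed.

Lemma to_word_inv N (s : seq (nat * bool)) :
  to_word N (rev [seq (a.1, ~~ a.2) | a <- s]) = winv (to_word N s).
Proof.
elim: s => //= -[k b] s IH; rewrite rev_cons -cats1 to_word_cat IH /=.
rewrite /to_word /=; case: insubP => [k' _ _|_] /=; last by rewrite cats0.
by rewrite -/(to_word N s) -[(k', b) :: _]cat1s winv_cat.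
Qed.

Lemma cable_letter_inv m q i b :
  cable_letter m (swapn i q) (i, b) =
  rev [seq (a.1, ~~ a.2) | a <- cable_letter m q (i, ~~ b)].
Proof.
have negK (t : seq nat) :
    [seq (a.1, ~~ a.2) | a <- [seq (k, ~~ b) | k <- t]] = [seq (k, b) | k <- t].
  by rewrite -map_comp; apply: eq_map => k /=; rewrite negbK.
rewrite /swapn; do ![case: ifP => ?]; rewrite /cable_letter; do ![case: ifP => ?];
  rewrite ?negK -?map_rev ?revK /rev /= ?negbK //; lia.
Qed.

Lemma cable_letter_far m q i j b d : i.+1 < j ->
  cable_letter m (swapn j q) (i, b) = cable_letter m q (i, b) /\
  cable_letter m (swapn i q) (j, d) = cable_letter m q (j, d).
Proof.
by move=> lt_ij; rewrite /swapn /=; split; do ![case: ifP => //]; lia.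
Qed.

Definition cable_gen N m q i : braid N :=
  wbraid (to_word N (cable_letter m q (i, true))).

Lemma cable_genE N m q i : cable_gen N m q i =
  if i.+1 < q then gen N i else if i.+1 == q then down N i m
  else if i == q then up N i m else gen N (i + m).-1.
Proof. by rewrite /cable_gen /cable_letter; do ![case: ifP => ?]. Qed.

Lemma cable_gen_braid N m q i :
  i + m < N.-1 -> (i.+2 < q -> i.+1 < N.-1) ->
  cable_gen N m (swapn i.+1 (swapn i q)) i * cable_gen N m (swapn i q) i.+1
    * cable_gen N m q i =
  cable_gen N m (swapn i (swapn i.+1 q)) i.+1 * cable_gen N m (swapn i.+1 q) i
    * cable_gen N m q i.+1.
Proof.
move=> lt_im lt_i.
case: (ltngtP i.+2 q) => [lt_q|gt_q|<-].
- have -> : swapn i q = q by rewrite /swapn; do ![case: ifP]; lia.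
  have -> : swapn i.+1 q = q by rewrite /swapn; do ![case: ifP]; lia.
  have -> : swapn i q = q by rewrite /swapn; do ![case: ifP]; lia.
  rewrite !cable_genE; do ![case: ifP => ?]; try lia.
  exact/gen_braid/lt_i.
- have [->|neq_qi] := eqVneq q i.
    have -> : swapn i i = i.+1 by rewrite /swapn eqxx.
    have -> : swapn i.+1 i = i by rewrite /swapn; do ![case: ifP]; lia.
    have -> : swapn i.+1 i.+1 = i.+2 by rewrite /swapn eqxx.
    have -> : swapn i i = i.+1 by rewrite /swapn eqxx.
    rewrite !cable_genE; do ![case: ifP => ?]; try lia.
    exact: up_slide.
  have [->|neq_qi1] := eqVneq q i.+1.
    have -> : swapn i i.+1 = i by rewrite /swapn; do ![case: ifP]; lia.
    have -> : swapn i.+1 i = i by rewrite /swapn; do ![case: ifP]; lia.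
    have -> : swapn i.+1 i.+1 = i.+2 by rewrite /swapn eqxx.
    have -> : swapn i i.+2 = i.+2 by rewrite /swapn; do ![case: ifP]; lia.
    rewrite !cable_genE; do ![case: ifP => ?]; try lia.
    exact: up_down.
  have -> : swapn i q = q by rewrite /swapn; do ![case: ifP]; lia.
  have -> : swapn i.+1 q = q by rewrite /swapn; do ![case: ifP]; lia.
  have -> : swapn i q = q by rewrite /swapn; do ![case: ifP]; lia.
  rewrite !cable_genE; do ![case: ifP => ?]; try lia.
  have -> : (i.+1 + m).-1 = (i + m).-1.+1 by lia.
  by apply: gen_braid; lia.
have -> : swapn i i.+2 = i.+2 by rewrite /swapn; do ![case: ifP]; lia.
have -> : swapn i.+1 i.+2 = i.+1 by rewrite /swapn; do ![case: ifP]; lia.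
have -> : swapn i i.+1 = i by rewrite /swapn; do ![case: ifP]; lia.
rewrite !cable_genE; do ![case: ifP => ?]; try lia.
exact: down_slide.
Qed.

Lemma cable_word_rel n m (p : 'I_n) (u v : word n) :
  braid_rel u v -> braid_rel (cable_word m p u) (cable_word m p v).
Proof.
move=> uv; elim: uv p => {u v}.
- by move=> u p; apply: braid_refl.
- by move=> u v _ IH p; apply/braid_sym/IH.
- by move=> u v w _ IH _ IH' p; apply: braid_trans (IH p) (IH' p).
- move=> u u' v v' _ IH vv' IH' p; rewrite !cable_word_cat (word_perm_rel vv').
  exact: braid_cat (IH _) (IH' _).
- move=> i b p; rewrite /cable_word cats0 /= !mul1g perm1 letter_permE.
  rewrite -/(swapn i p) -!/(cable_letter m _ (_, _)) cable_letter_inv to_word_inv.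
  exact: braid_winvl.
- move=> i j lt_ij p; rewrite /cable_word !cats0 /= !mul1g perm1 !letter_permE.
  rewrite -/(swapn i p) -/(swapn j p) -!/(cable_letter m _ (_, _)).
  have [-> ->] := @cable_letter_far m p i j true true lt_ij.
  rewrite -!to_word_cat; apply/wbraidP/wbraid_far/allrelP => -[k b] [l d].
  rewrite /cable_letter.
  do ![case: ifP => ?]; rewrite ?mem_seq1;
   do ?[case/mapP => ?; rewrite ?mem_rev mem_iota => ? [-> ?] | move=> /eqP [-> ?]];
   rewrite /=; lia.
- move=> i j def_j p; apply/wbraidP.
  rewrite /cable_word !cats0 /= !mul1g perm1 !permM !letter_permE.
  rewrite -!/(swapn _ _) -!/(cable_letter m _ (_, _)) !wbraidM !mulgA.
  rewrite -!/(cable_gen _ _ _ _) def_j.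
  by have := letter_ltS i; have := letter_ltS j; have := ltn_ord p;
     move=> ???; apply: cable_gen_braid; lia.
Qed.

Lemma cable_wbraid n m (p : 'I_n) (w : word n) :
  cable m p (wbraid w) = wbraid (cable_word m p w).
Proof. exact/wbraidP/cable_word_rel/repr_wbraid. Qed.

Lemma shift_word_lt n m (p : 'I_n) (w : word m) :
  all (fun a => a.1 < (n + m).-1.-1)
      [seq ((p + a.1)%N, a.2) | a : 'I_m.-1 * bool <- w].
Proof.
rewrite all_map; apply/allP => -[[i lt_i] b] _ /=.
by have := ltn_ord p; lia.
Qed.

Lemma shift_word_inner n m (p : 'I_n) (w : word m) (k : 'I_m)
    (r : 'I_(n + m).-1) :
  r = p + k :> nat -> word_perm (shift_word p w) r = p + word_perm w k :> nat.
Proof.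
move=> def_r; rewrite word_perm_act ?shift_word_lt // def_r.
elim: w => [|[i b] w IH] /=; first by rewrite perm1.
by rewrite IH permM letter_permE /swapn; do ![case: ifP]; lia.
Qed.

Lemma shift_word_outer n m (p : 'I_n) (w : word m) (r : 'I_(n + m).-1) :
  (r < p) || (p + m <= r) -> word_perm (shift_word p w) r = r.
Proof.
move=> out_r; apply: val_inj; rewrite /= word_perm_act ?shift_word_lt //.
elim: w => [|[[i lt_i] b] w IH] //=.
by rewrite IH /swapn; do ![case: ifP]; lia.
Qed.

Lemma shift_word_rel n m (p : 'I_n) (u v : word m) :
  braid_rel u v -> braid_rel (shift_word p u) (shift_word p v).
Proof.
have lt_shift (i : 'I_m.-1) : p + i < (n + m).-1.-1.
  by have := ltn_ord p; have := ltn_ord i; lia.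
have shift_cat (u' v' : word m) :
    shift_word p (u' ++ v') = shift_word p u' ++ shift_word p v'.
  by rewrite /shift_word map_cat to_word_cat.
have shift1 (i : 'I_m.-1) b :
    shift_word p [:: (i, b)] = [:: (Ordinal (lt_shift i), b)].
  exact: to_word1.
elim=> {u v}.
- by move=> u; apply: braid_refl.
- by move=> u v _ IH; apply/braid_sym/IH.
- by move=> u v w _ IH _ IH'; apply: braid_trans IH IH'.
- by move=> u u' v v' _ IH _ IH'; rewrite !shift_cat; apply: braid_cat.
- move=> i b; rewrite -[_ :: _]cat1s shift_cat !shift1.
  exact: braid_cancel.
- move=> i j lt_ij; rewrite -[_ :: _ in X in braid_rel X _]cat1s.
  rewrite -[_ :: _ in X in braid_rel _ X]cat1s !shift_cat !shift1.
  by apply: braid_far; rewrite /= -addnS ltn_add2l.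
- move=> i j def_j.
  have shift3 (a b c : 'I_m.-1) : shift_word p [:: (a, true); (b, true); (c, true)]
    = [:: (Ordinal (lt_shift a), true); (Ordinal (lt_shift b), true);
          (Ordinal (lt_shift c), true)].
    by rewrite -[_ :: _]cat1s shift_cat shift1 -[[:: _; _]]cat1s shift_cat !shift1.
  by rewrite !shift3; apply: braid_braid; rewrite /= def_j addnS.
Qed.

Lemma shift_wbraid n m (p : 'I_n) (w : word m) :
  shift p (wbraid w) = wbraid (shift_word p w).
Proof. exact/wbraidP/shift_word_rel/repr_wbraid. Qed.

Lemma braid_permX n (x : braid n) k : braid_perm (x ^+ k) = braid_perm x ^+ k.
Proof.
elim: k => [|k IH]; first exact: braid_perm1.
by rewrite monoid.expgSr braid_permM IH -expgS.
Qed.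

Lemma prod_sigma m : \prod_(i < m.-1) sigma i = up m 0 m.-1 :> braid m.
Proof.
transitivity (\prod_(i < m.-1) gen m i).
  apply: eq_bigr => i _; rewrite /sigma /gen (to_word1 _ (ltn_ord i)).
  by congr (wbraid [:: (_, _)]); apply: val_inj.
by elim: m.-1 => [|k IH]; rewrite ?big_ord0 // big_ord_recr /= IH upS.
Qed.

Lemma braid_perm_full_twist m : braid_perm (full_twist m) = 1.
Proof.
rewrite /full_twist braid_permX prod_sigma braid_perm_wbraid.
set s := word_perm _.
have sE (x : 'I_m) : s x = (x.+1 %% m)%N :> nat.
  rewrite word_perm_act; last first.
    by rewrite all_map; apply/allP => k; rewrite mem_iota.
  rewrite word_act_up; have lt_x := ltn_ord x.
  case: eqP => [def_x|neq_x].
    have -> : x.+1 = m by lia.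
    by rewrite modnn.
  have lt_x1 : x.+1 < m by lia.
  by rewrite modn_small //; case: ifP; lia.
have sX k (x : 'I_m) : (s ^+ k) x = ((x + k) %% m)%N :> nat.
  elim: k => [|k IH]; first by rewrite perm1 addn0 modn_small.
  by rewrite expgSr permM sE IH -addn1 modnDml addn1 addnS.
by apply/permP => x; apply: val_inj; rewrite /= sX perm1 modnDr modn_small.
Qed.

Lemma braid_perm_expgz m (k : int) : braid_perm (expgz (full_twist m) k) = 1.
Proof.
by case: k => k; rewrite /expgz ?braid_permV braid_permX braid_perm_full_twist
  expg1n ?invg1.
Qed.

Lemma ribbon_circ_inner n m (p : 'I_n) (x : ribbon n) (y : ribbon m) (k : 'I_m)
    (r : 'I_(n + m).-1) :
  r = p + k :> nat ->
  ribbon_perm (ribbon_circ p x y) r = ribbon_perm x p + ribbon_perm y k :> nat.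
Proof.
move=> def_r; rewrite /ribbon_perm /= braid_permM permM.
set z := _ * rbraid y; have zk : braid_perm z k = ribbon_perm y k.
  by rewrite braid_permM braid_perm_expgz mulg1.
rewrite [braid_perm (cable _ _ _)]braid_perm_wbraid.
rewrite (@cable_word_inner _ _ _ _ _ (ribbon_perm y k)) //.
by rewrite braid_perm_wbraid (shift_word_inner _ def_r) -zk.
Qed.

Lemma ribbon_circ_outer n m (p q : 'I_n) (x : ribbon n) (y : ribbon m)
    (r : 'I_(n + m).-1) :
  q != p -> r = outer_pos m p q :> nat ->
  ribbon_perm (ribbon_circ p x y) r =
    outer_pos m (ribbon_perm x p) (ribbon_perm x q) :> nat.
Proof.
move=> neq_qp def_r; rewrite /ribbon_perm /= braid_permM permM.
rewrite [braid_perm (cable _ _ _)]braid_perm_wbraid.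
rewrite (@cable_word_outer _ _ _ q) // braid_perm_wbraid shift_word_outer //.
rewrite def_r /outer_pos; move: neq_qp; rewrite -val_eqE /=.
by case: ifP; lia.
Qed.

Inductive btree := Leaf of nat | Node of btree & btree.

Fixpoint btree_code (t : btree) : GenTree.tree nat :=
  match t with
  | Leaf l => GenTree.Leaf l
  | Node t1 t2 => GenTree.Node 0 [:: btree_code t1; btree_code t2]
  end.

Fixpoint btree_decode (c : GenTree.tree nat) : btree :=
  match c with
  | GenTree.Leaf l => Leaf l
  | GenTree.Node _ [:: c1; c2] => Node (btree_decode c1) (btree_decode c2)
  | _ => Leaf 0
  end.

Lemma btree_codeK : cancel btree_code btree_decode.
Proof. by elim=> //= t1 -> t2 ->. Qed.

HB.instance Definition _ := Countable.copy btree (can_type btree_codeK).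

Fixpoint leaves (t : btree) : seq nat :=
  match t with
  | Leaf l => [:: l]
  | Node t1 t2 => leaves t1 ++ leaves t2
  end.

Fixpoint relabel (f : nat -> nat) (t : btree) : btree :=
  match t with
  | Leaf l => Leaf (f l)
  | Node t1 t2 => Node (relabel f t1) (relabel f t2)
  end.

(* Grafting y, with leaves 1, .., m, at the leaf i + 1. *)
Fixpoint graft (m i : nat) (t y : btree) : btree :=
  match t with
  | Leaf l => if l == i.+1 then relabel (addn i) y
              else Leaf (if l <= i then l else (l + m).-1)
  | Node t1 t2 => Node (graft m i t1 y) (graft m i t2 y)
  end.

(* A planar unrooted trivalent tree is represented by cutting it open at one
   of its boundary edges.  The cyclic order of the edges at the vertex of
   [Node t1 t2] is: the edge to the root, t1, t2.  [reroot c t] is the tree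
   with root 0 obtained by joining c and t along their roots, if 0 is a leaf
   of t. *)
Fixpoint reroot (c t : btree) : btree :=
  match t with
  | Leaf _ => c
  | Node t1 t2 => if 0 \in leaves t1 then reroot (Node t2 c) t1
                  else reroot (Node c t1) t2
  end.

(* The unrooted tree given by t and the label r of its root, viewed as rooted
   at its edge labelled 0. *)
Definition root_at0 (r : nat) (t : btree) : btree :=
  if r == 0 then t else reroot (Leaf r) t.

Lemma leaves_relabel f t : leaves (relabel f t) = map f (leaves t).
Proof. by elim: t => //= t1 -> t2 ->; rewrite map_cat. Qed.

Lemma leaves_reroot c t : 0 \in leaves t ->
  perm_eq (0 :: leaves (reroot c t)) (leaves c ++ leaves t).
Proof.
elim: t c => [l|t1 IH1 t2 IH2] c /=.
  by rewrite mem_seq1 => /eqP <-; rewrite perm_sym cats1 perm_rcons.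
rewrite mem_cat; case: ifP => [in1 _|_ /= in2].
  apply: perm_trans (IH1 _ in1) _ => /=.
  by rewrite -catA perm_catC -catA.
by apply: perm_trans (IH2 _ in2) _ => /=; rewrite -catA.
Qed.

Record tree (n : nat) := Tree {
  tree_val :> btree;
  _ : perm_eq (leaves tree_val) (iota 1 n)
}.
#[warning="-projection-no-head-constant"]
HB.instance Definition _ n := [isSub for @tree_val n].
HB.instance Definition _ n := [Countable of tree n by <:].

Lemma treeP n (t : tree n) : perm_eq (leaves t) (iota 1 n).
Proof. exact: valP t. Qed.

Lemma size_leaves n (t : tree n) : size (leaves t) = n.
Proof. by rewrite (perm_size (treeP t)) size_iota. Qed.

Lemma uniq_leaves n (t : tree n) : uniq (leaves t).
Proof. by rewrite (perm_uniq (treeP t)) iota_uniq. Qed.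

Lemma mem_leaves n (t : tree n) l : (l \in leaves t) = (0 < l <= n).
Proof. by rewrite (perm_mem (treeP t)) mem_iota add1n ltnS. Qed.

(* The underlying permutation of an object: the input i is sent to its
   position in the word. *)
Lemma label_pos_lt n (t : tree n) (i : 'I_n) : index i.+1 (leaves t) < n.
Proof.
by have := index_mem i.+1 (leaves t); rewrite size_leaves mem_leaves /= ltn_ord.
Qed.

Definition label_pos n (t : tree n) (i : 'I_n) : 'I_n := Ordinal (label_pos_lt t i).

Lemma label_pos_inj n (t : tree n) : injective (label_pos t).
Proof.
move=> i j /(congr1 (fun k : 'I_n => nth 0 (leaves t) k)) /=.
by rewrite !nth_index ?mem_leaves //= => -[] /val_inj.
Qed.

Definition tree_perm n (t : tree n) : 'S_n := perm (@label_pos_inj n t).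

Lemma tree_permE n (t : tree n) (i : 'I_n) :
  tree_perm t i = index i.+1 (leaves t) :> nat.
Proof. by rewrite permE. Qed.

Lemma nth_tree_perm n (t : tree n) (i : 'I_n) :
  nth 0 (leaves t) (tree_perm t i) = i.+1.
Proof. by rewrite tree_permE nth_index // mem_leaves /=. Qed.

Lemma tree_permP n (a b : tree n) (s : 'S_n) :
  reflect (forall p, nth 0 (leaves b) (s p) = nth 0 (leaves a) p)
          (s == (tree_perm a)^-1 * tree_perm b).
Proof.
apply: (iffP eqP) => [-> p|nth_s].
  rewrite permM nth_tree_perm -{2}(permKV (tree_perm a) p).
  by rewrite nth_tree_perm.
apply/permP => p; rewrite permM; have := nth_s p.
rewrite -{2}(permKV (tree_perm a) p) nth_tree_perm.
rewrite -(nth_tree_perm b) => /eqP; rewrite nth_uniq ?size_leaves //.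
  by move/eqP/val_inj.
exact: uniq_leaves.
Qed.

Lemma tree_one_subproof : perm_eq (leaves (Leaf 1)) (iota 1 1).
Proof. by []. Qed.
Definition tree_one : tree 1%N := Tree tree_one_subproof.

Definition shift_label (m i l : nat) := if l <= i then l else (l + m).-1.

Lemma leaves_graft m i t y : leaves (graft m i t y) =
  flatten [seq (if l == i.+1 then map (addn i) (leaves y)
                else [:: shift_label m i l]) | l <- leaves t].
Proof.
elim: t => [l|t1 IH1 t2 IH2] /=; last by rewrite IH1 IH2 map_cat flatten_cat.
by rewrite cats0; case: ifP; rewrite ?leaves_relabel.
Qed.

Lemma flatten_outer m i (s y : seq nat) : i.+1 \notin s ->
  flatten [seq (if l == i.+1 then y else [:: shift_label m i l]) | l <- s] =
  map (shift_label m i) s.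
Proof.
by elim: s => //= l s IH; rewrite inE negb_or eq_sym => /andP[/negbTE -> /IH ->].
Qed.

Lemma tree_circ_subproof n m (i : 'I_n) (x : tree n) (y : tree m) :
  perm_eq (leaves (graft m i x y)) (iota 1 (n + m).-1).
Proof.
rewrite leaves_graft; have lt_i := ltn_ord i.
apply: perm_trans (perm_flatten (perm_map _ (treeP x))) _.
have -> : iota 1 n = iota 1 i ++ i.+1 :: iota i.+2 (n - i.+1).
  rewrite -[i.+1 :: _]/(iota i.+1 (n - i.+1).+1) -[in iota i.+1 _]add1n -iotaD.
  by congr iota; lia.
rewrite map_cat flatten_cat /= eqxx !flatten_outer ?mem_iota; try lia.
have -> : iota 1 (n + m).-1 = iota 1 i ++ iota i.+1 m ++ iota (i.+1 + m) (n - i.+1).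
  rewrite -iotaD -[in iota i.+1 _]add1n -iotaD; congr iota; lia.
have -> : [seq shift_label m i l | l <- iota 1 i] = iota 1 i.
  rewrite -[RHS]map_id; apply/eq_in_map => l; rewrite mem_iota /shift_label.
  by case: ifP => //; lia.
have -> : [seq shift_label m i l | l <- iota i.+2 (n - i.+1)] =
    iota (i.+1 + m) (n - i.+1).
  rewrite (_ : i.+1 + m = (i.+2 + m).-1)%N; last by lia.
  have : i < i.+2 by [].
  elim: (n - i.+1)%N i.+2 => //= k IH l lt_l; rewrite IH; last exact: ltnW.
  by rewrite /shift_label leqNgt lt_l /= (_ : (l + m).-1.+1 = l + m); last lia.
rewrite perm_cat2l perm_cat2r.
have -> : iota i.+1 m = map (addn i) (iota 1 m) by rewrite -iotaDl addn1.
exact/perm_map/treeP.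
Qed.

Definition tree_circ n m (i : 'I_n) (x : tree n) (y : tree m) :
    tree (n + m).-1 := Tree (tree_circ_subproof i x y).

(* The right action of s relabels by the inverse of s. *)
Definition label_map n (s : 'S_n.+1) (l : nat) : nat := s^-1 (inord l).

Definition act_btree n (s : 'S_n.+1) (t : btree) : btree :=
  root_at0 (s^-1 ord0) (relabel (label_map s) t).

Lemma perm_label_map n (s : 'S_n.+1) (t : tree n) :
  perm_eq (nat_of_ord (s^-1 ord0) :: map (label_map s) (leaves t)) (iota 0 n.+1).
Proof.
have -> : nat_of_ord (s^-1 ord0) = label_map s 0.
  by rewrite /label_map; congr (nat_of_ord (s^-1 _)); apply/val_inj; rewrite /= inordK.
rewrite -[_ :: _]/(map (label_map s) (0 :: leaves t)).
have /perm_trans -> // : perm_eq (map (label_map s) (0 :: leaves t))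
    (map (label_map s) (iota 0 n.+1)).
  by apply: perm_map; rewrite perm_cons treeP.
rewrite -val_enum_ord -map_comp.
rewrite (@eq_map _ _ _ (val \o s^-1)); last first.
  by move=> k /=; rewrite /label_map inord_val.
rewrite map_comp; apply/perm_map/uniq_perm; rewrite ?enum_uniq //.
  by rewrite map_inj_uniq ?enum_uniq //; apply: perm_inj.
move=> k; rewrite mem_enum; apply/mapP; exists (s k); rewrite ?mem_enum //.
by rewrite permK.
Qed.

Lemma tree_act_subproof n (s : 'S_n.+1) (t : tree n) :
  perm_eq (leaves (act_btree s t)) (iota 1 n).
Proof.
have := perm_label_map s t; rewrite -leaves_relabel /act_btree /root_at0.
case: eqP => [-> |/eqP nz_s] perm_s; first by rewrite -(perm_cons 0).
have in0 : 0 \in leaves (relabel (label_map s) t).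
  have : 0 \in iota 0 n.+1 by rewrite mem_iota.
  by rewrite -(perm_mem perm_s) inE eq_sym (negbTE nz_s).
rewrite -(perm_cons 0); apply: (perm_trans (leaves_reroot _ in0)).
exact: perm_s.
Qed.

(* The relabelling action of Aut {0, .., n} on planar unrooted trees. *)
Definition tree_act n (s : 'S_n.+1) (t : tree n) : tree n :=
  Tree (tree_act_subproof s t).

Lemma tree_sym_subproof n (s : 'S_n) (t : tree n) :
  perm_eq (leaves (relabel (label_map (lift_perm ord0 ord0 s)) t)) (iota 1 n).
Proof.
have := perm_label_map (lift_perm ord0 ord0 s) t.
by rewrite lift_permV lift_perm_id -leaves_relabel perm_cons.
Qed.

Definition tree_sym n (s : 'S_n) (t : tree n) : tree n :=
  Tree (tree_sym_subproof s t).

Lemma tree_sym_perm n (s : 'S_n) (t : tree n) :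
  tree_perm (tree_sym s t) = s * tree_perm t.
Proof.
apply/permP => i; rewrite permM; apply: val_inj => /=.
apply/eqP; rewrite -(nth_uniq 0 _ _ (uniq_leaves (tree_sym s t)));
  rewrite ?size_leaves //.
rewrite nth_tree_perm leaves_relabel (nth_map 0) ?size_leaves //.
rewrite nth_tree_perm /label_map lift_permV.
have -> : inord (s i).+1 = lift ord0 (s i) :> 'I_n.+1.
  by apply: val_inj; rewrite /= inordK // ltnS.
by rewrite lift_perm_lift permK.
Qed.

Record mor (n : nat) := Mor {
  msrc : tree n;
  mtgt : tree n;
  mrib : ribbon n;
  mor_perm : ribbon_perm mrib == (tree_perm msrc)^-1 * tree_perm mtgt
}.

Lemma mor_eq n (f g : mor n) :
  msrc f = msrc g -> mtgt f = mtgt g -> mrib f = mrib g -> f = g.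
Proof.
case: f g => [a b x fP] [a' b' x' gP] /= eq_a eq_b eq_x.
by case: _ / eq_a eq_b eq_x gP => eq_b eq_x; case: _ / eq_b; case: _ / eq_x => gP;
   rewrite (bool_irrelevance fP gP).
Qed.

Lemma mor_id_subproof n (a : tree n) :
  ribbon_perm (1 : ribbon n) == (tree_perm a)^-1 * tree_perm a.
Proof. by rewrite ribbon_perm1 mulVg. Qed.
Definition mor_id n (a : tree n) : mor n := Mor (mor_id_subproof a).

Lemma mor_inv_subproof n (f : mor n) :
  ribbon_perm (mrib f)^-1 == (tree_perm (mtgt f))^-1 * tree_perm (msrc f).
Proof. by rewrite ribbon_permV (eqP (mor_perm f)) invMg invgK. Qed.
Definition mor_inv n (f : mor n) : mor n := Mor (mor_inv_subproof f).

Lemma mor_comp_subproof n (g f : mor n) : mtgt f = msrc g ->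
  ribbon_perm (mrib g * mrib f) == (tree_perm (msrc f))^-1 * tree_perm (mtgt g).
Proof.
move=> fg; rewrite ribbon_permM (eqP (mor_perm f)) (eqP (mor_perm g)) fg.
by rewrite -mulgA mulKVg.
Qed.

(* g . f, first f and then g; the value is irrelevant if they do not match. *)
Definition mor_comp n (g f : mor n) : mor n :=
  match mtgt f =P msrc g with
  | ReflectT fg => Mor (mor_comp_subproof fg)
  | ReflectF _ => f
  end.

Lemma nth_graft n m (i : 'I_n) (x : tree n) (y : tree m) :
  (forall k : 'I_m,
     nth 0 (leaves (graft m i x y)) (tree_perm x i + k) = (i + nth 0 (leaves y) k)%N)
  /\ (forall q : 'I_n, q != tree_perm x i ->
     nth 0 (leaves (graft m i x y)) (outer_pos m (tree_perm x i) q) =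
     shift_label m i (nth 0 (leaves x) q)).
Proof.
have lt_p : tree_perm x i < size (leaves x) by rewrite size_leaves.
have xE := drop_nth 0 lt_p; rewrite nth_tree_perm in xE.
have defx := cat_take_drop (tree_perm x i) (leaves x); rewrite xE in defx.
have szt : size (take (tree_perm x i) (leaves x)) = tree_perm x i.
  by rewrite size_take size_leaves ltn_ord.
have := uniq_leaves x; have := size_leaves x; rewrite leaves_graft -defx.
move: szt; set a := take _ _; set b := drop _ _ => sza szx.
rewrite cat_uniq /= negb_or => /and3P[_ /andP[nin1 _] /andP[nin2 _]].
have szb : size b = (n - (tree_perm x i).+1)%N.
  by move: szx; rewrite size_cat /= sza; lia.
rewrite map_cat flatten_cat /= eqxx !flatten_outer //; split=> [k|q neq_q].
  rewrite nth_cat size_map sza ltnNge leq_addr /= addKn nth_cat size_map.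
  by rewrite size_leaves ltn_ord (nth_map 0) // size_leaves.
rewrite /outer_pos; case: ltnP => [lt_q|ge_q].
  rewrite nth_cat size_map sza lt_q (nth_map 0) ?sza //.
  by rewrite nth_cat sza lt_q.
have {}ge_q : tree_perm x i < q by rewrite ltn_neqAle ge_q andbT eq_sym.
rewrite nth_cat size_map sza; case: ltnP => [?|_]; first by lia.
rewrite nth_cat size_map size_leaves; case: ltnP => [?|_]; first by lia.
have lt_q := ltn_ord q.
rewrite (nth_map 0); last by rewrite szb; lia.
rewrite nth_cat sza ltnNge (ltnW ge_q) /=.
have -> : (q - tree_perm x i = (q - (tree_perm x i).+1).+1)%N by lia.
by congr (shift_label _ _ (nth _ _ _)); lia.
Qed.

Lemma mor_circ_subproof n m (i : 'I_n) (f : mor n) (g : mor m) :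
  ribbon_perm (ribbon_circ (tree_perm (msrc f) i) (mrib f) (mrib g)) ==
  (tree_perm (tree_circ i (msrc f) (msrc g)))^-1
    * tree_perm (tree_circ i (mtgt f) (mtgt g)).
Proof.
apply/tree_permP => r /=; set p := tree_perm (msrc f) i.
have fp : ribbon_perm (mrib f) p = tree_perm (mtgt f) i.
  by rewrite (eqP (mor_perm f)) permM permK.
have [in_b out_b] := nth_graft i (mtgt f) (mtgt g).
have [in_a out_a] := nth_graft i (msrc f) (msrc g).
have lt_r := ltn_ord r; have lt_p := ltn_ord p.
have [/andP[le_pr lt_rp]|out_r] := boolP (p <= r < p + m).
  have lt_k : r - p < m by lia.
  have def_r : r = p + Ordinal lt_k :> nat by rewrite /= subnKC.
  rewrite (ribbon_circ_inner _ _ def_r) fp in_b.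
  transitivity (i + nth 0 (leaves (msrc g)) (Ordinal lt_k))%N; last first.
    by rewrite -in_a -def_r.
  congr (_ + _)%N.
  exact/tree_permP/mor_perm.
pose q0 := if r < p then nat_of_ord r else (r - m).+1.
have lt_q : q0 < n by rewrite /q0; move: out_r; case: ifP; lia.
have neq_q : Ordinal lt_q != p.
  by rewrite -val_eqE /= /q0; move: out_r; case: ifP; lia.
have def_r : r = outer_pos m p (Ordinal lt_q) :> nat.
  by rewrite /outer_pos /= /q0; move: out_r; do ![case: ifP]; lia.
rewrite (ribbon_circ_outer _ _ neq_q def_r) fp out_b; last first.
  by rewrite -fp (inj_eq perm_inj).
transitivity (shift_label m i (nth 0 (leaves (msrc f)) (Ordinal lt_q))).
  by congr shift_label; apply/tree_permP/mor_perm.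
by rewrite -out_a // -def_r.
Qed.

Definition mor_circ n m (i : 'I_n) (f : mor n) (g : mor m) : mor (n + m).-1 :=
  Mor (mor_circ_subproof i f g).

Lemma mor_sym_subproof n (s : 'S_n) (f : mor n) :
  ribbon_perm (mrib f) ==
  (tree_perm (tree_sym s (msrc f)))^-1 * tree_perm (tree_sym s (mtgt f)).
Proof. by rewrite !tree_sym_perm invMg -mulgA mulKg (eqP (mor_perm f)). Qed.
Definition mor_sym n (s : 'S_n) (f : mor n) : mor n := Mor (mor_sym_subproof s f).

(* A small groupoid, with the set of all its morphisms; [cmp g f] is the
   composite "first f, then g", which is meaningful when [cod f = dom g]. *)
Record groupoid := Groupoid {
  ob : Type;
  arr : Type;
  dom : arr -> ob;
  cod : arr -> ob;
  idt : ob -> arr;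
  cmp : arr -> arr -> arr;
  inv : arr -> arr;
  dom_idt : forall x, dom (idt x) = x;
  cod_idt : forall x, cod (idt x) = x;
  dom_cmp : forall g f, cod f = dom g -> dom (cmp g f) = dom f;
  cod_cmp : forall g f, cod f = dom g -> cod (cmp g f) = cod g;
  cmp_idtl : forall f, cmp (idt (cod f)) f = f;
  cmp_idtr : forall f, cmp f (idt (dom f)) = f;
  cmpA : forall h g f, cod f = dom g -> cod g = dom h ->
    cmp h (cmp g f) = cmp (cmp h g) f;
  dom_inv : forall f, dom (inv f) = cod f;
  cod_inv : forall f, cod (inv f) = dom f;
  cmp_invl : forall f, cmp (inv f) f = idt (dom f);
  cmp_invr : forall f, cmp f (inv f) = idt (cod f)
}.

(* The structure maps of a symmetric operad on the family of sets X; the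
   composition x o_(i+1) y is [circ i x y]. *)
Record operad_ops (X : nat -> Type) := OperadOps {
  circ : forall n m, 'I_n -> X n -> X m -> X (n + m).-1;
  sym : forall n, 'S_n -> X n -> X n;
  one : X 1%N
}.

(* An operad in groupoids, given by its structure maps on objects and on
   morphisms; a cyclic structure only refers to these. *)
Record groupoid_operad := GroupoidOperad {
  gpd : nat -> groupoid;
  ob_ops : operad_ops (fun n => ob (gpd n));
  arr_ops : operad_ops (fun n => arr (gpd n))
}.

Definition zcyc n : 'S_n.+1 := perm (@ordS_inj n.+1).

(* A cyclic structure on a family of sets with operadic structure maps: right
   actions of Aut {0, .., n}, [act n s] being s^*.  As s * t is "first s, then
   t", the law (sigma rho)^* = rho^* sigma^* is [act_mul].  The subgroup fixing
   0 consists of the permutations [lift_perm ord0 ord0 s]. *)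
Record cyclic_axioms (X : nat -> Type) (O : operad_ops X)
    (act : forall n, 'S_n.+1 -> X n -> X n) : Prop := CyclicAxioms {
  act_1 : forall n x, act n 1 x = x;
  act_mul : forall n s t x, act n (s * t) x = act n s (act n t x);
  act_sym : forall n s x, act n (lift_perm ord0 ord0 s) x = sym O s x;
  act_one : act 1%N (zcyc 1%N) (one O) = one O;
  act_circ : forall n m (i j : 'I_n) (x : X n) (y : X m), j.+1 = i :> nat ->
    act (n + m).-1 (zcyc _) (circ O i x y) = circ O j (act n (zcyc n) x) y;
  act_circ1 : forall n m (i : 'I_n) (j : 'I_m) (x : X n) (y : X m)
      (e : (m + n).-1 = (n + m).-1), i = 0 :> nat -> j.+1 = m ->
    act (n + m).-1 (zcyc _) (circ O i x y) =
    ecast k (X k) e (circ O j (act m (zcyc m) y) (act n (zcyc n) x));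
  act_circ0 : forall n (i j : 'I_n) (x : X n) (y : X 0),
      i = 0 :> nat -> j.+1 = n ->
    act (n + 0).-1 (zcyc _) (circ O i x y) =
    circ O j (act n (zcyc n * zcyc n) x) y
}.

(* A cyclic structure on an operad in groupoids: actions of the groups
   Aut {0, .., n} by functors, satisfying the axioms on objects and on
   morphisms. *)
Record cyclic_structure (O : groupoid_operad)
    (act_ob : forall n, 'S_n.+1 -> ob (gpd O n) -> ob (gpd O n))
    (act_arr : forall n, 'S_n.+1 -> arr (gpd O n) -> arr (gpd O n)) : Prop :=
    CyclicStructure {
  act_dom : forall n s f, dom (act_arr n s f) = act_ob n s (dom f);
  act_cod : forall n s f, cod (act_arr n s f) = act_ob n s (cod f);
  act_idt : forall n s x, act_arr n s (idt x) = idt (act_ob n s x);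
  act_cmp : forall n s (g f : arr (gpd O n)), cod f = dom g ->
    act_arr n s (cmp g f) = cmp (act_arr n s g) (act_arr n s f);
  cyclic_ob : cyclic_axioms (ob_ops O) act_ob;
  cyclic_arr : cyclic_axioms (arr_ops O) act_arr
}.
Arguments cyclic_structure : clear implicits.

Section MorGroupoid.
Variable n : nat.
Implicit Types (f g h : mor n) (a : tree n).

Lemma mor_compT g f : mtgt f = msrc g ->
  [/\ msrc (mor_comp g f) = msrc f, mtgt (mor_comp g f) = mtgt g
    & mrib (mor_comp g f) = mrib g * mrib f].
Proof. by rewrite /mor_comp; case: eqP. Qed.

Lemma msrc_comp g f : mtgt f = msrc g -> msrc (mor_comp g f) = msrc f.
Proof. by case/mor_compT. Qed.

Lemma mtgt_comp g f : mtgt f = msrc g -> mtgt (mor_comp g f) = mtgt g.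
Proof. by case/mor_compT. Qed.

Lemma mrib_comp g f : mtgt f = msrc g -> mrib (mor_comp g f) = mrib g * mrib f.
Proof. by case/mor_compT. Qed.

Lemma mor_comp_idl f : mor_comp (mor_id (mtgt f)) f = f.
Proof.
by apply: mor_eq; rewrite ?msrc_comp ?mtgt_comp ?mrib_comp //= mul1g.
Qed.

Lemma mor_comp_idr f : mor_comp f (mor_id (msrc f)) = f.
Proof.
by apply: mor_eq; rewrite ?msrc_comp ?mtgt_comp ?mrib_comp //= mulg1.
Qed.

Lemma mor_compA h g f : mtgt f = msrc g -> mtgt g = msrc h ->
  mor_comp h (mor_comp g f) = mor_comp (mor_comp h g) f.
Proof.
move=> fg gh; have fgh : mtgt (mor_comp g f) = msrc h by rewrite mtgt_comp.
have fgh' : mtgt f = msrc (mor_comp h g) by rewrite msrc_comp.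
by apply: mor_eq; rewrite ?(msrc_comp fgh) ?(msrc_comp fgh') ?(mtgt_comp fgh)
  ?(mtgt_comp fgh') ?(mrib_comp fgh) ?(mrib_comp fgh') ?msrc_comp ?mtgt_comp
  ?mrib_comp // mulgA.
Qed.

Lemma mor_comp_invl f : mor_comp (mor_inv f) f = mor_id (msrc f).
Proof.
by apply: mor_eq; rewrite ?msrc_comp ?mtgt_comp ?mrib_comp //= mulVg.
Qed.

Lemma mor_comp_invr f : mor_comp f (mor_inv f) = mor_id (mtgt f).
Proof.
by apply: mor_eq; rewrite ?msrc_comp ?mtgt_comp ?mrib_comp //= mulgV.
Qed.

Definition PaRB_gpd : groupoid :=
  @Groupoid (tree n) (mor n) (@msrc n) (@mtgt n) (@mor_id n) (@mor_comp n)
    (@mor_inv n) (fun=> erefl) (fun=> erefl) msrc_comp mtgt_comp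
    mor_comp_idl mor_comp_idr mor_compA (fun=> erefl) (fun=> erefl)
    mor_comp_invl mor_comp_invr.

End MorGroupoid.

Definition PaRB : groupoid_operad :=
  @GroupoidOperad PaRB_gpd
    (@OperadOps tree tree_circ tree_sym tree_one)
    (@OperadOps mor mor_circ mor_sym (mor_id tree_one)).

Lemma mu_subproof : perm_eq (leaves (Node (Leaf 1) (Leaf 2))) (iota 1 2).
Proof. by []. Qed.
Definition mu : tree 2 := Tree mu_subproof.

Lemma mu21_subproof : perm_eq (leaves (Node (Leaf 2) (Leaf 1))) (iota 1 2).
Proof. by []. Qed.
Definition mu21 : tree 2 := Tree mu21_subproof.

Lemma tau_subproof :
  ribbon_perm (Ribbon 1 [ffun=> 1%R] : ribbon 1) ==
  (tree_perm tree_one)^-1 * tree_perm tree_one.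
Proof. by rewrite /ribbon_perm braid_perm1 mulVg. Qed.
Definition tau : mor 1 := Mor tau_subproof.

Lemma beta12_subproof :
  ribbon_perm (Ribbon (@sigma 2 (@ord0 0)) [ffun=> 0%R] : ribbon 2) ==
  (tree_perm mu)^-1 * tree_perm mu21.
Proof.
apply/tree_permP => p; rewrite /ribbon_perm /= braid_perm_wbraid /= mul1g.
by rewrite letter_permE; case: p => [[|[|]]].
Qed.
Definition beta12 : mor 2 := Mor beta12_subproof.

Lemma alpha123_subproof :
  ribbon_perm (1 : ribbon 3) ==
  (tree_perm (tree_circ ord0 mu mu))^-1 * tree_perm (tree_circ ord_max mu mu).
Proof. by apply/tree_permP => p; rewrite ribbon_perm1 perm1. Qed.
Definition alpha123 : mor 3 := Mor alpha123_subproof.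

(* [mor_sym s] replaces the inputs 1, 2, 3 by 2, 3, 1 if the inverse of s is
   the cycle 1 -> 2 -> 3 -> 1. *)
Definition alpha231 : mor 3 := mor_sym (perm (@ordS_inj 3))^-1 alpha123.

(* The transposition (0 1) in Aut {0, .., n + 1}. *)
Definition s0 n : 'S_n.+2 := tperm ord0 (lift ord0 ord0).

(* Main.v *)
Require Import Defs.
From HB Require Import structures.
From mathcomp Require Import all_boot all_fingroup all_algebra.
From mathcomp Require Import generic_quotient zify boolp.

Set Implicit Arguments.
Unset Strict Implicit.
Unset Printing Implicit Defensive.

Local Open Scope group_scope.

(** Seen on the sphere, a ribbon braid on n strands has one more strand, the
    root, and the ribbon braid group of n strands is the stabiliser of the root
    in the framed mapping class group of the sphere with n + 1 holes.  Letting
    another strand play the role of the root turns a crossing that does not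
    involve it into a crossing in rotated positions; the crossing of the new
    root with a neighbour becomes the inverse of the braid in which one strand
    passes all the others and is twisted once ([swing], [swing']), and a twist
    of the new root becomes the full twist of all the ribbons ([full_spin]).  These
    rules define a cocycle [rebase q] on the ribbon braid group for every
    position q of the new root; it respects the braid relations, satisfies
    [rebase (r - q) (rebase q x) = rebase r x], and is compatible with the
    insertion of ribbon braids into ribbons.  Each of these identities between
    cocycles only has to be checked on generators.

    A permutation s of the labels acts on a morphism f by relabelling the two
    trees and by [rebase q], where q is the position of the label s 0 in the
    source of f.  This gives existence.  Uniqueness holds because the associator,
    the braiding and the twist generate all the morphisms: the action of (0 1)
    on the associator determines the action of the whole group on it, since (0 1)
    and the permutations fixing 0 produce a 4-cycle sending the associator to
    its inverse, and on the braiding because its square is a product of twists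
    of the root and of the inputs. *)

(** * Generators of the ribbon braid groups *)

(** Seen from one strand, the other strands and the old root form a row. When the new root exchanges
    places with a neighbour, that neighbour goes from one end of the row to the other, which is an
    inverse [swing] or [swing']. Thanks to the framing twist in its definition, the n-th power of
    the swing on n strands is a rigid full rotation, that is, the twist of the root; the factor
    [tau^-1] in the value of [s0] on the braiding is this twist. Braids being classes of words, the
    obstacle is that every braid relation must hold for every location of the new root among the
    strands. The cases in which the new root takes part rest on two facts: conjugation by a swing
    shifts crossings by one position, and [full_spin] is central. For partial compositions the
    question is whether the strand of input 1, which [zcyc] makes the root, lies outside the
    inserted block or inside it. Outside, the inserted factor is left alone; inside, the two factors
    exchange their roles, as in the axiom for the first input. *)

Section RibbonElements.
Variable N : nat.
Implicit Types (x y : ribbon N) (b : braid N) (i j k l m r : nat).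

Lemma ribbon_eq x y : rbraid x = rbraid y -> rtwist x =1 rtwist y -> x = y.
Proof. by case: x y => [b t] [b' t'] /= -> /ffunP ->. Qed.

(* Maps on positions are handled on nat, and are the identity outside the
   range of the positions. *)
Definition npos x r : nat := oapp (fun p => nat_of_ord (ribbon_perm x p)) r (insub r).

Lemma npos_ord x (p : 'I_N) : npos x p = ribbon_perm x p.
Proof. by rewrite /npos valK. Qed.

Lemma npos_out x r : N <= r -> npos x r = r.
Proof. by move=> le_r; rewrite /npos insubF // ltnNge le_r. Qed.

Lemma nposM x y r : npos (x * y) r = npos x (npos y r).
Proof.
case: (ltnP r N) => [lt_r|?]; last by rewrite !npos_out.
rewrite -[r]/(nat_of_ord (Ordinal lt_r)) !npos_ord.
by rewrite ribbon_permM permM.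
Qed.

Lemma npos1 r : npos 1 r = r.
Proof.
case: (ltnP r N) => [lt_r|?]; last by rewrite !npos_out.
by rewrite -[r]/(nat_of_ord (Ordinal lt_r)) !npos_ord ribbon_perm1 perm1.
Qed.

Lemma nposK x : cancel (npos x) (npos x^-1).
Proof. by move=> r; rewrite -nposM mulVg npos1. Qed.

Lemma nposVK x : cancel (npos x^-1) (npos x).
Proof. by move=> r; rewrite -nposM mulgV npos1. Qed.

Lemma npos_inj x : injective (npos x).
Proof. exact: can_inj (nposK x). Qed.

Lemma npos_lt x r : (npos x r < N) = (r < N).
Proof.
case: (ltnP r N) => [lt_r|?]; last by rewrite npos_out // ltnNge; lia.
by rewrite -[r]/(nat_of_ord (Ordinal lt_r)) npos_ord ltn_ord.
Qed.

Lemma rbraidM x y : rbraid (x * y) = rbraid x * rbraid y.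
Proof. by []. Qed.

Lemma rtwistM x y p :
  rtwist (x * y) p = (rtwist y p + rtwist x (ribbon_perm y p))%R.
Proof. exact: ffunE. Qed.

Definition flat b : ribbon N := Ribbon b [ffun=> 0%R].

Lemma flatM b b' : flat (b * b') = flat b * flat b'.
Proof.
by apply: ribbon_eq => //= p; rewrite !ffunE /= GRing.addr0.
Qed.

Lemma flat1 : flat 1 = 1.
Proof. by []. Qed.

Lemma flatV b : flat b^-1 = (flat b)^-1.
Proof. by apply: (mulgI (flat b)); rewrite mulgV -flatM mulgV. Qed.

Definition twists (t : {ffun 'I_N -> int}) : ribbon N := Ribbon 1 t.

Lemma twistsD t t' : twists (t + t')%R = twists t * twists t'.
Proof.
apply: ribbon_eq => [|p] /=; first by rewrite mulg1.
by rewrite !ffunE /= braid_perm1 perm1 GRing.addrC.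
Qed.

Lemma twists0 : twists 0%R = 1.
Proof. by apply: ribbon_eq => [|p] //=; rewrite !ffunE. Qed.

Lemma twistsC t t' : commute (twists t) (twists t').
Proof. by rewrite /commute -!twistsD GRing.addrC. Qed.

Lemma twistsN t : twists (- t)%R = (twists t)^-1.
Proof. by apply: (mulgI (twists t)); rewrite mulgV -twistsD GRing.subrr twists0. Qed.

Lemma flat_twists x : x = flat (rbraid x) * twists (rtwist x).
Proof.
by apply: ribbon_eq => [|p] /=; rewrite ?mulg1 // !ffunE /= GRing.addr0.
Qed.

Lemma ribbon_conj x (t : {ffun 'I_N -> int}) :
  x * twists [ffun p => t (ribbon_perm x p)] = twists t * x.
Proof.
apply: ribbon_eq => [|p] /=; first by rewrite mulg1 mul1g.
by rewrite !ffunE /= braid_perm1 perm1 GRing.addrC.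
Qed.

End RibbonElements.

(** An index out of range gives the identity here, so indices can stay in [nat] and bounds are
    required only where a relation uses them. *)
HB.lock Definition spin N (r : nat) : ribbon N := twists [ffun p : 'I_N => (val p == r)%:R%R].
HB.lock Definition cross N k : ribbon N := flat (gen N k).
HB.lock Definition fup N i m : ribbon N := flat (up N i m).
HB.lock Definition fdown N i m : ribbon N := flat (down N i m).

Section RibbonGenerators.
Variable N : nat.
Implicit Types (x y : ribbon N) (b : braid N) (i j k l m r : nat).
Notation cross := (cross N).
Notation spin := (spin N).
Notation fup := (fup N).
Notation fdown := (fdown N).

Lemma spinE r : spin r = twists [ffun p : 'I_N => (val p == r)%:R%R].
Proof. by rewrite spin.unlock. Qed.

Lemma crossE k : cross k = flat (gen N k).
Proof. by rewrite cross.unlock. Qed.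

Lemma fupE i m : fup i m = flat (up N i m).
Proof. by rewrite fup.unlock. Qed.

Lemma fdownE i m : fdown i m = flat (down N i m).
Proof. by rewrite fdown.unlock. Qed.

Lemma spinC r r' : spin r * spin r' = spin r' * spin r.
Proof. by rewrite !spinE; apply: twistsC. Qed.

Lemma spin_conj x r : x * spin r = spin (npos x r) * x.
Proof.
rewrite !spinE -[RHS]ribbon_conj; congr (_ * twists _); apply/ffunP => p.
by rewrite !ffunE -[X in X == npos x r]npos_ord (inj_eq (@npos_inj _ x)).
Qed.

Lemma npos_flat_word (s : seq (nat * bool)) r :
  all (fun a => a.1 < N.-1) s ->
  npos (flat (wbraid (to_word N s))) r = word_act s r.
Proof.
move=> s_lt; case: (ltnP r N) => [lt_r|le_r].
  rewrite -[r]/(nat_of_ord (Ordinal lt_r)) npos_ord /ribbon_perm /=.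
  by rewrite braid_perm_wbraid word_perm_act.
rewrite npos_out //; elim: s s_lt => //= a s IH /andP[lt_a /IH <-].
by rewrite /swapn; do ![case: ifP]; lia.
Qed.

Lemma npos_spin r q : npos (spin r) q = q.
Proof.
case: (ltnP q N) => [lt_q|?]; last by rewrite npos_out.
rewrite -[q]/(nat_of_ord (Ordinal lt_q)) npos_ord spinE /ribbon_perm /=.
by rewrite braid_perm1 perm1.
Qed.

Lemma npos_cross k r : k.+1 < N -> npos (cross k) r = swapn k r.
Proof. by move=> lt_k; rewrite crossE npos_flat_word //= andbT; lia. Qed.

Lemma npos_fup i m r : i + m < N -> npos (fup i m) r =
  if r == i + m then i else if i <= r < i + m then r.+1 else r.
Proof.
move=> lt_im; rewrite fupE npos_flat_word ?word_act_up //.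
by rewrite all_map; apply/allP => k; rewrite mem_iota /=; lia.
Qed.

Lemma npos_fdown i m r : i + m < N -> npos (fdown i m) r =
  if r == i then i + m else if i < r <= i + m then r.-1 else r.
Proof.
move=> lt_im; rewrite fdownE npos_flat_word ?word_act_down //.
by rewrite all_map all_rev; apply/allP => k; rewrite mem_iota /=; lia.
Qed.

Lemma fup0 i : fup i 0 = 1. Proof. by rewrite fupE. Qed.
Lemma fdown0 i : fdown i 0 = 1. Proof. by rewrite fdownE. Qed.

Lemma fupS i m : fup i m.+1 = fup i m * cross (i + m).
Proof. by rewrite !fupE crossE upS flatM. Qed.

Lemma fdownS i m : fdown i m.+1 = cross (i + m) * fdown i m.
Proof. by rewrite !fdownE crossE downS flatM. Qed.

Lemma fupD i m m' : fup i (m + m') = fup i m * fup (i + m) m'.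
Proof.
elim: m' => [|m' IH]; first by rewrite addn0 fup0 mulg1.
by rewrite addnS !fupS IH mulgA addnA.
Qed.

Lemma fdownD i m m' : fdown i (m + m') = fdown (i + m) m' * fdown i m.
Proof.
elim: m' => [|m' IH]; first by rewrite addn0 fdown0 mul1g.
by rewrite addnS !fdownS IH mulgA addnA.
Qed.

Lemma fup1 i : fup i 1 = cross i.
Proof. by rewrite fupS addn0 fup0 mul1g. Qed.

Lemma fdown1 i : fdown i 1 = cross i.
Proof. by rewrite fdownS addn0 fdown0 mulg1. Qed.

Lemma fupSl i m : fup i m.+1 = cross i * fup i.+1 m.
Proof. by rewrite -add1n fupD fup1 addn1. Qed.

Lemma fdownSl i m : fdown i m.+1 = fdown i.+1 m * cross i.
Proof. by rewrite -add1n fdownD fdown1 addn1. Qed.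

Lemma cross_far k l : (k.+1 < l) || (l.+1 < k) ->
  cross k * cross l = cross l * cross k.
Proof. by rewrite !crossE -!flatM => /orP[] /gen_far ->. Qed.

Lemma cross_braid k : k.+2 < N ->
  cross k * cross k.+1 * cross k = cross k.+1 * cross k * cross k.+1.
Proof. by move=> lt_k; rewrite !crossE -!flatM gen_braid //; lia. Qed.

Lemma cross_fup_far l i m : (l.+1 < i) || (i + m < l) ->
  cross l * fup i m = fup i m * cross l.
Proof. by move=> far; rewrite !crossE !fupE -!flatM far_up. Qed.

Lemma cross_fdown_far l i m : (l.+1 < i) || (i + m < l) ->
  cross l * fdown i m = fdown i m * cross l.
Proof. by move=> far; rewrite !crossE !fdownE -!flatM far_down. Qed.

Lemma cross_spin k r : k.+1 < N -> cross k * spin r = spin (swapn k r) * cross k.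
Proof. by move=> lt_k; rewrite spin_conj npos_cross. Qed.

(** Only the factors [cross k] and [cross k.+1] of [fup i m] interact with the crossing, through a
    single braid relation; all the other factors are far from it on the side where it passes
    them. *)
Lemma fup_cross i m k : i <= k -> k.+1 < i + m -> i + m < N ->
  fup i m * cross k = cross k.+1 * fup i m.
Proof.
move=> le_ik lt_km lt_N.
have -> : m = (k - i).+2 + (i + m - k.+2) by lia.
rewrite fupD !fupS.
have -> : i + (k - i) = k by lia.
have -> : i + (k - i).+1 = k.+1 by lia.
have -> : i + (k - i).+2 = k.+2 by lia.
rewrite -!mulgA -cross_fup_far; last by lia.
rewrite !mulgA; congr (_ * _).
rewrite cross_fup_far; last by lia.
rewrite -!mulgA; congr (_ * _); rewrite !mulgA; apply: cross_braid; lia.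
Qed.

Lemma fdown_cross i m k : i <= k -> k.+1 < i + m -> i + m < N ->
  fdown i m * cross k.+1 = cross k * fdown i m.
Proof.
move=> le_ik lt_km lt_N.
have -> : m = (k - i).+2 + (i + m - k.+2) by lia.
rewrite fdownD !fdownS.
have -> : i + (k - i) = k by lia.
have -> : i + (k - i).+1 = k.+1 by lia.
have -> : i + (k - i).+2 = k.+2 by lia.
rewrite -!mulgA -(@cross_fdown_far k.+1); last by lia.
rewrite !mulgA; congr (_ * _).
rewrite cross_fdown_far; last by lia.
rewrite -!mulgA; congr (_ * _); rewrite !mulgA; apply/esym/cross_braid; lia.
Qed.

End RibbonGenerators.

(* The strand in position i + m passes under the m strands to its left, and is
   twisted once; in the mirror image [swing'] the strand in position i passes
   over the m strands to its right. *)
HB.lock Definition swing N i m : ribbon N := fup N i m * spin N (i + m).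
HB.lock Definition swing' N i m : ribbon N := fdown N i m * spin N i.

Section Swing.
Variable N : nat.
Implicit Types (i j k l m r : nat).
Notation cross := (cross N).
Notation spin := (spin N).
Notation fup := (fup N).
Notation fdown := (fdown N).
Notation swing := (swing N).
Notation swing' := (swing' N).

Lemma swingE i m : swing i m = fup i m * spin (i + m).
Proof. by rewrite swing.unlock. Qed.

Lemma swing'E i m : swing' i m = fdown i m * spin i.
Proof. by rewrite swing'.unlock. Qed.

Lemma npos_swing i m r : i + m < N -> npos (swing i m) r =
  if r == i + m then i else if i <= r < i + m then r.+1 else r.
Proof. by move=> lt_im; rewrite swingE nposM npos_spin npos_fup. Qed.

Lemma npos_swing' i m r : i + m < N -> npos (swing' i m) r =
  if r == i then i + m else if i < r <= i + m then r.-1 else r.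
Proof. by move=> lt_im; rewrite swing'E nposM npos_spin npos_fdown. Qed.

Lemma swing_cross i m k : i <= k -> k.+1 < i + m -> i + m < N ->
  swing i m * cross k = cross k.+1 * swing i m.
Proof.
move=> le_ik lt_km lt_N; rewrite !swingE mulgA -fup_cross // -!mulgA.
congr (_ * _); rewrite cross_spin; last by lia.
by congr (spin _ * _); rewrite /swapn; do ![case: ifP]; lia.
Qed.

Lemma swing'_cross i m k : i <= k -> k.+1 < i + m -> i + m < N ->
  swing' i m * cross k.+1 = cross k * swing' i m.
Proof.
move=> le_ik lt_km lt_N; rewrite !swing'E mulgA -fdown_cross // -!mulgA.
congr (_ * _); rewrite cross_spin; last by lia.
by congr (spin _ * _); rewrite /swapn; do ![case: ifP]; lia.
Qed.

End Swing.

(** The braid part is a word in crossings and their inverses, the framing part an integral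
    combination of unit twists. *)
Lemma ribbon_ind n (K : ribbon n -> Prop) :
  K 1 -> (forall x y, K x -> K y -> K (x * y)) -> (forall x, K x -> K x^-1) ->
  (forall k, k.+1 < n -> K (cross n k)) -> (forall r, r < n -> K (spin n r)) ->
  forall x, K x.
Proof.
move=> K1 KM KV Kc Ks x; rewrite (flat_twists x); apply: (KM).
  rewrite -(wbraid_repr (rbraid x)); elim: (repr _) => [|[i b] w IH] //.
  rewrite -cat1s wbraidM flatM; apply: (KM) => //.
  have KT : K (flat (wbraid [:: (i, true)])).
    have := Kc i (letter_ltS i); rewrite crossE /gen (to_word1 _ (ltn_ord i)).
    by congr (K (flat (wbraid [:: (_, _)]))); apply: val_inj.
  case: b => //.
  have -> : wbraid [:: (i, false)] = (wbraid [:: (i, true)])^-1.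
    by rewrite -wbraidV.
  by rewrite flatV; apply: KV.
pose K' t := K (twists t).
have K'D t t' : K' t -> K' t' -> K' (t + t')%R.
  by rewrite /K' twistsD; apply: KM.
have K'0 : K' 0%R by rewrite /K' twists0.
have K'N t : K' t -> K' (- t)%R by rewrite /K' twistsN; apply: KV.
rewrite -/(K' _); set t := rtwist x.
have -> : t = (\sum_(r < n) [ffun p : 'I_n => (val p == val r)%:R * t r])%R.
  apply/ffunP => p; rewrite sum_ffunE (bigD1 p) //= ffunE eqxx GRing.mul1r.
  rewrite big1 ?GRing.addr0 // => r neq; rewrite ffunE.
  by rewrite val_eqE eq_sym (negbTE neq) GRing.mul0r.
apply: (big_ind K') => // r _.
have K'n (k : nat) : K' [ffun p : 'I_n => (val p == val r)%:R * k%:Z]%R.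
  elim: k => [|k IH].
    by rewrite [X in K' X](_ : _ = 0)%R //; apply/ffunP => p; rewrite !ffunE GRing.mulr0.
  rewrite [X in K' X](_ : _ = [ffun p : 'I_n => (val p == val r)%:R * k%:Z] +
     [ffun p : 'I_n => (val p == val r)%:R : int])%R.
    by apply: (K'D _ _ IH); have := Ks _ (ltn_ord r); rewrite spinE.
  by apply/ffunP => p; rewrite !ffunE intS GRing.mulrDr GRing.mulr1 GRing.addrC.
case: (t r) => k; first exact: K'n.
rewrite [X in K' X](_ : _ = - [ffun p : 'I_n => (val p == val r)%:R * k.+1%:Z])%R.
  exact/K'N/K'n.
by apply/ffunP => p; rewrite !ffunE NegzE GRing.mulrN.
Qed.

(* Conversion would otherwise try to compare products of ribbon braids through
   representatives of the underlying braids. *)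
Global Opaque ribbon_mul ribbon_inv.

(** * Powers of the swing and the full rotation *)

Section SwingPowers.
Variable N : nat.
Implicit Types (i j k l m r : nat).
Notation cross := (cross N).
Notation spin := (spin N).
Notation fup := (fup N).
Notation fdown := (fdown N).
Notation swing := (swing N).
Notation swing' := (swing' N).

Lemma swing_fup i m j l : i <= j -> j + l < i + m -> i + m < N ->
  swing i m * fup j l = fup j.+1 l * swing i m.
Proof.
move=> le_ij; elim: l => [|l IH] lt_l lt_N; first by rewrite !fup0 mul1g mulg1.
rewrite !fupS mulgA IH; [|lia|lia].
by rewrite -!mulgA addSn swing_cross //; lia.
Qed.

Lemma swing'_fdown i m j l : i <= j -> j + l < i + m -> i + m < N ->
  swing' i m * fdown j.+1 l = fdown j l * swing' i m.
Proof.
move=> le_ij; elim: l => [|l IH] lt_l lt_N; first by rewrite !fdown0 mul1g mulg1.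
rewrite !fdownS mulgA addSn swing'_cross; [|lia|lia|lia].
by rewrite -!mulgA IH //; lia.
Qed.

(** Crossings of two blocks. In [grid], [k] strands pass one by one under the [l] strands to their
    left; in [grid'], [k] strands, the last of them in position [i], pass one by one over the [l]
    strands to their right. *)
Fixpoint grid i l k : ribbon N :=
  if k is k'.+1 then fup (i + k') l * grid i l k' else 1.
Fixpoint grid' i l k : ribbon N :=
  if k is k'.+1 then fdown (i - k') l * grid' i l k' else 1.

Lemma swingD i l m : swing i (l + m) = fup i l * swing (i + l) m.
Proof. by rewrite !swingE fupD -mulgA addnA. Qed.

Lemma swing'D i l m : swing' i (m + l) = fdown (i + m) l * swing' i m.
Proof. by rewrite !swing'E fdownD -mulgA. Qed.

(* Moving k strands one after the other past the first l strands moves them as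
   a block, up to the powers of the swing of the last m + 1 strands. *)
Lemma swing_pow i l m k : k <= m.+1 -> i + (l + m) < N ->
  swing i (l + m) ^+ k = grid i l k * swing (i + l) m ^+ k.
Proof.
move=> + lt_N; elim: k => [|k IH] le_k; first by rewrite mulg1.
have slide j : j <= k ->
    swing i (l + m) ^+ j * fup i l = fup (i + j) l * swing i (l + m) ^+ j.
  elim: j => [|j IHj] le_j; first by rewrite addn0 mul1g mulg1.
  rewrite monoid.expgS -mulgA IHj; last by lia.
  by rewrite mulgA swing_fup ?addnS -?mulgA //; lia.
rewrite monoid.expgSr {2}swingD mulgA slide // -mulgA IH; last by lia.
by rewrite /= monoid.expgSr !mulgA.
Qed.

Lemma swing'_pow i l m k : k <= m.+1 -> i + (m + l) < N ->
  swing' i (m + l) ^+ k = grid' (i + m) l k * swing' i m ^+ k.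
Proof.
move=> + lt_N; elim: k => [|k IH] le_k; first by rewrite mulg1.
have slide j : j <= k ->
    swing' i (m + l) ^+ j * fdown (i + m) l = fdown (i + m - j) l * swing' i (m + l) ^+ j.
  elim: j => [|j IHj] le_j; first by rewrite subn0 mul1g mulg1.
  rewrite monoid.expgS -mulgA IHj; last by lia.
  have -> : i + m - j = (i + m - j.+1).+1 by lia.
  by rewrite mulgA swing'_fdown -?mulgA //; lia.
rewrite monoid.expgSr {2}swing'D mulgA slide // -mulgA IH; last by lia.
by rewrite /= monoid.expgSr !mulgA.
Qed.

Lemma grid_fdown i k : grid i 1 k = fdown i k.
Proof. by elim: k => [|k IH] /=; rewrite ?fdown0 // IH fup1 fdownS. Qed.

Lemma grid'_fup i k : k <= i.+1 -> grid' i 1 k = fup (i.+1 - k) k.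
Proof.
elim: k => [|k IH] le_k /=; first by rewrite fup0.
rewrite IH ?fdown1; last by lia.
rewrite fupSl; congr (cross _ * fup _ _); lia.
Qed.

Lemma swing_swing i m l j : i <= j -> j + l < i + m -> i + m < N ->
  swing i m * swing j l = swing j.+1 l * swing i m.
Proof.
move=> le_ij lt_l lt_N; rewrite (swingE _ j) mulgA swing_fup // -mulgA spin_conj.
rewrite npos_swing // (ltn_eqF lt_l) lt_l (leq_trans le_ij (leq_addr _ _)).
by rewrite mulgA (swingE _ j.+1).
Qed.

Lemma commute_pow (G : groupType) (x y z : G) k :
  x * y = z * x -> x * y ^+ k = z ^+ k * x.
Proof.
move=> xy; elim: k => [|k IH]; first by rewrite mulg1 mul1g.
by rewrite !monoid.expgSr mulgA IH -!mulgA xy.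
Qed.

(** Both sides are one full rotation of [m.+1] ribbons. The lemmas on powers, with [l = 1], split
    off the path of a single strand and leave a rotation of fewer strands; the two remainders sit
    one position apart and are matched by conjugation with a swing. *)
Lemma swing_swing' i m : i + m < N -> swing i m ^+ m.+1 = swing' i m ^+ m.+1.
Proof.
elim: m => [|m IH] lt_N; first by rewrite swingE swing'E fup0 fdown0 addn0.
have E : swing i m.+1 ^+ m.+1 = fdown i m.+1 * swing i.+1 m ^+ m.+1.
  by have := @swing_pow i 1 m m.+1; rewrite add1n addn1 grid_fdown; apply.
have E' : swing' i m.+1 ^+ m.+1 = fup i m.+1 * swing' i m ^+ m.+1.
  have := @swing'_pow i 1 m m.+1; rewrite addn1 grid'_fup; last by lia.
  have -> : (i + m).+1 - m.+1 = i by lia.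
  exact.
rewrite monoid.expgSr E [RHS]monoid.expgS E' -IH; last by lia.
rewrite -mulgA -(@commute_pow _ _ (swing i m)); last by rewrite swing_swing //; lia.
rewrite !mulgA; congr (_ * _); rewrite !swingE !swing'E -!mulgA; congr (_ * _).
by rewrite spin_conj npos_fup // eqxx.
Qed.

(** The rotation of all ribbons by a full turn: its braid is [full_twist] and each ribbon is twisted
    once, see [full_spin_flat]. As a power of the swing it can be handled by the conjugation rules
    for swings. *)
Definition full_spin : ribbon N := swing 0 N.-1 ^+ N.

Lemma full_spin' : full_spin = swing' 0 N.-1 ^+ N.
Proof.
rewrite /full_spin; case: (posnP N) => [N0|N_gt0].
  by rewrite [X in _ ^+ X = _]N0 [X in _ = _ ^+ X]N0.
have := @swing_swing' 0 N.-1; rewrite add0n prednK //.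
by apply.
Qed.

(* Conjugation by the swing of all the strands shifts each crossing to the next
   one; for the last crossing this only makes sense for the square. *)
Lemma swing_last m : m.+2 = N ->
  swing 0 m.+1 ^+ 2 * cross m = cross 0 * swing 0 m.+1 ^+ 2.
Proof.
move=> defN; set s := spin m * spin m.+1.
have sE : swing 0 m.+1 ^+ 2 = fup 0 m.+1 * fup 0 m.+1 * s.
  rewrite monoid.expgS monoid.expg1 !swingE add0n /s -!mulgA; congr (_ * _).
  rewrite !mulgA; congr (_ * _); rewrite spin_conj npos_fup; last by lia.
  by rewrite add0n (ltn_eqF (ltnSn _)) /= ltnSn.
have sC : s * cross m = cross m * s.
  rewrite /s [RHS]mulgA cross_spin; last by lia.
  rewrite -[RHS]mulgA cross_spin; last by lia.
  by rewrite [RHS]mulgA [in LHS]spinC /swapn !eqxx gtn_eqF.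
have slide : fup 0 m.+1 * fup 0 m.+1 = fup 1 m * fup 0 m * cross m * cross m.
  rewrite {1}fupSl fupS mulgA add0n; congr (_ * _).
  have := @up_slide N 0 m; rewrite add0n => S; have /S {}S : m < N.-1 by lia.
  by rewrite !crossE !fupE -!flatM S.
have := @up_slide N 0 m; rewrite add0n => S; have /S {}S : m < N.-1 by lia.
have S' : cross 0 * fup 1 m * fup 0 m = fup 1 m * fup 0 m * cross m.
  by rewrite !crossE !fupE -!flatM S.
by rewrite sE -mulgA sC slide !mulgA S'.
Qed.

Lemma full_spin_cross k : k.+1 < N -> full_spin * cross k = cross k * full_spin.
Proof.
move=> lt_k; pose m := N.-2; have defN : m.+2 = N by lia.
set V := swing 0 m.+1; have le_k : k <= m by lia.
(* The exponent follows the crossing around the circle: [m - k] steps take it from [k] to the last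
   index [m], two more to index 0 by [swing_last], and [k] steps back to [k]. *)
have -> : full_spin = V ^+ (k + 2 + (m - k)).
  by congr (swing 0 _ ^+ _); lia.
have step j : j < m -> V * cross j = cross j.+1 * V.
  by move=> lt_j; apply: swing_cross; lia.
have pow j : j <= m -> V ^+ j * cross 0 = cross j * V ^+ j.
  elim: j => [|j IH] le_j; first by rewrite mul1g mulg1.
  by rewrite monoid.expgS -mulgA IH ?mulgA ?step //; apply: ltnW.
have pow' : V ^+ (m - k) * cross k = cross m * V ^+ (m - k).
  have E : V ^+ m = V ^+ (m - k) * V ^+ k by rewrite -monoid.expgnDr subnK.
  have := pow m (leqnn _); rewrite E -mulgA pow //.
  by rewrite !mulgA => /mulIg.
rewrite !monoid.expgnDr -mulgA pow' (mulgA _ (cross m)) -(mulgA _ _ (cross m)).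
by rewrite swing_last // !mulgA pow.
Qed.

Lemma npos_full_spin r : npos full_spin r = r.
Proof.
case: (ltnP r N) => [lt_r|?]; last by rewrite npos_out.
have lt_N : 0 + N.-1 < N by lia.
have pow k q : q < N -> npos (swing 0 N.-1 ^+ k) q = ((q + k) %% N)%N.
  move=> lt_q; elim: k => [|k IH]; first by rewrite npos1 addn0 modn_small.
  rewrite monoid.expgS nposM IH npos_swing // add0n addnS.
  have := ltn_pmod (q + k) (leq_ltn_trans (leq0n _) lt_q).
  have -> : ((q + k).+1 %% N = ((q + k) %% N).+1 %% N)%N.
    by rewrite -addn1 -modnDml addn1.
  move: ((q + k) %% N)%N => u lt_u.
  case: eqP => [->|neq]; first by rewrite prednK ?modnn //; lia.
  by rewrite modn_small; [case: ifP; lia|lia].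
by rewrite pow // modnDr modn_small.
Qed.

Lemma full_spinC x : commute full_spin x.
Proof.
elim/ribbon_ind: x => [|x y Cx Cy|x Cx|k lt_k|r lt_r].
- exact: commute1.
- exact: commuteM.
- exact: commuteV.
- exact: full_spin_cross.
- by rewrite /commute spin_conj npos_full_spin.
Qed.

End SwingPowers.
(** * Change of root *)

Lemma expgzS (G : groupType) (x : G) k : expgz x (k + 1)%R = expgz x k * x.
Proof.
case: k => [k|[|k]].
- have -> : (Posz k + 1)%R = Posz k.+1 by lia.
  by rewrite /= monoid.expgSr.
- have -> : (Negz 0 + 1)%R = Posz 0 by lia.
  by rewrite /= mulVg.
- have -> : (Negz k.+1 + 1)%R = Negz k by lia.
  by rewrite /= [x ^+ k.+2]monoid.expgS invgM -mulgA mulVg mulg1.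
Qed.

Lemma expgzD (G : groupType) (x : G) j k :
  expgz x (j + k)%R = expgz x j * expgz x k.
Proof.
elim/int_rec: k => [|k IH|k IH]; first by rewrite GRing.addr0 mulg1.
  have -> : (j + k.+1%:Z = (j + k%:Z) + 1)%R by lia.
  have -> : (k.+1%:Z = k%:Z + 1)%R by lia.
  by rewrite !expgzS IH mulgA.
apply: (mulIg x); rewrite -mulgA -!expgzS.
have -> : (j - k.+1%:Z + 1 = j - k%:Z)%R by lia.
by have -> : (- k.+1%:Z + 1 = - k%:Z)%R by lia.
Qed.

Lemma expgz_commute (G : groupType) (x y : G) k : commute x y -> commute (expgz x k) y.
Proof.
move=> xy; have yX j : commute (x ^+ j) y by apply/commute_sym/commuteX/commute_sym.
by case: k => j /=; [exact: yX | exact/commute_sym/commuteV/commute_sym/yX].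
Qed.

Lemma commute_invl (G : groupType) (x y z : G) :
  x * y = z * x -> x^-1 * z = y * x^-1.
Proof. by move=> xy; apply: (mulIg x); rewrite -!mulgA -xy mulKg mulVg mulg1. Qed.

(** * A crossing seen from a strand, and the braid relations *)

Section Turn.
Variable n : nat.
Implicit Types (c d q r : nat) (x y : ribbon n).

(* Positions 1, .., n lie on a circle with the root in position 0. *)
Definition hat x q : nat := if q is r.+1 then (npos x r).+1 else 0.

Lemma hatM x y q : hat (x * y) q = hat x (hat y q).
Proof. by case: q => //= r; rewrite nposM. Qed.

Lemma hat1 q : hat 1 q = q.
Proof. by case: q => //= r; rewrite npos1. Qed.

Lemma hatK x : cancel (hat x) (hat x^-1).
Proof. by move=> q; rewrite -hatM mulVg hat1. Qed.

Lemma hat_le x q : (hat x q <= n) = (q <= n).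
Proof. by case: q => //= r; rewrite npos_lt. Qed.

Lemma hat_inj x : injective (hat x).
Proof. exact: can_inj (hatK x). Qed.

Lemma hat_cross k q : k.+1 < n -> hat (cross n k) q = swapn k.+1 q.
Proof.
move=> lt_k; case: q => [|r] /=; rewrite ?npos_cross //.
by rewrite /swapn !eqSS; do ![case: ifP].
Qed.

Lemma hat_spin r q : hat (spin n r) q = q.
Proof. by case: q => //= q; rewrite npos_spin. Qed.

(* The crossing of the strands in the positions c and c + 1, seen from the
   strand in position q. *)
Definition turn c q : ribbon n :=
  if q < c then cross n (c - q).-1
  else if q == c then (swing n 0 n.-1)^-1
  else if q == c.+1 then (swing' n 0 n.-1)^-1
  else cross n (c + n - q).

(** Subtraction and addition modulo [n.+1], written by cases so that linear arithmetic decides the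
    identities between them. *)
Definition rot_pos q r := if q <= r then r - q else (r + n.+1) - q.
Definition unrot_pos q r := if r + q <= n then r + q else (r + q) - n.+1.

Lemma rot_posK q r : q <= n -> r <= n -> unrot_pos q (rot_pos q r) = r.
Proof. by rewrite /unrot_pos /rot_pos; do ![case: ifP]; lia. Qed.

Lemma unrot_posK q r : q <= n -> r <= n -> rot_pos q (unrot_pos q r) = r.
Proof. by rewrite /unrot_pos /rot_pos; do ![case: ifP]; lia. Qed.

Lemma rot_pos_le q r : q <= n -> r <= n -> rot_pos q r <= n.
Proof. by rewrite /rot_pos; case: ifP; lia. Qed.

Lemma unrot_pos_le q r : q <= n -> r <= n -> unrot_pos q r <= n.
Proof. by rewrite /unrot_pos; case: ifP; lia. Qed.

Lemma hat_swing q : 0 < q <= n ->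
  hat (swing n 0 n.-1) q = if q == n then 1%N else q.+1.
Proof.
case: q => //= q lt_q; rewrite npos_swing; last by lia.
by do ![case: ifP]; lia.
Qed.

Lemma hat_swing' q : 0 < q <= n ->
  hat (swing' n 0 n.-1) q = if q == 1%N then n else q.-1.
Proof.
case: q => //= q lt_q; rewrite npos_swing'; last by lia.
by do ![case: ifP]; lia.
Qed.

Lemma hat_turn c q r : 0 < c < n -> q <= n -> r <= n ->
  hat (turn c q) (rot_pos q r) = rot_pos (swapn c q) (swapn c r).
Proof.
move=> c_n le_q le_r; rewrite /turn.
case: (ltnP q c) => [lt_q|ge_q].
  rewrite hat_cross; last by lia.
  by rewrite /swapn /rot_pos; do ![case: ifP]; lia.
case: (eqVneq q c) => [->|neq_q].
  apply: (@hat_inj (swing n 0 n.-1)); rewrite -hatM mulgV hat1.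
  have [->|neq] := eqVneq r c.
    have -> : rot_pos (swapn c c) (swapn c c) = 0.
      by rewrite /swapn /rot_pos; do ![case: ifP]; lia.
    by rewrite /rot_pos leqnn subnn.
  rewrite hat_swing; rewrite /swapn /rot_pos; do ![case: ifP]; lia.
case: (eqVneq q c.+1) => [->|neq_q1].
  apply: (@hat_inj (swing' n 0 n.-1)); rewrite -hatM mulgV hat1.
  have [->|neq] := eqVneq r c.+1.
    have -> : rot_pos (swapn c c.+1) (swapn c c.+1) = 0.
      by rewrite /swapn /rot_pos; do ![case: ifP]; lia.
    by rewrite /rot_pos leqnn subnn.
  rewrite hat_swing'; rewrite /swapn /rot_pos; do ![case: ifP]; lia.
rewrite hat_cross; last by lia.
by rewrite /swapn /rot_pos; do ![case: ifP]; lia.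
Qed.

Lemma turn_lt c q : q < c -> turn c q = cross n (c - q).-1.
Proof. by rewrite /turn => ->. Qed.

Lemma turn_eq c : turn c c = (swing n 0 n.-1)^-1.
Proof. by rewrite /turn ltnn eqxx. Qed.

Lemma turn_eqS c : turn c c.+1 = (swing' n 0 n.-1)^-1.
Proof. by rewrite /turn ltnNge leqnSn eqxx gtn_eqF. Qed.

Lemma turn_gt c q : c.+1 < q -> turn c q = cross n (c + n - q).
Proof.
move=> lt_q; have lt_q' := ltnW lt_q; have le_q := ltnW lt_q'.
by rewrite /turn ltnNge le_q /= (gtn_eqF lt_q') (gtn_eqF lt_q).
Qed.

Lemma swapn_l c : swapn c c = c.+1.
Proof. by rewrite /swapn eqxx. Qed.

Lemma swapn_r c : swapn c c.+1 = c.
Proof. by rewrite /swapn gtn_eqF // eqxx. Qed.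

Lemma swapn_out c q : (q < c) || (c.+1 < q) -> swapn c q = q.
Proof. by rewrite /swapn; do ![case: ifP]; lia. Qed.

Lemma swingV k : k.+2 < n ->
  (swing n 0 n.-1)^-1 * cross n k.+1 = cross n k * (swing n 0 n.-1)^-1.
Proof. by move=> lt_k; apply/commute_invl/swing_cross; lia. Qed.

Lemma swing'V k : k.+2 < n ->
  (swing' n 0 n.-1)^-1 * cross n k = cross n k.+1 * (swing' n 0 n.-1)^-1.
Proof. by move=> lt_k; apply/commute_invl/swing'_cross; lia. Qed.

(** If the new root takes part in one of the crossings, that crossing becomes an inverse swing. The
    root then moves by one position, so the relative index of the other crossing changes by one, and
    this is exactly the effect of conjugation by the swing. *)
Lemma turn_far c d q : 0 < c -> c.+1 < d -> d < n -> q <= n ->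
  turn c (swapn d q) * turn d q = turn d (swapn c q) * turn c q.
Proof.
move=> c_gt0 lt_cd lt_d le_q.
case: (ltngtP q c) => [lt_q|gt_q|->].
- rewrite !swapn_out ?(turn_lt lt_q); [|lia..].
  by rewrite turn_lt; [apply: cross_far|]; lia.
- have [->|neq_q] := eqVneq q c.+1.
    rewrite swapn_r swapn_out; last by lia.
    rewrite turn_eqS !(@turn_lt d); [|lia..].
    have -> : (d - c).-1 = (d - c.+1).-1.+1 by lia.
    by apply: swing'V; lia.
  have {}gt_q : c.+1 < q by lia.
  rewrite (@swapn_out c); last by lia.
  case: (ltngtP q d) => [lt_q'|gt_q'|->].
  + rewrite (@swapn_out d) ?(@turn_gt c) ?(@turn_lt d); [|lia..].
    by apply: cross_far; lia.
  + have [->|neq_q'] := eqVneq q d.+1.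
      rewrite swapn_r turn_eqS !turn_gt; [|lia..].
      have -> : c + n - d = (c + n - d.+1).+1 by lia.
      by apply/esym/swing'V; lia.
    rewrite (@swapn_out d) ?(@turn_gt c) ?(@turn_gt d); [|lia..].
    by apply: cross_far; lia.
  + rewrite swapn_l turn_eq !turn_gt; [|lia..].
    have -> : c + n - d = (c + n - d.+1).+1 by lia.
    by apply/esym/swingV; lia.
- rewrite swapn_l (@swapn_out d) ?turn_eq ?(@turn_lt d); [|lia..].
  have -> : (d - c).-1 = (d - c.+1).-1.+1 by lia.
  by apply: swingV; lia.
Qed.

(** Multiplied by the [m]-th power of the same swing, the square becomes [full_spin], which is
    central; that power also carries [cross n m] to [cross n 0]. *)
Lemma swing'_last m : m.+2 = n ->
  swing' n 0 m.+1 ^+ 2 * cross n 0 = cross n m * swing' n 0 m.+1 ^+ 2.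
Proof.
move=> def_n; set V := swing' n 0 m.+1.
have pow j : j <= m -> V ^+ j * cross n j = cross n 0 * V ^+ j.
  elim: j => [|j IH] le_j; first by rewrite mul1g mulg1.
  rewrite monoid.expgSr -mulgA [V * _]swing'_cross; [|lia..].
  by rewrite mulgA IH -?mulgA //; lia.
have VX : V ^+ 2 * V ^+ m = full_spin n.
  rewrite -monoid.expgnDr full_spin' /V; congr (swing' n 0 _ ^+ _); lia.
apply: (mulIg (V ^+ m)).
rewrite -[LHS]mulgA -pow // -(mulgA (cross n m)) VX (mulgA (V ^+ 2)) VX.
exact: full_spinC.
Qed.

(** This is the braid relation, inverted, for a new root that starts as the middle one of the three
    strands. Each inverse crossing cancels against a factor of a swing; the remaining braids agree
    by [up_down], and the two twists commute. *)
Lemma swing_swing'_mid m : m.+2 = n ->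
  swing' n 0 m.+1 * (cross n 0)^-1 * swing n 0 m.+1 =
  swing n 0 m.+1 * (cross n m)^-1 * swing' n 0 m.+1.
Proof.
move=> def_n; rewrite !swingE !swing'E add0n.
have ->: fdown n 0 m.+1 * spin n 0 = spin n m.+1 * fdown n 0 m.+1.
  by rewrite spin_conj npos_fdown // add0n; lia.
have ->: fup n 0 m.+1 * spin n m.+1 * (cross n m)^-1 = spin n 0 * fup n 0 m.
  rewrite spin_conj npos_fup; last by lia.
  by rewrite add0n eqxx fupS add0n -mulgA mulgK.
have -> : spin n m.+1 * fdown n 0 m.+1 * (cross n 0)^-1 = spin n m.+1 * fdown n 1 m.
  by rewrite fdownSl mulgA mulgK.
have slide : fdown n 1 m * fup n 0 m.+1 = fup n 0 m * fdown n 0 m.+1.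
  rewrite fupSl fdownS add0n !mulgA; have := @up_down n 0 m; rewrite add0n => S.
  by rewrite !crossE !fupE !fdownE -!flatM S //; lia.
rewrite -mulgA (mulgA (fdown n 1 m)) slide.
rewrite (spin_conj (fup n 0 m * _)) nposM npos_fdown; last by lia.
rewrite add0n /= ltnSn npos_fup; last by lia.
rewrite eqxx -mulgA (mulgA (fup n 0 m)) spin_conj npos_fup; last by lia.
by rewrite gtn_eqF // ltnNge leqnSn /= !mulgA spinC.
Qed.

(** The start of the new root selects the relation: [swing_last] for the left strand,
    [swing_swing'_mid] for the middle one, [swing'_last] for the right one, and an ordinary braid
    relation if the root is none of the three. *)
Lemma turn_braid c q : 0 < c -> c.+1 < n -> q <= n ->
  turn c (swapn c.+1 (swapn c q)) * turn c.+1 (swapn c q) * turn c q =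
  turn c.+1 (swapn c (swapn c.+1 q)) * turn c (swapn c.+1 q) * turn c.+1 q.
Proof.
move=> c_gt0 lt_c le_q; pose m := n.-2.
have def_n : m.+2 = n by lia.
have E : n.-1 = m.+1 by lia.
case: (ltngtP q c) => [lt_q|gt_q|->].
- rewrite !swapn_out ?turn_lt; [|lia..].
  have -> : (c.+1 - q).-1 = (c - q).-1.+1 by lia.
  by apply: cross_braid; lia.
- have [->|neq_q] := eqVneq q c.+1.
    rewrite swapn_r swapn_l (@swapn_out c.+1 c) 1?(@swapn_out c c.+2); [|lia..].
    rewrite !turn_eq !turn_eqS (@turn_lt c.+1 c) ?(@turn_gt c c.+2); [|lia..].
    have -> : (c.+1 - c).-1 = 0 by lia.
    have -> : c + n - c.+2 = m by lia.
    apply: invg_inj; rewrite !invgM !invgK !mulgA E.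
    exact: swing_swing'_mid.
  have [->|neq_q'] := eqVneq q c.+2.
    rewrite (@swapn_out c c.+2) ?swapn_r; last by lia.
    rewrite !turn_eqS (@turn_lt c.+1 c) ?(@turn_gt c c.+2); [|lia..].
    have -> : (c.+1 - c).-1 = 0 by lia.
    have -> : c + n - c.+2 = m by lia.
    apply: invg_inj; rewrite !invgM !invgK E; apply: (mulgI (cross n m)).
    rewrite mulKVg (mulgA _ _ (cross n 0)^-1) mulgA -monoid.expg2.
    by rewrite -swing'_last // mulgK.
  rewrite !(@swapn_out c) ?(@swapn_out c.+1) ?(@swapn_out c); [|lia..].
  rewrite (@turn_gt c) ?(@turn_gt c.+1); [|lia..].
  have -> : c.+1 + n - q = (c + n - q).+1 by lia.
  by apply: cross_braid; lia.
rewrite (@swapn_out c.+1 c) ?swapn_l; last by lia.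
rewrite !turn_eq (@turn_lt c.+1 c) ?(@turn_gt c c.+2); [|lia..].
have -> : (c.+1 - c).-1 = 0 by lia.
have -> : c + n - c.+2 = m by lia.
apply: invg_inj; rewrite !invgM !invgK E; apply: (mulIg (cross n m)).
rewrite (mulgA _ _ (cross n m)^-1) mulgVK -monoid.expg2 -[RHS]mulgA.
by rewrite swing_last // mulKg.
Qed.

End Turn.

(** * The cocycle on words and on ribbon braids *)

Section Rot.
Variable n : nat.
Implicit Types (c d q r : nat) (x y : ribbon n) (w : word n).
Implicit Type t : {ffun 'I_n -> int}.

Definition word_pos w q : nat := foldr (fun a : 'I_n.-1 * bool => swapn a.1.+1) q w.

Lemma hat_word w q : hat (flat (wbraid w)) q = word_pos w q.
Proof.
elim: w => [|[i b] w IH] /=; first by rewrite hat1.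
rewrite -cat1s wbraidM flatM hatM IH; move: (word_pos w q) => s.
rewrite -(to_word_nat [:: (i, b)]); case: s => [//|r]; rewrite /hat npos_flat_word /= ?andbT //.
by rewrite /swapn !eqSS; do ![case: ifP].
Qed.

Lemma word_pos_cat w w' q : word_pos (w ++ w') q = word_pos w (word_pos w' q).
Proof. exact: foldr_cat. Qed.

Lemma word_pos_le w q : (word_pos w q <= n) = (q <= n).
Proof. by rewrite -hat_word hat_le. Qed.

(** The cocycle rule forces the value on an inverse crossing: it undoes the crossing read from the
    position that the root reaches, which is [swapn c q]. *)
Definition rot_letter q (a : 'I_n.-1 * bool) : ribbon n :=
  let c := a.1.+1 in
  if a.2 then turn n c q else (turn n c (swapn c q))^-1.

Fixpoint rot_word q w : ribbon n :=
  if w is a :: w' then rot_letter (word_pos w' q) a * rot_word q w' else 1.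

Lemma rot_word_cat q w w' :
  rot_word q (w ++ w') = rot_word (word_pos w' q) w * rot_word q w'.
Proof.
elim: w => [|a w IH] /=; first by rewrite mul1g.
by rewrite IH word_pos_cat mulgA.
Qed.

Lemma swapnK c : involutive (swapn c).
Proof. by move=> r; rewrite /swapn; do ![case: ifP]; lia. Qed.

Lemma rot_word_rel w w' q : braid_rel w w' -> q <= n -> rot_word q w = rot_word q w'.
Proof.
move=> ww'; elim: ww' q => {w w'}.
- by [].
- by move=> u v _ IH q le_q; rewrite IH.
- by move=> u v w _ IH _ IH' q le_q; rewrite IH ?IH'.
- move=> u u' v v' _ IH vv' IH' q le_q; rewrite !rot_word_cat IH' //.
  by rewrite -!hat_word (wbraidP v v').2 ?IH // hat_le.
- move=> i b q _; rewrite /= mulg1 /rot_letter /=; case: b => /=.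
    by rewrite mulgV.
  by rewrite swapnK mulVg.
- move=> i j lt_ij q le_q; rewrite /= !mulg1 /rot_letter /=.
  by apply: turn_far => //; have := ltn_ord j; lia.
- move=> i j def_j q le_q; rewrite /= !mulg1 /rot_letter /= !mulgA def_j.
  by apply: turn_braid => //; have := letter_ltS j; lia.
Qed.

Definition label_twist t q : int := if q is r.+1 then oapp t 0%R (insub r) else 0%R.

Lemma label_twist_hat t x q :
  label_twist [ffun p => t (ribbon_perm x p)] q = label_twist t (hat x q).
Proof.
case: q => //= r; case: (ltnP r n) => [lt_r|le_r].
  rewrite -[r]/(nat_of_ord (Ordinal lt_r)) npos_ord !valK /=.
  by rewrite ffunE.
by rewrite npos_out // !insubF // ltnNge le_r.
Qed.

Lemma label_twistD t t' q :
  label_twist (t + t')%R q = (label_twist t q + label_twist t' q)%R.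
Proof.
case: q => [|r] /=; first by rewrite GRing.addr0.
by case: insubP => [p _ _|_] /=; rewrite ?ffunE ?GRing.addr0.
Qed.

(** Twists stay with their ribbons, now in rotated positions. The old root has no framing
    coordinate, whence the value 0 of [label_twist] at position 0, and each twist of the new root
    becomes a full rotation. *)
Definition rot_twist q t : ribbon n :=
  twists [ffun r : 'I_n => label_twist t (unrot_pos n q r.+1)]
  * expgz (full_spin n) (label_twist t q).

(* The automorphism "strand q becomes the root" of the ribbon braid groupoid:
   [rebase q x] is x drawn on the sphere with the root in position 0, seen from
   the ribbon that starts in position q. *)
Definition rebase q x : ribbon n :=
  rot_word q (repr (rbraid x)) * rot_twist q (rtwist x).

Lemma hat_rot_word q w r : q <= n -> r <= n ->
  hat (rot_word q w) (rot_pos n q r) = rot_pos n (word_pos w q) (word_pos w r).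
Proof.
move=> le_q le_r; elim: w => [|[i b] w IH] /=; first by rewrite hat1.
have lt_i : 0 < i.+1 < n by have := letter_ltS i.
rewrite hatM IH /rot_letter /=; case: b => /=.
  by rewrite hat_turn ?word_pos_le.
apply: (@hat_inj _ (turn n i.+1 (swapn i.+1 (word_pos w q)))).
have le_sw s : s <= n -> swapn i.+1 (word_pos w s) <= n.
  by rewrite -(word_pos_le w); rewrite /swapn; do ![case: ifP]; lia.
by rewrite -hatM mulgV hat1 hat_turn ?swapnK // le_sw.
Qed.

Lemma rot_twistD q t t' : rot_twist q (t + t')%R = rot_twist q t * rot_twist q t'.
Proof.
have fC k x : commute (expgz (full_spin n) k) x.
  exact/expgz_commute/full_spinC.
rewrite /rot_twist label_twistD expgzD.
have -> : [ffun r : 'I_n => label_twist (t + t')%R (unrot_pos n q r.+1)] =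
    ([ffun r : 'I_n => label_twist t (unrot_pos n q r.+1)] +
     [ffun r : 'I_n => label_twist t' (unrot_pos n q r.+1)])%R.
  by apply/ffunP => r; rewrite !ffunE label_twistD.
rewrite twistsD -!mulgA; congr (_ * _); rewrite !mulgA; congr (_ * _).
by rewrite fC.
Qed.

(** Twists pass through a braid along its permutation and [full_spin] is central; this makes the
    braid part and the framing part of [rebase] fit together into a cocycle on the semidirect
    product. *)
Lemma rot_braid_twist b q t : q <= n ->
  rot_word q (repr b) * rot_twist q [ffun p => t (braid_perm b p)] =
  rot_twist (hat (flat b) q) t * rot_word q (repr b).
Proof.
move=> le_q; rewrite /rot_twist (label_twist_hat t (flat b)).
set k := label_twist t _; set X := rot_word _ _.
have fC x : commute (expgz (full_spin n) k) x.
  exact/expgz_commute/full_spinC.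
rewrite -[RHS]mulgA fC !mulgA; congr (_ * _).
rewrite -ribbon_conj; congr (_ * twists _); apply/ffunP => r.
rewrite !ffunE (label_twist_hat t (flat b)); congr label_twist.
have E : hat X r.+1 = (ribbon_perm X r).+1 by rewrite /= npos_ord.
have le_r : r.+1 <= n by [].
have := @hat_rot_word q (repr b) (unrot_pos n q r.+1) le_q (unrot_pos_le le_q le_r).
rewrite unrot_posK // -/X E -!hat_word wbraid_repr => ->.
by rewrite rot_posK // ?hat_le ?unrot_pos_le.
Qed.

Lemma rebaseM q x y : q <= n -> rebase q (x * y) = rebase (hat y q) x * rebase q y.
Proof.
move=> le_q; rewrite /rebase.
have hatE z s : hat z s = hat (flat (rbraid z)) s by case: s.
have -> : rbraid (x * y) = rbraid x * rbraid y by [].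
have -> : rtwist (x * y) =
    ([ffun p => rtwist x (braid_perm (rbraid y) p)] + rtwist y)%R.
  by apply/ffunP => p; rewrite !ffunE GRing.addrC.
rewrite rot_twistD (@rot_word_rel _ (repr (rbraid x) ++ repr (rbraid y))) //; last first.
  by apply/wbraidP; rewrite wbraidM !wbraid_repr.
rewrite rot_word_cat -hat_word wbraid_repr -hatE -[LHS]mulgA -[RHS]mulgA.
congr (_ * _).
by rewrite (mulgA (rot_word q _)) hatE rot_braid_twist // -[LHS]mulgA -?hatE.
Qed.

Lemma rebase_cross q k : k.+1 < n -> q <= n -> rebase q (cross n k) = turn n k.+1 q.
Proof.
move=> lt_k le_q; rewrite crossE /rebase /= -/(flat _).
have lt_k' : k < n.-1 by lia.
rewrite (@rot_word_rel _ [:: (Ordinal lt_k', true)]) //; last first.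
  by apply/wbraidP; rewrite wbraid_repr /gen to_word1.
rewrite /= mulg1 /rot_letter /= /rot_twist.
have E s : label_twist [ffun=> 0%R] s = 0%R.
  by case: s => //= s; case: insubP => //= p _ _; rewrite ffunE.
rewrite E /= mulg1 (_ : [ffun r => _] = 0%R) ?twists0 ?mulg1 //.
by apply/ffunP => r; rewrite !ffunE E.
Qed.

Lemma rot_word_nil q (b : braid n) : b = 1 -> q <= n -> rot_word q (repr b) = 1.
Proof.
by move=> -> le_q; rewrite (@rot_word_rel _ [::]) //; apply/wbraidP; rewrite wbraid_repr.
Qed.

Lemma rebase_spin q r : r < n -> q <= n ->
  rebase q (spin n r) = if q == r.+1 then full_spin n else spin n (rot_pos n q r.+1).-1.
Proof.
move=> lt_r le_q; rewrite spinE /rebase rot_word_nil // mul1g /rot_twist /=.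
set t := [ffun p : 'I_n => (val p == r)%:R%R].
have E s : label_twist t s = (s == r.+1)%:R%R.
  case: s => //= s; case: insubP => [p _ <-|] /=; first by rewrite ffunE eqSS.
  by rewrite eqSS; case: eqP => [->|]; rewrite ?lt_r.
rewrite E; case: (eqVneq q r.+1) => [def_q|neq_q] /=.
  rewrite -[RHS]mul1g; congr (_ * _); rewrite -(twists0 n); congr twists.
  apply/ffunP => p; rewrite !ffunE E def_q /unrot_pos.
  by have := ltn_ord p; case: ifP; case: eqP => //; lia.
rewrite mulg1 spinE; congr twists; apply/ffunP => p; rewrite !ffunE E.
congr ((nat_of_bool _)%:R)%R; rewrite /rot_pos /unrot_pos; case: p => p lt_p /=.
by do ![case: ifP]; lia.
Qed.

Lemma hat_rebase q x r : q <= n -> r <= n ->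
  hat (rebase q x) (rot_pos n q r) = rot_pos n (hat x q) (hat x r).
Proof.
move=> le_q le_r; rewrite /rebase hatM.
have -> s : hat (rot_twist q (rtwist x)) s = s.
  have fz k : npos (expgz (full_spin n) k) =1 id.
    have fX j : npos (full_spin n ^+ j) =1 id.
      by elim: j => [|j IH] p; rewrite ?npos1 // monoid.expgS nposM IH npos_full_spin.
    case: k => j p /=; first exact: fX.
    by apply: (@npos_inj _ (full_spin n ^+ j.+1)); rewrite nposVK fX.
  have tz t : npos (twists t) =1 id.
    move=> p; case: (ltnP p n) => [lt_p|?]; last by rewrite npos_out.
    rewrite -[p]/(nat_of_ord (Ordinal lt_p)) npos_ord /ribbon_perm /=.
    by rewrite braid_perm1 perm1.
  by case: s => //= s; rewrite nposM fz tz.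
rewrite hat_rot_word // -!hat_word wbraid_repr.
by case: (q) (r) => [|?] [|?].
Qed.

Lemma rebase1 q : q <= n -> rebase q 1 = 1.
Proof.
move=> le_q; have := rebaseM 1 1 le_q; rewrite hat1 mulg1 => E.
by apply: (mulIg (rebase q 1)); rewrite -E mul1g.
Qed.

End Rot.

(** A cocycle is trivial at 1, and the rule determines it on products and inverses. Indexing by a
    whole permutation instead of one position lets several marked strands be followed at once. *)
Lemma cocycle_ext n (H : groupType) (F G : 'S_n -> ribbon n -> H) :
  (forall p x y, F p (x * y) = F (p * ribbon_perm y) x * F p y) ->
  (forall p x y, G p (x * y) = G (p * ribbon_perm y) x * G p y) ->
  (forall p k, k.+1 < n -> F p (cross n k) = G p (cross n k)) ->
  (forall p r, r < n -> F p (spin n r) = G p (spin n r)) ->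
  forall p x, F p x = G p x.
Proof.
move=> FM GM Fc Fs p x.
have one K : (forall p x y, K p (x * y) = K (p * ribbon_perm y) x * K p y) ->
    forall q, K q 1 = 1 :> H.
  move=> KM q; have := KM q 1 1; rewrite ribbon_perm1 !mulg1 => E.
  by apply: (mulIg (K q 1)); rewrite -E mul1g.
elim/ribbon_ind: x p => [|x y IHx IHy|x IH|k lt_k|r lt_r] p.
- by rewrite !one.
- by rewrite FM GM IHx IHy.
- have E K : (forall p x y, K p (x * y) = K (p * ribbon_perm y) x * K p y) ->
    K p x^-1 = (K (p * ribbon_perm x^-1) x)^-1 :> H.
    move=> KM; apply: (mulgI (K (p * ribbon_perm x^-1) x)).
    by rewrite -KM !mulgV one.
  by rewrite !E // IH.
- exact: Fc.
- exact: Fs.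
Qed.

(** * Two successive changes of root *)

Section RotRot.
Variable n : nat.
Implicit Types (c d q r s : nat) (x y : ribbon n).
Notation cross := (cross n).
Notation spin := (spin n).
Notation fup := (fup n).
Notation fdown := (fdown n).
Notation swing := (swing n).
Notation swing' := (swing' n).
Notation rebase := (@rebase n).

Lemma rebaseV q x : q <= n -> rebase q x^-1 = (rebase (hat x^-1 q) x)^-1.
Proof.
move=> le_q; apply: (mulgI (rebase (hat x^-1 q) x)).
by rewrite -rebaseM // !mulgV rebase1.
Qed.

Lemma rebase_cross_lt q k : k.+1 < n -> q <= k -> rebase q (cross k) = cross (k - q).
Proof. by move=> lt_k le_q; rewrite rebase_cross ?turn_lt //; [congr cross|]; lia. Qed.

Lemma rebase_cross_gt q k : k.+2 < q -> q <= n -> rebase q (cross k) = cross (k.+1 + n - q).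
Proof. by move=> lt_k le_q; rewrite rebase_cross ?turn_gt //; lia. Qed.

Lemma hat_fup q i m : i + m < n -> hat (fup i m) q =
  if q == (i + m).+1 then i.+1 else if i < q <= i + m then q.+1 else q.
Proof.
by move=> lt_n; case: q => //= q; rewrite npos_fup // eqSS; do ![case: ifP]; lia.
Qed.

Lemma hat_fdown q i m : i + m < n -> hat (fdown i m) q =
  if q == i.+1 then (i + m).+1 else if i.+1 < q <= (i + m).+1 then q.-1 else q.
Proof.
by move=> lt_n; case: q => //= q; rewrite npos_fdown // eqSS; do ![case: ifP]; lia.
Qed.

Lemma rebase_fup_lt q i m : i + m < n -> q <= i -> rebase q (fup i m) = fup (i - q) m.
Proof.
elim: m => [|m IH] lt_n le_q; first by rewrite !fup0 rebase1 //; lia.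
rewrite !fupS rebaseM ?hat_cross ?swapn_out ?IH ?rebase_cross_lt; try lia.
by congr (_ * cross _); lia.
Qed.

Lemma rebase_fup_gt q i m : (i + m).+1 < q -> q <= n ->
  rebase q (fup i m) = fup (i.+1 + n - q) m.
Proof.
elim: m => [|m IH] lt_n le_q; first by rewrite !fup0 rebase1 //; lia.
rewrite !fupS rebaseM ?hat_cross ?swapn_out ?IH ?rebase_cross_gt; try lia.
by congr (_ * cross _); lia.
Qed.

Lemma rebase_fdown_lt q i m : i + m < n -> q <= i -> rebase q (fdown i m) = fdown (i - q) m.
Proof.
elim: m => [|m IH] lt_n le_q; first by rewrite !fdown0 rebase1 //; lia.
have E : hat (fdown i m) q = q by rewrite hat_fdown; [do ![case: ifP]; lia|lia].
rewrite !fdownS rebaseM ?E ?IH ?rebase_cross_lt; try lia.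
by congr (cross _ * _); lia.
Qed.

Lemma rebase_fdown_gt q i m : (i + m).+1 < q -> q <= n ->
  rebase q (fdown i m) = fdown (i.+1 + n - q) m.
Proof.
elim: m => [|m IH] lt_n le_q; first by rewrite !fdown0 rebase1 //; lia.
have E : hat (fdown i m) q = q by rewrite hat_fdown; [do ![case: ifP]; lia|lia].
rewrite !fdownS rebaseM ?E ?IH ?rebase_cross_gt; try lia.
by congr (cross _ * _); lia.
Qed.

Lemma rebase_fup_mover i m : i + m < n ->
  rebase (i + m).+1 (fup i m) = (swing' 0 n.-1)^-1 ^+ m.
Proof.
elim: m => [|m IH] lt_n; first by rewrite fup0 rebase1 //; lia.
rewrite fupS addnS rebaseM ?hat_cross ?swapn_r ?IH ?rebase_cross ?turn_eqS; try lia.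
by rewrite -monoid.expgSr.
Qed.

Lemma rebase_fdown_mover i m : i + m < n ->
  rebase i.+1 (fdown i m) = (swing 0 n.-1)^-1 ^+ m.
Proof.
elim: m => [|m IH] lt_n; first by rewrite fdown0 rebase1 //; lia.
rewrite fdownS rebaseM ?hat_fdown ?eqxx ?IH ?rebase_cross ?turn_eq; try lia.
by rewrite -monoid.expgS.
Qed.

(** Seen from the moving strand, its [n.-1] crossings are inverses of [swing'] and its twist is
    [full_spin], the [n]-th power of [swing']; one factor is left. *)
Lemma rebase_swing_mover : 0 < n -> rebase n (swing 0 n.-1) = swing' 0 n.-1.
Proof.
move=> n_gt0; have lt_n : 0 + n.-1 < n by lia.
rewrite swingE rebaseM ?hat_spin ?rebase_spin; try lia.
have := rebase_fup_mover lt_n; rewrite !add0n prednK // eqxx => ->.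
rewrite full_spin' -[X in swing' _ _ ^+ X](prednK n_gt0) monoid.expgSr mulgA.
by rewrite monoid.expVgn mulVg mul1g.
Qed.

Lemma rebase_swing'_mover : 0 < n -> rebase 1 (swing' 0 n.-1) = swing 0 n.-1.
Proof.
move=> n_gt0; have lt_n : 0 + n.-1 < n by lia.
rewrite swing'E rebaseM ?hat_spin ?rebase_spin; try lia.
rewrite eqxx rebase_fdown_mover //.
rewrite /full_spin -[X in swing _ _ ^+ X](prednK n_gt0) monoid.expgSr mulgA.
by rewrite monoid.expVgn mulVg mul1g.
Qed.

Lemma rebase_swing u : 0 < u < n -> rebase u (swing 0 n.-1) = (cross (n - u).-1)^-1.
Proof.
move=> u_n; pose a := (n - u).-1.
(* The mover meets the strand [u] exactly once, in the factor [cross u.-1]; the factors on either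
   side do not involve that strand. *)
have E : fup 0 n.-1 = fup 0 u.-1 * cross u.-1 * fup u a.
  rewrite -fupS (_ : fup u a = fup (0 + u.-1.+1) a); last by congr fup; lia.
  by rewrite -fupD; congr fup; lia.
have swingD' : swing 0 n.-1 = fup 0 a * cross a * swing a.+1 u.-1.
  have := fupS n 0 a; rewrite add0n => <-; have := swingD n 0 a.+1 u.-1.
  by rewrite add0n => <-; congr swing; lia.
rewrite {1}swingE E rebaseM ?hat_spin; last by lia.
rewrite rebaseM; last by lia.
have -> : hat (fup u a) u = u by rewrite hat_fup; [do ![case: ifP]; lia|lia].
rewrite rebaseM; last by lia.
rewrite hat_cross; last by lia.
have -> : swapn u.-1.+1 u = u.+1 by rewrite /swapn; do ![case: ifP]; lia.
rewrite rebase_spin; [|lia..].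
rewrite (_ : (u == _) = false); last by lia.
have -> : (rot_pos n u (0 + n.-1).+1).-1 = a by rewrite /rot_pos; case: ifP; lia.
rewrite (rebase_fup_gt (q := u.+1)) ?rebase_fup_lt ?subnn; [|lia..].
rewrite rebase_cross; [|lia..].
rewrite (_ : u.-1.+1 = u); last by lia.
rewrite turn_eq swingD' !invgM -!mulgA mulKg.
have -> : 1%N + n - u.+1 = a.+1 by lia.
have lt_a : a.+1 + u.-1 < n by lia.
have S : fup a.+1 u.-1 * spin (a.+1 + u.-1) = spin a.+1 * fup a.+1 u.-1.
  by rewrite spin_conj npos_fup // eqxx.
rewrite swingE S invgM !mulgA mulgV mul1g.
apply: (mulIg (cross a)); rewrite mulVg.
have C : cross a * spin a.+1 = spin a * cross a.
  by rewrite cross_spin ?swapn_r //; lia.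
by rewrite -!mulgA -C mulKg mulVg.
Qed.

Lemma rebase_swing' u : 1 < u <= n -> rebase u (swing' 0 n.-1) = (cross (n - u))^-1.
Proof.
move=> u_n; pose b := n - u.
have E : fdown 0 n.-1 = fdown u.-1 b * (cross u.-2 * fdown 0 u.-2).
  have := fdownS n 0 u.-2; rewrite add0n => <-.
  have := fdownD n 0 u.-2.+1 b; rewrite add0n.
  rewrite (_ : u.-2.+1 = u.-1); last by lia.
  by move=> <-; congr fdown; lia.
have swingD' : swing' 0 n.-1 = fdown b.+1 u.-2 * cross b * swing' 0 b.
  have := swing'D n 0 1 b; rewrite add0n fdown1 -mulgA => <-.
  rewrite addn1; have := swing'D n 0 u.-2 b.+1; rewrite add0n => <-.
  by congr swing'; lia.
rewrite {1}swing'E E rebaseM ?hat_spin; last by lia.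
rewrite rebaseM ?hatM; last by lia.
have -> : hat (fdown 0 u.-2) u = u by rewrite hat_fdown; [do ![case: ifP]; lia|lia].
rewrite (rebaseM (cross _)); last by lia.
have -> : hat (fdown 0 u.-2) u = u by rewrite hat_fdown; [do ![case: ifP]; lia|lia].
rewrite hat_cross; last by lia.
have -> : swapn u.-2.+1 u = u.-1 by rewrite /swapn; do ![case: ifP]; lia.
rewrite rebase_spin; [|lia..].
rewrite (_ : (u == _) = false); last by lia.
have -> : (rot_pos n u 1).-1 = b.+1 by rewrite /rot_pos; case: ifP; lia.
rewrite (rebase_fdown_gt (q := u)) ?rebase_fdown_lt ?subnn; [|lia..].
rewrite rebase_cross; [|lia..].
have -> : turn n u.-2.+1 u = turn n u.-1 u.-1.+1 by congr turn; lia.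
rewrite turn_eqS swingD' !invgM -!mulgA.
have -> : 1%N + n - u = b.+1 by lia.
rewrite mulKg swing'E.
have S : fdown 0 b * spin 0 = spin b * fdown 0 b.
  by rewrite spin_conj npos_fdown //; lia.
rewrite !mulgA S invgM !mulgA mulgV mul1g.
apply: (mulIg (cross b)); rewrite mulVg.
have C : cross b * spin b = spin b.+1 * cross b.
  by rewrite cross_spin ?swapn_l //; lia.
by rewrite -!mulgA -C mulKg mulVg.
Qed.

Lemma hatX_swing k q : 0 < q -> q + k <= n -> hat (swing 0 n.-1 ^+ k) q = q + k.
Proof.
elim: k => [|k IH] q_gt0 le_q; first by rewrite hat1 addn0.
by rewrite monoid.expgS hatM IH ?hat_swing ?ltn_eqF ?addnS //; lia.
Qed.

(** The full rotation is the twist of the old root, which has index [n - r] in the row seen from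
    [r]. For [r = 1] the strand is passed in the first [n.-1] swings and is itself the mover in the
    last one; centrality of [full_spin] gives the other [r], by conjugation with a braid [x] that
    carries position 1 to [r]. *)
Lemma rebase_full_spin r : 0 < r <= n -> rebase r (full_spin n) = spin (n - r).
Proof.
move=> r_n; have n_gt0 : 0 < n by lia.
have fix_full s : hat (full_spin n) s = s by case: s => //= s; rewrite npos_full_spin.
have one : rebase 1 (full_spin n) = spin n.-1.
  rewrite /full_spin; rewrite -[X in _ ^+ X](prednK n_gt0).
  have pow k : k < n -> rebase 1 (swing 0 n.-1 ^+ k) = (fdown (n.-1 - k) k)^-1.
    elim: k => [|k IH] lt_k; first by rewrite fdown0 invg1 rebase1.
    rewrite monoid.expgS rebaseM // IH; last by lia.
    rewrite hatX_swing ?rebase_swing; [|lia..].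
    have -> : n.-1 - k = (n.-1 - k.+1).+1 by lia.
    by rewrite fdownSl invgM; congr ((cross _)^-1 * _); lia.
  rewrite monoid.expgS rebaseM // hatX_swing; [|lia..].
  rewrite pow ?subnn; last by lia.
  rewrite add1n prednK // rebase_swing_mover // swing'E spin_conj npos_fdown; last by lia.
  by rewrite eqxx add0n mulgK.
pose x := fdown 0 r.-1; have hat_x : hat x 1 = r.
  by rewrite hat_fdown ?eqxx; lia.
have := rebaseM x (full_spin n) n_gt0; rewrite -full_spinC rebaseM // fix_full hat_x one.
have E : npos (rebase 1 x) n.-1 = n - r.
  have := @hat_rebase n 1 x 0 n_gt0 isT.
  rewrite hat_x /rot_pos /= add0n subn1 /= => E.
  apply: succn_inj; rewrite -[LHS]/(hat (rebase 1 x) n.-1.+1) prednK // E.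
  by case: ifP; lia.
by rewrite spin_conj E => /mulIg.
Qed.

Lemma rebase0 x : rebase 0 x = x.
Proof.
apply: (@cocycle_ext n _ (fun=> rebase 0) (fun=> id) _ _ _ _ 1) => //.
- by move=> _ y z; rewrite rebaseM.
- by move=> _ k lt_k; rewrite rebase_cross_lt ?subn0.
- by move=> _ r lt_r; rewrite rebase_spin // /rot_pos subn0.
Qed.

Definition perm_pos (p : 'S_n) q : nat :=
  if q is r.+1 then (oapp (fun i => nat_of_ord (p i)) r (insub r)).+1 else 0.

Lemma perm_posM p x q :
  perm_pos (p * ribbon_perm x) q = hat x (perm_pos p q).
Proof.
case: q => //= r; congr _.+1; rewrite /npos.
by case: insubP => [i _ _ | /negbTE out] /=; [rewrite valK /= permM | rewrite insubF].
Qed.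

Lemma perm_pos1 q : perm_pos 1 q = q.
Proof. by case: q => //= r; case: insubP => //= i _ <-; rewrite perm1. Qed.

Lemma perm_pos_le p q : (perm_pos p q <= n) = (q <= n).
Proof.
case: q => //= r; case: insubP => [i lt_r _ | out] //=.
by rewrite lt_r ltn_ord.
Qed.

Lemma perm_pos_inj p : injective (perm_pos p).
Proof.
case=> [|r] [|s] //= []; case: insubP => [i lt_i <-|out_r] /=;
  case: insubP => [j lt_j <-|out_s] //=.
- by move/val_inj/perm_inj => ->.
- by move=> E; move: out_s; rewrite -E ltn_ord.
- by move=> E; move: out_r; rewrite E ltn_ord.
- by move=> ->.
Qed.

Lemma rot_posxx q : rot_pos n q q = 0.
Proof. by rewrite /rot_pos leqnn subnn. Qed.

(** If [q] takes no part in the crossing, its image is again a crossing and the cases of [turn]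
    match by index arithmetic. Otherwise the image is an inverse swing, and the formulas for swings
    seen from the mover or from a passed strand apply. *)
Lemma rebase_rebase_cross q s k : k.+1 < n -> q <= n -> s <= n -> q != s ->
  rebase (rot_pos n q s) (rebase q (cross k)) = rebase s (cross k).
Proof.
move=> lt_k le_q le_s neq_qs; rewrite !(rebase_cross lt_k) //.
have le_r := rot_pos_le le_q le_s.
have n_gt0 : 0 < n by lia.
case: (ltngtP q k.+1) => [lt_q|gt_q|def_q].
- rewrite turn_lt // rebase_cross; [|lia|by []].
  have [def_s|neq_s] := eqVneq s k.+1.
    have -> : (k.+1 - q).-1.+1 = rot_pos n q s by rewrite /rot_pos; case: ifP; lia.
    by rewrite def_s !turn_eq.
  have [def_s|neq_s'] := eqVneq s k.+2.
    have -> : rot_pos n q s = (k.+1 - q).-1.+2 by rewrite /rot_pos; case: ifP; lia.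
    by rewrite def_s !turn_eqS.
  case: (ltnP s k.+1) => [lt_s|ge_s].
    rewrite (turn_lt n lt_s); case: (ltnP s q) => [lt_sq|ge_sq].
      rewrite turn_gt /rot_pos; first by congr cross; case: ifP; lia.
      by case: ifP; lia.
    rewrite turn_lt /rot_pos; first by congr cross; case: ifP; lia.
    by case: ifP; lia.
  rewrite !turn_gt; [|lia|by rewrite /rot_pos; case: ifP; lia].
  by congr cross; rewrite /rot_pos; case: ifP; lia.
- have [def_q|neq_q] := eqVneq q k.+2.
    rewrite def_q in le_r *; rewrite turn_eqS rebaseV //.
    have [def_s|neq_s] := eqVneq s k.+1.
      have -> : rot_pos n k.+2 s = n by rewrite /rot_pos; case: ifP; lia.
      have -> : hat (swing' 0 n.-1)^-1 n = 1%N.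
        apply: (@hat_inj _ (swing' 0 n.-1)); rewrite -hatM mulgV hat1.
        by rewrite hat_swing' ?eqxx //.
      by rewrite rebase_swing'_mover // def_s turn_eq.
    have lt_r : 0 < rot_pos n k.+2 s < n by rewrite /rot_pos; case: ifP; lia.
    have -> : hat (swing' 0 n.-1)^-1 (rot_pos n k.+2 s) = (rot_pos n k.+2 s).+1.
      apply: (@hat_inj _ (swing' 0 n.-1)); rewrite -hatM mulgV hat1.
      by rewrite hat_swing'; [case: ifP|]; lia.
    rewrite rebase_swing' ?invgK; last by lia.
    case: (ltnP s k.+1) => [lt_s|ge_s].
      rewrite turn_lt //; congr cross; rewrite /rot_pos; case: ifP; lia.
    rewrite turn_gt; last by lia.
    by congr cross; rewrite /rot_pos; case: ifP; lia.
  rewrite turn_gt // ?rebase_cross; [|lia..].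
  have E c : c = rot_pos n q k.+1 -> c = (k.+1 + n - q).+1.
    by move=> ->; rewrite /rot_pos; case: ifP; lia.
  have [def_s|neq_s] := eqVneq s k.+1.
    have -> : (k.+1 + n - q).+1 = rot_pos n q s by rewrite /rot_pos; case: ifP; lia.
    by rewrite def_s !turn_eq.
  have [def_s|neq_s'] := eqVneq s k.+2.
    have -> : rot_pos n q s = (k.+1 + n - q).+2 by rewrite /rot_pos; case: ifP; lia.
    by rewrite def_s !turn_eqS.
  case: (ltnP s k.+1) => [lt_s|ge_s].
    rewrite !turn_lt //; first by congr cross; rewrite /rot_pos; case: ifP; lia.
    by rewrite /rot_pos; case: ifP; lia.
  rewrite (@turn_gt n k.+1 s); last by lia.
  case: (ltnP s q) => [lt_sq|ge_sq].
    rewrite turn_gt /rot_pos; first by congr cross; case: ifP; lia.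
    by case: ifP; lia.
  rewrite turn_lt /rot_pos; first by congr cross; case: ifP; lia.
  by case: ifP; lia.
rewrite def_q in le_r *; rewrite turn_eq rebaseV //.
have [def_s|neq_s] := eqVneq s k.+2.
  have -> : rot_pos n k.+1 s = 1%N by rewrite /rot_pos; case: ifP; lia.
  have -> : hat (swing 0 n.-1)^-1 1 = n.
    apply: (@hat_inj _ (swing 0 n.-1)); rewrite -hatM mulgV hat1.
    by rewrite hat_swing ?eqxx //; lia.
  by rewrite rebase_swing_mover // def_s turn_eqS.
have lt_r : 1 < rot_pos n k.+1 s <= n by rewrite /rot_pos; case: ifP; lia.
have -> : hat (swing 0 n.-1)^-1 (rot_pos n k.+1 s) = (rot_pos n k.+1 s).-1.
  apply: (@hat_inj _ (swing 0 n.-1)); rewrite -hatM mulgV hat1.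
  by rewrite hat_swing; [case: ifP|]; lia.
rewrite rebase_swing ?invgK; last by lia.
case: (ltnP s k.+1) => [lt_s|ge_s].
  by rewrite turn_lt //; congr cross; rewrite /rot_pos; case: ifP; lia.
rewrite turn_gt; last by lia.
by congr cross; rewrite /rot_pos; case: ifP; lia.
Qed.

Lemma rebase_rebase_spin q s r : r < n -> q <= n -> s <= n -> q != s ->
  rebase (rot_pos n q s) (rebase q (spin r)) = rebase s (spin r).
Proof.
move=> lt_r le_q le_s neq_qs; rewrite !(rebase_spin lt_r) //.
have le_r := rot_pos_le le_q le_s.
have [def_q|neq_q] := eqVneq q r.+1.
  rewrite -def_q eq_sym (negbTE neq_qs) rebase_full_spin.
    by congr spin; rewrite /rot_pos; do ![case: ifP]; lia.
  by rewrite /rot_pos; case: ifP; lia.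
rewrite rebase_spin //; last by rewrite /rot_pos; case: ifP; lia.
have [->|neq_s] := eqVneq s r.+1.
  by rewrite prednK ?eqxx //; rewrite /rot_pos; case: ifP; lia.
rewrite ifN.
  by congr spin; rewrite /rot_pos; do ![case: ifP]; lia.
by rewrite /rot_pos; do ![case: ifP]; lia.
Qed.

Lemma rebase_rebase q s x : q <= n -> s <= n -> rebase (rot_pos n q s) (rebase q x) = rebase s x.
Proof.
move=> le_q le_s.
(* Both marked strands move along the braid, so the permutation [p] records where each of them
   starts; if they coincide, the second change of root is [rebase0]. *)
pose F p x := rebase (rot_pos n (perm_pos p q) (perm_pos p s)) (rebase (perm_pos p q) x).
suff: F 1 x = rebase (perm_pos 1 s) x by rewrite /F !perm_pos1.
apply: (@cocycle_ext n _ F (fun p => rebase (perm_pos p s))) => p.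
- move=> y z; rewrite /F !perm_posM.
  have le_q' : perm_pos p q <= n by rewrite perm_pos_le.
  have le_s' : perm_pos p s <= n by rewrite perm_pos_le.
  by rewrite rebaseM // rebaseM ?rot_pos_le // hat_rebase.
- by move=> y z; rewrite rebaseM ?perm_posM ?perm_pos_le.
- move=> k lt_k; rewrite /F; have [->|neq] := eqVneq s q.
    by rewrite rot_posxx rebase0.
  apply: rebase_rebase_cross => //; rewrite ?perm_pos_le //.
  by rewrite (inj_eq (@perm_pos_inj p)) eq_sym.
- move=> r lt_r; rewrite /F; have [->|neq] := eqVneq s q.
    by rewrite rot_posxx rebase0.
  apply: rebase_rebase_spin => //; rewrite ?perm_pos_le //.
  by rewrite (inj_eq (@perm_pos_inj p)) eq_sym.
Qed.

End RotRot.
(** * Insertion of ribbon braids into ribbons *)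

Section Cable.
Variables n m : nat.
Implicit Types (p : 'I_n) (b : braid n) (d : braid m).

Lemma cableM p b b' :
  cable m p (b * b') = cable m (braid_perm b' p) b * cable m p b'.
Proof.
rewrite -{1}(wbraid_repr b) -{1}(wbraid_repr b') -wbraidM cable_wbraid.
by rewrite cable_word_cat wbraidM.
Qed.

Lemma cable1 p : cable m p 1 = 1.
Proof. by rewrite -[1]/(wbraid [::]) cable_wbraid. Qed.

Lemma shiftM p d d' : shift p (d * d') = shift p d * shift p d'.
Proof.
rewrite -{1}(wbraid_repr d) -{1}(wbraid_repr d') -wbraidM shift_wbraid.
by rewrite /shift_word map_cat to_word_cat wbraidM.
Qed.

Lemma shift1 p : shift p 1 = 1 :> braid (n + m).-1.
Proof. by rewrite -[1]/(wbraid [::]) shift_wbraid. Qed.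

Lemma shiftV p d : shift p d^-1 = (shift p d)^-1.
Proof. by apply: (mulgI (shift p d)); rewrite -shiftM !mulgV shift1. Qed.

Lemma cable_gen_cross p i : i.+1 < n ->
  flat (cable m p (gen n i)) =
  if i.+1 < p then cross (n + m).-1 i
  else if i.+1 == p then fdown (n + m).-1 i m
  else if i == p then fup (n + m).-1 i m else cross (n + m).-1 (i + m).-1.
Proof.
move=> lt_i; have lt_i' : i < n.-1 by lia.
rewrite /gen to_word1 cable_wbraid /= cats0 perm1.
rewrite -[wbraid _]/(cable_gen (n + m).-1 m p i) cable_genE.
by rewrite !crossE fupE fdownE; do ![case: ifP].
Qed.

Lemma shift_cross p j : j.+1 < m ->
  flat (shift p (gen m j)) = cross (n + m).-1 (p + j).
Proof.
move=> lt_j; have lt_j' : j < m.-1 by lia.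
by rewrite crossE /gen to_word1 shift_wbraid.
Qed.

(** A braid slides along the ribbon that carries it. Conjugating the cable by [shift] again gives a
    cocycle, so [b], and then [d], may be taken to be a crossing; if the carrying strand takes part,
    the claim is [fup_cross] or [fdown_cross]. *)
Lemma shift_cable p b d :
  shift (braid_perm b p) d * cable m p b = cable m p b * shift p d.
Proof.
pose H : groupType := braid (n + m).-1.
pose F (q : 'S_n) (x : ribbon n) : H := shift (ribbon_perm x (q p)) d
  * cable m (q p) (rbraid x) * (shift (q p) d)^-1.
pose G (q : 'S_n) (x : ribbon n) : H := cable m (q p) (rbraid x).
suff E : F 1 (flat b) = G 1 (flat b).
  have := E; rewrite /F /G !perm1 /= => /(canRL (mulgKV _)) ->.
  by [].
apply: cocycle_ext => [q x y|q x y|q k lt_k|q r lt_r].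
- rewrite /F cableM ribbon_permM !permM /= !mulgA; congr (_ * _ * _).
  by rewrite mulgKV.
- by rewrite /G cableM permM.
- rewrite /F /G; set i := q p; apply: (mulIg (shift i d)); rewrite mulgKV crossE /=.
  have [Z ->] : exists Z : ribbon m, d = rbraid Z by exists (flat d).
  elim/ribbon_ind: Z => [|x y Ix Iy|x Ix|j lt_j|r _].
  + by rewrite !shift1 mulg1 mul1g.
  + by rewrite !shiftM -mulgA Iy mulgA Ix mulgA.
  + rewrite !shiftV; apply: (mulgI (shift (ribbon_perm (flat (gen n k)) i) (rbraid x))).
    by rewrite !mulgA mulgV mul1g Ix mulgK.
  + suff E : flat (shift (ribbon_perm (flat (gen n k)) i) (rbraid (cross m j)) *
       cable m i (gen n k)) = flat (cable m i (gen n k) * shift i (rbraid (cross m j))).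
      exact: (congr1 (@rbraid _) E).
    rewrite !flatM crossE /= !shift_cross // cable_gen_cross //.
    have -> : ribbon_perm (flat (gen n k)) i = swapn k i :> nat.
      by rewrite -npos_ord -crossE npos_cross.
    have lt_i := ltn_ord i.
    case: (ltngtP k.+1 i) => [lt_ki|gt_ki|def_i].
    * by rewrite swapn_out; [apply: cross_far|]; lia.
    * have [def_i|neq] := eqVneq k i.
        by rewrite -def_i swapn_l addSn fup_cross; [|lia..].
      by rewrite ?(negbTE neq) swapn_out; [apply: cross_far|]; lia.
    * by rewrite -def_i swapn_r addSn fdown_cross; [|lia..].
  + by rewrite spinE /= !shift1 mulg1 mul1g.
by rewrite /F /G spinE /= cable1 mulg1 /ribbon_perm /= braid_perm1 perm1 mulgV.
Qed.

End Cable.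

(** This links the rotation defined by swings to the full twist used in operadic composition. The
    [k]-th power of the swing twists once each of the ribbons starting in the last [k] positions. *)
Lemma full_spin_flat n : full_spin n = Ribbon (full_twist n) [ffun=> 1%R].
Proof.
have [/eqP n0|n_gt0] := posnP n.
  have -> : full_spin n = 1 by rewrite /full_spin [X in _ ^+ X](eqP n0).
  apply: ribbon_eq => [|p]; last by have := ltn_ord p; rewrite [X in _ < X](eqP n0).
  by rewrite /full_twist [X in _ ^+ X](eqP n0).
have pow k : k <= n -> swing n 0 n.-1 ^+ k =
    flat (up n 0 n.-1 ^+ k) * twists [ffun p : 'I_n => (n - k <= p)%:R%R].
  elim: k => [|k IH] le_k.
    rewrite (_ : [ffun p => _] = 0%R) ?twists0 ?mulg1 //.
    by apply/ffunP => p; rewrite !ffunE subn0 leqNgt ltn_ord.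
  rewrite monoid.expgSr IH; last by lia.
  rewrite swingE fupE add0n monoid.expgSr flatM -!mulgA; congr (_ * _).
  rewrite mulgA; pose t := [ffun p : 'I_n => (n - k <= p)%:R%R : int].
  rewrite -/t -(ribbon_conj (flat (up n 0 n.-1))) -mulgA; congr (_ * _).
  rewrite spinE -twistsD; congr twists; apply/ffunP => p; rewrite !ffunE.
  rewrite -[X in n - k <= X]npos_ord -fupE npos_fup add0n; last by lia.
  case: p => p lt_p /=; have [->|neq] := eqVneq p n.-1.
    by rewrite (_ : n - k <= 0 = false) ?GRing.add0r; [congr (_%:R)%R|]; lia.
  rewrite GRing.addr0 (_ : p < n.-1); last by lia.
  by congr ((nat_of_bool _)%:R)%R; lia.
rewrite /full_spin pow // /full_twist prod_sigma subnn.
apply: ribbon_eq => [|p]; first by rewrite rbraidM mulg1.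
by rewrite rtwistM !ffunE GRing.addr0.
Qed.

Lemma full_twistC n (b : braid n) : commute (full_twist n) b.
Proof.
have := full_spinC (flat b); rewrite full_spin_flat => /(congr1 (@rbraid n)).
by [].
Qed.

Section RibbonCirc.
Variables n m : nat.
Implicit Types (p q : 'I_n) (x : ribbon n) (y : ribbon m).

Lemma circ_twist_inner p t t' (k : 'I_m) (r : 'I_(n + m).-1) :
  r = p + k :> nat -> circ_twist p t t' r = (t p + t' k)%R.
Proof.
move=> def_r; rewrite ffunE def_r ltnNge leq_addr /= ltn_add2l ltn_ord.
by rewrite addKn valK.
Qed.

Lemma circ_twist_outer p q t (t' : {ffun 'I_m -> int}) (r : 'I_(n + m).-1) :
  q != p -> r = outer_pos m p q :> nat -> circ_twist p t t' r = t q.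
Proof.
rewrite -val_eqE /= /outer_pos => neq; case: ltnP => [lt_q|ge_q] def_r.
  by rewrite ffunE def_r lt_q valK.
rewrite ffunE; have lt_qn := ltn_ord q.
rewrite (_ : r < p = false); last by lia.
rewrite (_ : r < p + m = false); last by lia.
by rewrite (_ : (r - m).+1 = q) ?valK; [|lia].
Qed.

Lemma ribbon_circ_cases p (r : 'I_(n + m).-1) :
  (exists k : 'I_m, r = p + k :> nat) \/
  (exists2 q, q != p & r = outer_pos m p q :> nat).
Proof.
have lt_r := ltn_ord r; have lt_p := ltn_ord p.
have [/andP[le_pr lt_rp]|out_r] := boolP (p <= r < p + m).
  have lt_k : r - p < m by lia.
  by left; exists (Ordinal lt_k); rewrite /= subnKC.
right; pose q0 := if r < p then nat_of_ord r else (r - m).+1.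
have lt_q : q0 < n by rewrite /q0; move: out_r; case: ifP; lia.
exists (Ordinal lt_q); first by rewrite -val_eqE /= /q0; move: out_r; case: ifP; lia.
by rewrite /outer_pos /= /q0; move: out_r; do ![case: ifP]; lia.
Qed.

(** The interchange law. The inner braid slides along the cable by [shift_cable], and the powers of
    [full_twist] caused by the twists of the carrying ribbon can be collected because they are
    central. *)
Lemma ribbon_circM p x x' y y' :
  ribbon_circ p (x * x') (y * y') =
  ribbon_circ (ribbon_perm x' p) x y * ribbon_circ p x' y'.
Proof.
apply: ribbon_eq => [|r].
  rewrite rbraidM [LHS]/= [X in _ = X * _]/= [X in _ = _ * X]/= rbraidM cableM rtwistM.
  set T := full_twist m; set q := ribbon_perm x' p.
  have TC k d : commute (expgz T k) d by apply/expgz_commute/full_twistC.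
  rewrite -[RHS]mulgA [X in _ = _ * X]mulgA shift_cable -!mulgA; congr (_ * (_ * _)).
  rewrite -shiftM; congr (shift p _).
  rewrite GRing.addrC expgzD -!mulgA; congr (_ * _).
  by rewrite rbraidM [LHS]mulgA (TC _ (rbraid y)) -[LHS]mulgA.
rewrite rtwistM; case: (ribbon_circ_cases p r) => [[k def_r]|[q neq_q def_r]].
  rewrite /= !(circ_twist_inner _ _ def_r).
  rewrite (circ_twist_inner (k := ribbon_perm y' k) _ _ (ribbon_circ_inner _ _ def_r)).
  by rewrite !rtwistM; lia.
rewrite /= !(circ_twist_outer _ _ neq_q def_r).
rewrite (circ_twist_outer (q := ribbon_perm x' q) _ _ _ (ribbon_circ_outer _ _ neq_q def_r)).
  by rewrite !rtwistM.
by rewrite (inj_eq perm_inj).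
Qed.

End RibbonCirc.

(** * Crossings of two blocks of strands *)

Section Grids.
Variable N : nat.
Notation cross := (cross N).
Notation fup := (fup N).
Notation fdown := (fdown N).

Lemma fdown_fup_far i l j k : i + l < j -> fdown i l * fup j k = fup j k * fdown i l.
Proof.
elim: l => [|l IH] far; first by rewrite fdown0 mul1g mulg1.
rewrite fdownS -mulgA IH; last by lia.
by rewrite mulgA cross_fup_far -?mulgA //; lia.
Qed.

Lemma cross_grid_far c i l k : i + l + k <= c -> cross c * grid N i l k = grid N i l k * cross c.
Proof.
elim: k => [|k IH] far /=; first by rewrite mul1g mulg1.
rewrite mulgA cross_fup_far -?mulgA; last by lia.
by rewrite IH //; lia.
Qed.

Lemma gridS i l k : grid N i l.+1 k = grid N i l k * fdown (i + l) k.
Proof.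
elim: k => [|k IH] /=; first by rewrite fdown0 mulg1.
rewrite IH fupS -!mulgA; congr (_ * _); rewrite mulgA cross_grid_far; last by lia.
by rewrite -mulgA fdownS; congr (_ * (cross _ * _)); lia.
Qed.

Lemma grid'S i l k : k <= i.+1 ->
  grid' N i l.+1 k = fup (i.+1 - k + l) k * grid' N i l k.
Proof.
elim: k => [|k IH] le_k /=; first by rewrite fup0 mulg1.
rewrite IH; last by lia.
have -> : i.+1 - k + l = (i - k + l).+1 by lia.
rewrite fdownS -!mulgA (mulgA (fdown _ _)) fdown_fup_far; last by lia.
by rewrite -!mulgA (mulgA (cross _)) -fupSl.
Qed.

(** The crossing of two blocks is the same whether the strands of the right or those of the left
    block are moved one by one. *)
Lemma grid_grid' i m l : grid N i m l = grid' N (i + m).-1 l m.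
Proof.
elim: l => [|l IH] /=.
  by elim: m (i + m).-1 => //= m IH j; rewrite fdown0 mul1g -IH.
case: m IH => [|m] IH; first by rewrite IH fup0 mul1g.
rewrite grid'S; last by lia.
by rewrite IH; congr (fup _ _ * _); lia.
Qed.
End Grids.

(** * Operadic composition on generators *)

Section CircTo.
Variables n m N : nat.
Hypothesis e : (n + m).-1 = N.
Implicit Types (p q : 'I_n) (x : ribbon n) (y : ribbon m).

(** The arity is a variable because the axiom for the first input compares compositions of arities
    [(n + m).-1] and [(m + n).-1]. *)
Definition circ_to p x y : ribbon N := ecast k (ribbon k) e (ribbon_circ p x y).

Lemma circ_toM p x x' y y' :
  circ_to p (x * x') (y * y') = circ_to (ribbon_perm x' p) x y * circ_to p x' y'.
Proof. by rewrite /circ_to; case: N / e => /=; apply: ribbon_circM. Qed.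

Lemma ribbon_circ_flat p (b : braid n) (d : braid m) :
  ribbon_circ p (flat b) (flat d) = flat (cable m p b) * flat (shift p d).
Proof.
rewrite -flatM; apply: ribbon_eq => [|r] /=; first by rewrite ffunE /= mul1g.
case: (ribbon_circ_cases p r) => [[k def_r]|[q neq_q def_r]].
  by rewrite (circ_twist_inner _ _ def_r) !ffunE GRing.addr0.
by rewrite (circ_twist_outer _ _ neq_q def_r) !ffunE.
Qed.

Lemma circ_to_cross p i : i.+1 < n ->
  circ_to p (cross n i) 1 =
  if i.+1 < p then cross N i
  else if i.+1 == p then fdown N i m
  else if i == p then fup N i m else cross N (i + m).-1.
Proof.
move=> lt_i; rewrite /circ_to; case: N / e => /=.
by rewrite crossE -flat1 ribbon_circ_flat shift1 flat1 mulg1 cable_gen_cross.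
Qed.

Lemma circ_to1_cross p j : j.+1 < m -> circ_to p 1 (cross m j) = cross N (p + j).
Proof.
move=> lt_j; rewrite /circ_to; case: N / e => /=.
by rewrite crossE -flat1 ribbon_circ_flat cable1 flat1 mul1g shift_cross.
Qed.

Lemma circ_to1_spin p j : j < m -> circ_to p 1 (spin m j) = spin N (p + j).
Proof.
move=> lt_j; rewrite /circ_to; case: N / e => /=.
rewrite !spinE; apply: ribbon_eq => [|r] /=.
  by rewrite ffunE /= mulg1 cable1 shift1 mulg1.
case: (ribbon_circ_cases p r) => [[k def_r]|[q neq_q def_r]].
  rewrite (circ_twist_inner _ _ def_r) !ffunE GRing.add0r.
  by rewrite -[val r]/(nat_of_ord r) def_r eqn_add2l.
rewrite (circ_twist_outer _ _ neq_q def_r) !ffunE.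
rewrite -[val r]/(nat_of_ord r) def_r /outer_pos.
move: neq_q; rewrite -val_eqE /=; have := ltn_ord q; have := ltn_ord p.
by case: ifP; case: eqP => //; lia.
Qed.

Lemma ribbon_circ_twists p (t : {ffun 'I_n -> int}) (t' : {ffun 'I_m -> int}) :
  t p = 0%R -> ribbon_circ p (twists t) (twists t') = twists (circ_twist p t t').
Proof.
by move=> tp0; rewrite /ribbon_circ /= tp0 cable1 mul1g mulg1 shift1.
Qed.

Lemma circ_to_spin p (r : nat) : r < n -> circ_to p (spin n r) 1 =
  if r < p then spin N r
  else if r == p then circ_to p 1 (full_spin m) else spin N (r + m).-1.
Proof.
move=> lt_r; rewrite /circ_to; case: N / e => /=; have lt_p := ltn_ord p.
have [def_r|neq] := eqVneq r p.
  rewrite def_r ltnn full_spin_flat spinE.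
  apply: ribbon_eq => [|s] /=; first by rewrite !ffunE eqxx /= cable1 !mul1g mulg1.
  case: (ribbon_circ_cases p s) => [[k def_s]|[q neq_q def_s]].
    by rewrite !(circ_twist_inner _ _ def_s) !ffunE eqxx GRing.addr0 GRing.add0r.
  rewrite !(circ_twist_outer _ _ neq_q def_s) !ffunE.
  by rewrite -[_ == _]/(q == p) (negbTE neq_q).
rewrite !spinE -(twists0 m) ribbon_circ_twists; last first.
  by rewrite ffunE eq_sym (negbTE neq).
rewrite -fun_if; congr twists; apply/ffunP => s.
case: (ribbon_circ_cases p s) => [[k def_s]|[q neq_q def_s]].
  rewrite (circ_twist_inner _ _ def_s) !ffunE GRing.addr0.
  have lt_k := ltn_ord k.
  case: ifP => lt_rp; rewrite ffunE -[val s]/(nat_of_ord s) def_s;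
    congr ((nat_of_bool _)%:R)%R; rewrite -?[val p]/(nat_of_ord p); lia.
rewrite (circ_twist_outer _ _ neq_q def_s) !ffunE.
move: neq_q; rewrite -val_eqE /= => neq_q; have lt_q := ltn_ord q.
case: ifP => lt_rp; rewrite ffunE -[val s]/(nat_of_ord s) def_s /outer_pos;
  congr ((nat_of_bool _)%:R)%R; rewrite -[val q]/(nat_of_ord q); case: ifP; lia.
Qed.

Lemma circ_to11 p : circ_to p 1 1 = 1.
Proof.
rewrite /circ_to; case: N / e => /=.
by rewrite -!flat1 ribbon_circ_flat cable1 shift1 !flat1 mulg1.
Qed.

Lemma circ_toMl p x x' :
  circ_to p (x * x') 1 = circ_to (ribbon_perm x' p) x 1 * circ_to p x' 1.
Proof. by rewrite -circ_toM mulg1. Qed.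

Lemma circ_toMr p y y' : circ_to p 1 (y * y') = circ_to p 1 y * circ_to p 1 y'.
Proof. by have := circ_toM p 1 1 y y'; rewrite mulg1 ribbon_perm1 perm1. Qed.

Lemma circ_to_split p x y : circ_to p x y = circ_to p x 1 * circ_to p 1 y.
Proof. by have := circ_toM p x 1 1 y; rewrite mulg1 mul1g ribbon_perm1 perm1. Qed.

Lemma circ_toVl p x : circ_to p x^-1 1 = (circ_to (ribbon_perm x^-1 p) x 1)^-1.
Proof.
apply: (mulgI (circ_to (ribbon_perm x^-1 p) x 1)).
by rewrite -circ_toMl !mulgV circ_to11.
Qed.

Lemma circ_toVr p y : circ_to p 1 y^-1 = (circ_to p 1 y)^-1.
Proof. by apply: (mulgI (circ_to p 1 y)); rewrite -circ_toMr !mulgV circ_to11. Qed.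

Lemma circ_toXr p y k : circ_to p 1 (y ^+ k) = circ_to p 1 y ^+ k.
Proof.
by elim: k => [|k IH]; rewrite ?circ_to11 // !monoid.expgS circ_toMr IH.
Qed.

Lemma circ_to1_fup p j l : j + l < m -> circ_to p 1 (fup m j l) = fup N (p + j) l.
Proof.
elim: l => [|l IH] lt_l; first by rewrite !fup0 circ_to11.
rewrite !fupS circ_toMr IH; last by lia.
by rewrite circ_to1_cross ?addnA //; lia.
Qed.

Lemma circ_to1_fdown p j l : j + l < m -> circ_to p 1 (fdown m j l) = fdown N (p + j) l.
Proof.
elim: l => [|l IH] lt_l; first by rewrite !fdown0 circ_to11.
rewrite !fdownS circ_toMr IH; last by lia.
by rewrite circ_to1_cross ?addnA //; lia.
Qed.

Lemma circ_to1_swing p j l : j + l < m -> circ_to p 1 (swing m j l) = swing N (p + j) l.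
Proof. by move=> lt_l; rewrite !swingE circ_toMr circ_to1_fup // circ_to1_spin ?addnA. Qed.

Lemma circ_to1_swing' p j l : j + l < m ->
  circ_to p 1 (swing' m j l) = swing' N (p + j) l.
Proof.
move=> lt_l; rewrite !swing'E circ_toMr circ_to1_fdown // circ_to1_spin ?addnA //.
by lia.
Qed.

Lemma npos_circ_inner p x y k : k < m ->
  npos (circ_to p x y) (p + k) = npos x p + npos y k.
Proof.
move=> lt_k; rewrite /circ_to; case: N / e => /=.
have lt_r : p + k < (n + m).-1 by have := ltn_ord p; lia.
rewrite -[p + k]/(nat_of_ord (Ordinal lt_r)) !npos_ord.
by rewrite -[k]/(nat_of_ord (Ordinal lt_k)) npos_ord; apply: ribbon_circ_inner.
Qed.

Lemma npos_circ_outer p x y (q : nat) : q < n -> q != p ->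
  npos (circ_to p x y) (outer_pos m p q) = outer_pos m (npos x p) (npos x q).
Proof.
move=> lt_q neq_q; rewrite /circ_to; case: N / e => /=.
have lt_p := ltn_ord p.
have lt_r : outer_pos m p q < (n + m).-1 by rewrite /outer_pos; case: ifP; lia.
rewrite -[outer_pos m p q]/(nat_of_ord (Ordinal lt_r)) !npos_ord.
rewrite -[q]/(nat_of_ord (Ordinal lt_q)) npos_ord; apply: ribbon_circ_outer => //.
Qed.

Hypothesis m_gt0 : 0 < m.

Lemma circ_to_full_spinr p : circ_to p 1 (full_spin m) = swing N p m.-1 ^+ m.
Proof. by rewrite circ_toXr circ_to1_swing; [rewrite addn0|lia]. Qed.

Lemma circ_to_fup p i l : i + l < n ->
  circ_to p (fup n i l) 1 =
  if p < i then fup N (i + m).-1 l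
  else if p < i + l then fup N i (l + m).-1
  else if p == i + l :> nat then grid N i l m else fup N i l.
Proof.
elim: l p => [|l IH] p lt_l.
  have E k : grid N i 0 k = 1 by elim: k => //= k ->; rewrite fup0 mulg1.
  rewrite !fup0 circ_to11 addn0 add0n E; case: ltngtP => // def_p.
rewrite fupS circ_toMl circ_to_cross; last by lia.
have E : ribbon_perm (cross n (i + l)) p = swapn (i + l) p :> nat.
  by rewrite -npos_ord npos_cross //; lia.
rewrite IH {IH}; last by lia.
rewrite !E {E}.
case: (ltngtP (i + l).+1 p) => [lt_p|gt_p|def_p].
- rewrite swapn_out; last by lia.
  do ![case: ifP => ?]; try (exfalso; lia); by rewrite fupS.
- case: (eqVneq (i + l) p) => [def_p|neq_p].
    rewrite -def_p swapn_l; do ![case: ifP => ?]; try (exfalso; lia).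
    by rewrite -fupD; congr fup; lia.
  rewrite swapn_out; last by lia.
  do ![case: ifP => ?]; try (exfalso; lia).
    by rewrite fupS; congr (_ * cross _ _); lia.
  have -> : (l.+1 + m).-1 = (l + m).-1.+1 by lia.
  by rewrite fupS; congr (_ * cross _ _); lia.
- rewrite -def_p swapn_r; do ![case: ifP => ?]; try (exfalso; lia).
  by rewrite gridS.
Qed.

Lemma circ_to_fdown p i l : i + l < n ->
  circ_to p (fdown n i l) 1 =
  if p < i then fdown N (i + m).-1 l
  else if p == i :> nat then grid N i m l
  else if p <= i + l then fdown N i (l + m).-1 else fdown N i l.
Proof.
elim: l => [|l IH] lt_l.
  rewrite !fdown0 circ_to11 addn0 add0n; case: ltngtP => // def_p.
rewrite fdownS circ_toMl IH; last by lia.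
have E : ribbon_perm (fdown n i l) p = (if p == i :> nat then i + l
   else if i < p <= i + l then p.-1 else p) :> nat.
  by rewrite -npos_ord npos_fdown //; lia.
rewrite circ_to_cross; last by lia.
move: E; set r := nat_of_ord (ribbon_perm _ _); clearbody r.
have -> : (l.+1 + m).-1 = l + m by lia.
case: (ltngtP p i) => [lt_p|gt_p|def_p] /= def_r.
- do ![case: ifP => ?]; try (exfalso; lia).
  by rewrite fdownS; congr (cross _ _ * _); lia.
- case: (ltnP (i + l).+1 p) => [lt_p|ge_p].
    have {def_r}-> : r = p by rewrite def_r; case: ifP; lia.
    do ![case: ifP => ?]; try (exfalso; lia); by rewrite fdownS.
  case: (leqP p (i + l)) def_r => [le_p|lt_p] ->.
    do ![case: ifP => ?]; try (exfalso; lia).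
    rewrite (_ : l + m = (l + m).-1.+1); last by lia.
    by rewrite fdownS; congr (cross _ _ * _); lia.
  do ![case: ifP => ?]; try (exfalso; lia).
  by rewrite fdownD.
- by do ![case: ifP => ?]; try (exfalso; lia).
Qed.

(** If the cabled strand is the mover, its [m] strands move one after the other, which by
    [swing_pow] amounts to [m] swings; its twist supplies the rotation inside the block. Otherwise
    the mover only passes more strands. *)
Lemma circ_to_swing p :
  circ_to p (swing n 0 n.-1) 1 = swing N 0 N.-1 ^+ (if p == n.-1 :> nat then m else 1%N).
Proof.
have lt_p := ltn_ord p; rewrite swingE circ_toMl circ_to_spin; last by lia.
have -> : ribbon_perm (spin n (0 + n.-1)) p = p.
  by apply: val_inj; rewrite /= -npos_ord npos_spin.
rewrite circ_to_fup; last by lia.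
case: eqP => [def_p|neq_p]; do ![case: ifP => ?]; try (exfalso; lia).
  rewrite circ_to_full_spinr def_p; have := @swing_pow N 0 n.-1 m.-1 m.
  rewrite add0n => <-; [|lia|lia].
  by congr (swing _ _ _ ^+ _); lia.
rewrite swingE; congr (fup _ _ _ * spin _ _); lia.
Qed.

Lemma circ_to_swing' p :
  circ_to p (swing' n 0 n.-1) 1 = swing' N 0 N.-1 ^+ (if p == 0 :> nat then m else 1%N).
Proof.
have lt_p := ltn_ord p; rewrite swing'E circ_toMl circ_to_spin; last by lia.
have -> : ribbon_perm (spin n 0) p = p.
  by apply: val_inj; rewrite /= -npos_ord npos_spin.
rewrite circ_to_fdown; last by lia.
case: eqP => [def_p|neq_p]; do ![case: ifP => ?]; try (exfalso; lia).
  rewrite circ_toXr -[circ_to p 1 _]/(circ_to p 1 (swing m 0 m.-1)) -circ_toXr.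
  rewrite -/(full_spin m) full_spin' circ_toXr circ_to1_swing' ?addn0; last by lia.
  rewrite def_p grid_grid' add0n; have := @swing'_pow N 0 n.-1 m.-1 m.
  rewrite add0n => <-; [|lia|lia].
  by congr (swing' _ _ _ ^+ _); lia.
rewrite swing'E; congr (fdown _ _ _ * spin _ _); lia.
Qed.

(** In [n] successive swings the cabled strand is the mover exactly once, so the result consists of
    [n.-1 + m = N] swings. *)
Lemma circ_to_full_spinl p : circ_to p (full_spin n) 1 = full_spin N.
Proof.
have lt_p := ltn_ord p.
have posX k (q : 'I_n) : q + k <= n ->
    ribbon_perm (swing n 0 n.-1 ^+ k) q = (if q + k == n then 0 else q + k) :> nat.
  move=> le_q; rewrite -npos_ord; case: k le_q => [|k] le_q.
    by rewrite npos1 addn0; have := ltn_ord q; case: eqP => //; lia.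
  rewrite monoid.expgS nposM.
  have -> : npos (swing n 0 n.-1 ^+ k) q = q + k.
    by apply: succn_inj; rewrite -addSn -(@hatX_swing n) //; lia.
  rewrite npos_swing; last by lia.
  by do ![case: ifP]; lia.
have pow k (q : 'I_n) : q + k < n ->
    circ_to q (swing n 0 n.-1 ^+ k) 1 = swing N 0 N.-1 ^+ k.
  elim: k => [|k IH] lt_k; first by rewrite circ_to11.
  rewrite monoid.expgS circ_toMl IH; last by lia.
  have E : (ribbon_perm (swing n 0 n.-1 ^+ k) q == n.-1 :> nat) = false.
    by rewrite posX; [case: ifP; lia|lia].
  by rewrite circ_to_swing E [RHS]monoid.expgS.
have {1}-> : full_spin n = swing n 0 n.-1 ^+ p * (swing n 0 n.-1 * swing n 0 n.-1 ^+ (n.-1 - p)).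
  rewrite -monoid.expgS -monoid.expgnDr; congr (_ ^+ _); lia.
set j := n.-1 - p; rewrite !circ_toMl ribbon_permM permM.
set q := ribbon_perm (swing n 0 n.-1 ^+ j) p.
have def_q : q = n.-1 :> nat by rewrite posX; [case: ifP; lia|lia].
have def_0 : ribbon_perm (swing n 0 n.-1) q = 0 :> nat.
  by rewrite -npos_ord def_q npos_swing ?add0n ?eqxx //; lia.
rewrite circ_to_swing def_q eqxx (pow j); last by rewrite /j; lia.
rewrite (pow p) ?def_0 -?monoid.expgnDr //.
by rewrite /full_spin; congr (_ ^+ _); rewrite /j; lia.
Qed.

End CircTo.

(** * Composition with the new root outside the inserted block *)

Section RebaseCirc.
Variables n m N : nat.
Hypotheses (e : (n + m).-1 = N) (m_gt0 : 0 < m).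
Implicit Types (p q : 'I_n) (i j k : nat) (x : ribbon n) (y : ribbon m).
Notation circ_to := (circ_to e).

Lemma rebase_circ_outerr p p' q y : q != p ->
  p' = (rot_pos n q.+1 p.+1).-1 :> nat ->
  rebase (outer_pos m p q).+1 (circ_to p 1 y) = circ_to p' 1 y.
Proof.
rewrite -val_eqE /= => neq def_p'; have lt_p := ltn_ord p; have lt_q := ltn_ord q.
pose F (_ : 'S_m) y := rebase (outer_pos m p q).+1 (circ_to p 1 y).
have le_Q : (outer_pos m p q).+1 <= N by rewrite /outer_pos; case: ifP; lia.
have fixQ z : hat (circ_to p 1 z) (outer_pos m p q).+1 = (outer_pos m p q).+1.
  by rewrite /= npos_circ_outer // !npos1.
suff: F 1 y = circ_to p' 1 y by [].
apply: (@cocycle_ext m _ F (fun=> circ_to p' 1)) => [s z z'|s z z'|s j lt_j|s j lt_j].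
- by rewrite /F circ_toMr rebaseM // fixQ.
- exact: circ_toMr.
- rewrite /F !circ_to1_cross // def_p' /outer_pos /rot_pos.
  case: ifP => lt_qp.
    by rewrite rebase_cross_lt; [congr (cross N _); case: ifP|..]; lia.
  by rewrite rebase_cross_gt; [congr (cross N _); case: ifP|..]; lia.
rewrite /F !circ_to1_spin // rebase_spin //; last by lia.
rewrite ifN; last by rewrite /outer_pos; case: ifP; lia.
by congr (spin N _); rewrite def_p' /outer_pos /rot_pos; do ![case: ifP]; lia.
Qed.

Lemma circ_to_cross_lt p i : i.+1 < p -> circ_to p (cross n i) 1 = cross N i.
Proof. by move=> lt_i; rewrite circ_to_cross ?lt_i //; have := ltn_ord p; lia. Qed.

Lemma circ_to_cross_r p i : i.+1 = p -> circ_to p (cross n i) 1 = fdown N i m.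
Proof. by move=> def_p; rewrite circ_to_cross def_p ?ltnn ?eqxx. Qed.

Lemma circ_to_cross_l p i : i = p :> nat -> i.+1 < n -> circ_to p (cross n i) 1 = fup N i m.
Proof.
by move=> def_p lt_i; rewrite circ_to_cross // -def_p ltnNge !leqnSn gtn_eqF ?eqxx.
Qed.

Lemma circ_to_cross_gt p i : p < i -> i.+1 < n ->
  circ_to p (cross n i) 1 = cross N (i + m).-1.
Proof.
by move=> lt_p lt_i; rewrite circ_to_cross //; do ![case: ifP => ?]; rewrite //; exfalso; lia.
Qed.

(** The essential case is a crossing of [p] with the new root [q]. The root then passes [m] strands,
    each giving an inverse swing; on the other side the cabled strand is the mover of one inverse
    swing, which also gives [m] of them. *)
Lemma rebase_circ_outer_cross p p' q i : q != p -> i.+1 < n ->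
  p' = (rot_pos n q.+1 p.+1).-1 :> nat ->
  rebase (outer_pos m p q).+1 (circ_to p (cross n i) 1) =
  circ_to p' (rebase q.+1 (cross n i)) 1.
Proof.
rewrite -val_eqE /= => neq lt_i; have lt_p := ltn_ord p; have lt_q := ltn_ord q.
have lt_p' := ltn_ord p'.
rewrite (_ : (rot_pos _ _ _).-1 = if q < p then p - q.+1 else p + n - q); last first.
  by rewrite /rot_pos; do ![case: ifP]; lia.
rewrite (_ : (outer_pos _ _ _).+1 = if q < p then q.+1 else q + m); last first.
  by rewrite /outer_pos; do ![case: ifP]; lia.
rewrite (rebase_cross lt_i) //; case: (ltngtP q i) => [lt_qi|gt_qi|def_q].
- rewrite turn_lt //.
  case: (ltngtP i.+1 p) => [lt_p1|gt_p1|def_p].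
  + rewrite ifT; last by lia.
    rewrite ifT ?(circ_to_cross_lt lt_p1) => [def_p'|]; last by lia.
    by rewrite circ_to_cross_lt ?rebase_cross_lt; [congr (cross N _)|..]; lia.
  + have [def_p|neq_p] := eqVneq i p.
      rewrite -def_p lt_qi (circ_to_cross_l def_p lt_i) => def_p'.
      by rewrite circ_to_cross_l ?rebase_fup_lt; [congr (fup N _ _)|..]; lia.
    rewrite circ_to_cross_gt; [|lia|lia]; case: ltnP => [lt_qp|le_pq] def_p'.
      by rewrite circ_to_cross_gt ?rebase_cross_lt; [congr (cross N _)|..]; lia.
    by rewrite circ_to_cross_lt ?rebase_cross_lt; [congr (cross N _)|..]; lia.
  + rewrite (circ_to_cross_r def_p) ifT => [|]; last by lia.
    rewrite ifT => [def_p'|]; last by lia.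
    by rewrite circ_to_cross_r ?rebase_fdown_lt; [congr (fdown N _ _)|..]; lia.
- have [def_q|neq_q] := eqVneq (q : nat) i.+1.
    rewrite def_q turn_eqS circ_toVl => def_p'.
    have pV : npos (swing' n 0 n.-1)^-1 p' = if p' == n.-1 :> nat then 0 else p'.+1.
      apply: (@npos_inj _ (swing' n 0 n.-1)); rewrite nposVK npos_swing'; last by lia.
      by do ![case: ifP]; lia.
    rewrite circ_to_swing' // -npos_ord pV; case: (ltngtP i p) => [lt_ip|gt_ip|def_p].
    + have E : i.+1 < p by lia.
      rewrite E in def_p' *; rewrite [_ == n.-1](_ : _ = false) /=; last by lia.
      by rewrite circ_to_cross_lt // rebase_cross ?turn_eqS //; lia.
    + have E : (i.+1 < p) = false by lia.
      rewrite E in def_p' *; rewrite [_ == n.-1](_ : _ = false) /=; last by lia.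
      rewrite circ_to_cross_gt // rebase_cross; [|lia..].
      by rewrite (_ : (i + m).-1.+1 = i + m) ?addSn ?turn_eqS //; lia.
    have E : (i.+1 < p) = false by lia.
    rewrite E in def_p' *; rewrite [_ == n.-1](_ : _ = true) /=; last by lia.
    rewrite (circ_to_cross_l def_p lt_i) addSn rebase_fup_mover; last by lia.
    by rewrite monoid.expVgn.
  rewrite turn_gt; last by lia.
  case: (ltngtP i.+1 p) => [lt_p1|gt_p1|def_p].
  + rewrite (circ_to_cross_lt lt_p1); case: ltnP => [lt_qp|le_pq] def_p'.
      by rewrite circ_to_cross_gt ?rebase_cross_gt; [congr (cross N _)|..]; lia.
    by rewrite circ_to_cross_lt ?rebase_cross_gt; [congr (cross N _)|..]; lia.
  + rewrite !ifF; [|lia..] => def_p'; have [def_p|neq_p] := eqVneq i p.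
      rewrite (circ_to_cross_l def_p lt_i).
      by rewrite circ_to_cross_l ?rebase_fup_gt; [congr (fup N _ _)|..]; lia.
    rewrite circ_to_cross_gt; [|lia|lia].
    by rewrite circ_to_cross_gt ?rebase_cross_gt; [congr (cross N _)|..]; lia.
  + rewrite (circ_to_cross_r def_p) !ifF; [|lia..] => def_p'.
    by rewrite circ_to_cross_r ?rebase_fdown_gt; [congr (fdown N _ _)|..]; lia.
rewrite def_q turn_eq circ_toVl => def_p'.
have pV : npos (swing n 0 n.-1)^-1 p' = if p' == 0 :> nat then n.-1 else p'.-1.
  apply: (@npos_inj _ (swing n 0 n.-1)); rewrite nposVK npos_swing; last by lia.
  by do ![case: ifP]; lia.
rewrite circ_to_swing // -npos_ord pV; case: (ltngtP i.+1 p) => [lt_ip|gt_ip|def_p].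
- have E : i < p by lia.
  rewrite E in def_p' *; rewrite [X in X == n.-1](_ : _ = p'.-1); last first.
    by case: ifP; lia.
  rewrite [_ == n.-1](_ : _ = false) /=; last by lia.
  by rewrite circ_to_cross_lt // rebase_cross ?turn_eq //; lia.
- have E : (i < p) = false by lia.
  rewrite E in def_p' *; rewrite [X in X == n.-1](_ : _ = p'.-1); last first.
    by case: ifP; lia.
  rewrite [_ == n.-1](_ : _ = false) /=; last by lia.
  rewrite circ_to_cross_gt; [|lia|lia].
  rewrite rebase_cross; [|lia..].
  by rewrite (_ : (i + m).-1.+1 = i + m) ?turn_eq //; lia.
have E : i < p by lia.
rewrite E in def_p' *; rewrite [X in X == n.-1](_ : _ = n.-1); last first.
  by case: ifP; lia.
rewrite eqxx (circ_to_cross_r def_p) rebase_fdown_mover ?monoid.expVgn //; lia.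
Qed.

Definition rot_ord p q : 'I_n := insubd p (rot_pos n q.+1 p.+1).-1.

Lemma rot_ordE p q : q != p -> rot_ord p q = (rot_pos n q.+1 p.+1).-1 :> nat.
Proof.
rewrite -val_eqE /= => neq; rewrite val_insubd ifT //.
by have := ltn_ord p; have := ltn_ord q; rewrite /rot_pos; case: ifP; lia.
Qed.

Lemma rebase_perm q p x : q != p ->
  ribbon_perm (rebase q.+1 x) (rot_ord p q) = rot_ord (ribbon_perm x p) (ribbon_perm x q).
Proof.
move=> neq; apply: val_inj => /=; rewrite rot_ordE ?(inj_eq perm_inj) //.
have lt_p := ltn_ord p; have lt_q := ltn_ord q.
have := @hat_rebase n q.+1 x p.+1 lt_q lt_p; rewrite /= !npos_ord => <-.
rewrite -npos_ord rot_ordE //.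
have : 0 < rot_pos n q.+1 p.+1.
  by move: neq; rewrite -val_eqE /rot_pos /=; case: ifP; lia.
by case: (rot_pos _ _ _).
Qed.

Lemma rebase_circ_outer p p' q x y : q != p ->
  p' = (rot_pos n q.+1 p.+1).-1 :> nat ->
  rebase (outer_pos m p q).+1 (circ_to p x y) = circ_to p' (rebase q.+1 x) y.
Proof.
move=> neq def_p'; have {def_p'}-> : p' = rot_ord p q.
  by apply: val_inj; rewrite /= rot_ordE.
have lt_p := ltn_ord p; have lt_q := ltn_ord q.
have le_Q (p1 q1 : 'I_n) : q1 != p1 -> (outer_pos m p1 q1).+1 <= N.
  have := ltn_ord p1; have := ltn_ord q1.
  by rewrite -val_eqE /outer_pos /=; case: ifP; lia.
have hatQ (p1 q1 : 'I_n) z z' : q1 != p1 ->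
    hat (circ_to p1 z z') (outer_pos m p1 q1).+1 =
    (outer_pos m (ribbon_perm z p1) (ribbon_perm z q1)).+1.
  by move=> neq1; rewrite /= npos_circ_outer // !npos_ord.
rewrite circ_to_split [RHS]circ_to_split rebaseM ?le_Q // hatQ // ribbon_perm1 !perm1.
rewrite (rebase_circ_outerr _ neq (rot_ordE neq)); congr (_ * _).
pose F (s : 'S_n) x := rebase (outer_pos m (s p) (s q)).+1 (circ_to (s p) x 1).
pose G (s : 'S_n) x := circ_to (rot_ord (s p) (s q)) (rebase (s q).+1 x) 1.
suff: F 1 x = G 1 x by rewrite /F /G !perm1.
have neqs (s : 'S_n) : s q != s p by rewrite (inj_eq perm_inj).
apply: (@cocycle_ext n _ F G) => [s z z'|s z z'|s i lt_i|s r lt_r].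
- by rewrite /F circ_toMl rebaseM ?le_Q // hatQ ?neqs // !permM.
- rewrite /G rebaseM // circ_toMl rebase_perm // !permM.
  by rewrite [hat _ _]/= npos_ord.
- by apply: rebase_circ_outer_cross => //; rewrite rot_ordE.
rewrite /F /G; move: (s p) (s q) (neqs s) => {neq}p1 q1 neq.
have lt_p1 := ltn_ord p1; have lt_q1 := ltn_ord q1.
rewrite (rebase_spin lt_r) //; have [def_r|neq_r] := eqVneq q1.+1 r.+1.
  have def_r' : r = q1 by lia.
  have := le_Q p1 q1 neq; move: neq; rewrite -val_eqE /= => neq.
  rewrite circ_to_full_spinl // circ_to_spin // def_r' (negbTE neq).
  rewrite /outer_pos; case: ifP => lt_qp leQ.
    by rewrite rebase_spin ?eqxx.
  by rewrite rebase_spin ?eqxx.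
rewrite circ_to_spin //; have [def_r|neq_rp] := eqVneq r p1.
  rewrite def_r ltnn (rebase_circ_outerr _ neq (rot_ordE neq)) -rot_ordE //.
  by rewrite circ_to_spin ?ltnn ?eqxx.
rewrite circ_to_spin; last by rewrite /rot_pos; case: ifP; lia.
have lep := rot_ordE neq.
move: neq lep (le_Q _ _ neq); rewrite -val_eqE /= => neq lep leQ.
rewrite -(fun_if (spin N)) rebase_spin; [|by case: ifP; lia|by []].
rewrite ifN; last by rewrite /outer_pos; do ![case: ifP]; lia.
rewrite [_ == _](_ : _ = false); last by rewrite lep /rot_pos; do ![case: ifP]; lia.
rewrite lep -(fun_if (spin N)); congr (spin N _).
rewrite /outer_pos /rot_pos; case: (ltnP r p1); case: (ltnP q1 p1); case: (ltnP q1 r);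
  do ![case: ifP]; lia.
Qed.

End RebaseCirc.

(** * Composition with the new root inside the inserted block *)

Section RebaseCircInner.
Variables n m N : nat.
Hypotheses (e : (n + m).-1 = N) (e' : (m + n).-1 = N) (n_gt0 : 0 < n) (m_gt0 : 0 < m).
Implicit Types (p : 'I_n) (k : 'I_m) (x : ribbon n) (y : ribbon m).

(** [rev_ord k] is the position of the old root of [y] seen from the strand [k]. Through this root
    [y] was attached to [x], so it is where [x] is inserted after the change of root. *)
Lemma rebase_perm0 k y :
  ribbon_perm (rebase k.+1 y) (rev_ord k) = rev_ord (ribbon_perm y k).
Proof.
have E c : c < m -> rot_pos m c.+1 0 = (m - c.+1).+1 by rewrite /rot_pos ltn0; lia.
have lt_k := ltn_ord k; apply/val_inj/succn_inj; rewrite /= -E // -!npos_ord.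
have := @hat_rebase m k.+1 y 0 lt_k isT; by rewrite E // => /= ->.
Qed.

Lemma rebase_circ_innerr p k y :
  rebase (p + k).+1 (circ_to e p 1 y) = circ_to e' (rev_ord k) (rebase k.+1 y) 1.
Proof.
have lt_p := ltn_ord p.
have le_Q (k1 : 'I_m) : (p + k1).+1 <= N by have := ltn_ord k1; lia.
have hatQ z z' (k1 : 'I_m) : hat (circ_to e p z z') (p + k1).+1 =
    (ribbon_perm z p + ribbon_perm z' k1).+1.
  by rewrite /= npos_circ_inner // !npos_ord.
pose F (s : 'S_m) y := rebase (p + s k).+1 (circ_to e p 1 y).
pose G (s : 'S_m) y := circ_to e' (rev_ord (s k)) (rebase (s k).+1 y) 1.
suff: F 1 y = G 1 y by rewrite /F /G perm1.
apply: cocycle_ext => [s z z'|s z z'|s j lt_j|s j lt_j].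
- by rewrite /F circ_toMr rebaseM // hatQ ribbon_perm1 perm1 permM.
- rewrite /G rebaseM // circ_toMl rebase_perm0 permM.
  by rewrite [hat _ _]/= npos_ord.
- rewrite /F /G circ_to1_cross //; move: (s k) => k1; have lt_k := ltn_ord k1.
  rewrite (rebase_cross lt_j) //; case: (ltngtP k1 j) => [lt_kj|gt_kj|def_k].
  + rewrite turn_lt // circ_to_cross_lt ?rebase_cross_lt /=; [|lia..].
    by congr (cross N _); lia.
  + have [def_k|neq_k] := eqVneq (k1 : nat) j.+1.
      rewrite def_k turn_eqS circ_toVl circ_to_swing' // -npos_ord.
      have -> : npos (swing' m 0 m.-1)^-1 (rev_ord k1) = (rev_ord k1).+1.
        apply: (@npos_inj _ (swing' m 0 m.-1)); rewrite nposVK npos_swing' /=; last by lia.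
        by do ![case: ifP]; lia.
      by rewrite /= addnS rebase_cross ?turn_eqS //; lia.
    rewrite turn_gt ?circ_to_cross_gt ?rebase_cross_gt /=; [|lia..].
    by congr (cross N _); lia.
  + rewrite def_k turn_eq circ_toVl circ_to_swing // -npos_ord.
    have -> : npos (swing m 0 m.-1)^-1 (rev_ord k1) = (rev_ord k1).-1.
      apply: (@npos_inj _ (swing m 0 m.-1)); rewrite nposVK npos_swing /=; last by lia.
      by do ![case: ifP]; lia.
    rewrite (_ : (rev_ord k1).-1 == m.-1 = false) /=; last by lia.
    by rewrite rebase_cross ?turn_eq //; lia.
rewrite /F /G circ_to1_spin //; move: (s k) => k1; have lt_k := ltn_ord k1.
rewrite (rebase_spin lt_j) // rebase_spin //; last by lia.
rewrite eqSS eqn_add2l eqSS; case: (ltngtP k1 j) => [lt_kj|gt_kj|def_k].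
- rewrite circ_to_spin ?ifT /= /rot_pos; [|by do ?[case: ifP]; lia..].
  by congr (spin N _); do ![case: ifP]; lia.
- rewrite circ_to_spin ?ifF /= /rot_pos; [|by do ?[case: ifP]; lia..].
  by congr (spin N _); do ![case: ifP]; lia.
by rewrite circ_to_full_spinl.
Qed.

Lemma rebase_circ_innerl p k x :
  rebase (p + k).+1 (circ_to e p x 1) = circ_to e' (rev_ord k) 1 (rebase p.+1 x).
Proof.
have lt_k := ltn_ord k.
have le_Q (p1 : 'I_n) : (p1 + k).+1 <= N by have := ltn_ord p1; lia.
have hatQ z (p1 : 'I_n) : hat (circ_to e p1 z 1) (p1 + k).+1 =
    (ribbon_perm z p1 + k).+1.
  by rewrite /= npos_circ_inner // npos_ord npos1.
pose F (s : 'S_n) x := rebase (s p + k).+1 (circ_to e (s p) x 1).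
pose G (s : 'S_n) x := circ_to e' (rev_ord k) 1 (rebase (s p).+1 x).
suff: F 1 x = G 1 x by rewrite /F /G perm1.
apply: cocycle_ext => [s z z'|s z z'|s i lt_i|s r lt_r].
- by rewrite /F circ_toMl rebaseM // hatQ permM.
- by rewrite /G rebaseM // circ_toMr [hat _ _]/= npos_ord permM.
- rewrite /F /G; move: (s p) => p1; have lt_p := ltn_ord p1.
  rewrite (rebase_cross lt_i) //; pose a := m - k.+1.
  case: (ltngtP p1 i) => [lt_pi|gt_pi|def_p].
  + rewrite turn_lt ?circ_to_cross_gt ?rebase_cross_lt ?circ_to1_cross /=; [|lia..].
    by congr (cross N _); lia.
  + have [def_p|neq_p] := eqVneq (p1 : nat) i.+1.
      rewrite circ_to_cross_r // def_p turn_eqS circ_toVr circ_to1_swing'; last by lia.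
      (* The block is split at the new root, its strand number [k]: only the middle crossing
         involves the root, and the [a] strands beyond it and the [k] strands before it are passed
         as usual. *)
      have E : fdown N i m = fdown N (i + k).+1 a * (cross N (i + k) * fdown N i k).
        rewrite -fdownS -addnS -fdownD; congr fdown; lia.
      rewrite E rebaseM; last by lia.
      rewrite rebaseM ?hatM; last by lia.
      have fix_hat : hat (fdown N i k) (i.+1 + k).+1 = (i.+1 + k).+1.
        by rewrite hat_fdown; [do ![case: ifP]; lia|lia].
      rewrite fix_hat hat_cross ?addSn ?swapn_r; last by lia.
      rewrite rebase_cross ?turn_eqS; [|lia|lia].
      rewrite (rebase_fdown_gt (i := i)) ?rebase_fdown_lt ?subnn; [|lia..].
      rewrite (_ : i.+1 + N - (i + k).+2 = a + n.-1); last by lia.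
      have := swing'D N 0 n.-1 a; have := swing'D N 0 k (a + n.-1).
      rewrite !add0n (_ : a + n.-1 + k = N.-1); last by lia.
      move=> -> E'; rewrite invgM -!mulgA mulVg mulg1 E' invgM mulgA addn0 -/a.
      have S : swing' N 0 a = spin N a * fdown N 0 a.
        by rewrite swing'E spin_conj npos_fdown ?add0n //; lia.
      by rewrite S invgM mulgA mulgV mul1g -invgM /= -/a -swing'E.
    rewrite turn_gt ?circ_to_cross_lt ?rebase_cross_gt ?circ_to1_cross /=; [|lia..].
    by congr (cross N _); lia.
  rewrite circ_to_cross_l // def_p turn_eq circ_toVr circ_to1_swing; last by lia.
  have E : fup N i m = fup N i k * (cross N (i + k) * fup N (i + k).+1 a).
    rewrite mulgA -fupS -addnS -fupD; congr fup; lia.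
  rewrite E rebaseM; last by lia.
  rewrite rebaseM ?hatM; last by lia.
  have fix_hat : hat (fup N (i + k).+1 a) (i + k).+1 = (i + k).+1.
    by rewrite hat_fup; [do ![case: ifP]; lia|lia].
  rewrite fix_hat hat_cross ?swapn_l; last by lia.
  rewrite rebase_cross ?turn_eq; [|lia|lia].
  rewrite rebase_fup_gt ?rebase_fup_lt ?subnn; [|lia..].
  rewrite (_ : i.+1 + N - (i + k).+2 = a + n.-1); last by lia.
  have := swingD N 0 a (n.-1 + k); have := swingD N a n.-1 k.
  rewrite !add0n (_ : a + (n.-1 + k) = N.-1); last by lia.
  move=> E' ->; rewrite invgM -!mulgA mulVg mulg1 E' invgM mulgA addn0 -/a.
  have S : swing N (a + n.-1) k = spin N (a + n.-1) * fup N (a + n.-1) k.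
    by rewrite swingE spin_conj npos_fup ?eqxx //; lia.
  by rewrite S invgM mulgA mulgV mul1g -invgM /= -/a -swingE.
rewrite /F /G; move: (s p) => p1; have lt_p := ltn_ord p1.
rewrite circ_to_spin // (rebase_spin lt_r) //; case: (ltngtP r p1) => [lt_rp|gt_rp|def_r].
- rewrite ifF ?circ_to1_spin ?rebase_spin; [|by rewrite /rot_pos; do ?[case: ifP]; lia..].
  rewrite ifF; last by lia.
  by congr (spin N _); rewrite /rot_pos /=; do ![case: ifP]; lia.
- rewrite ifF ?circ_to1_spin ?rebase_spin; [|by rewrite /rot_pos; do ?[case: ifP]; lia..].
  rewrite ifF; last by lia.
  by congr (spin N _); rewrite /rot_pos /=; do ![case: ifP]; lia.
rewrite def_r eqxx rebase_circ_innerr rebase_full_spin; last by lia.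
by rewrite circ_to_spin ?ltnn ?eqxx //= ?ltnn ?eqxx //; lia.
Qed.

Lemma rebase_circ_inner p k x y :
  rebase (p + k).+1 (circ_to e p x y) =
  circ_to e' (rev_ord k) (rebase k.+1 y) (rebase p.+1 x).
Proof.
have lt_k := ltn_ord k; have lt_p := ltn_ord p.
rewrite circ_to_split rebaseM; last by lia.
rewrite [hat _ _]/= npos_circ_inner // npos1 npos_ord.
rewrite rebase_circ_innerl rebase_circ_innerr.
have := circ_toM e' (rev_ord k) 1 (rebase k.+1 y) (rebase p.+1 x) 1.
by rewrite mul1g mulg1 => ->; rewrite rebase_perm0.
Qed.

End RebaseCircInner.
(** * Planar unrooted trees *)

(** [reroot] for an arbitrary label, so that cuts at two different boundary edges can be compared
    before anything is relabelled. *)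
Fixpoint reroot_at (l : nat) (c t : btree) : btree :=
  match t with
  | Leaf _ => c
  | Node t1 t2 => if l \in leaves t1 then reroot_at l (Node t2 c) t1
                  else reroot_at l (Node c t1) t2
  end.

Lemma reroot_at0 c t : reroot c t = reroot_at 0 c t.
Proof. by elim: t c => //= t1 IH1 t2 IH2 c; rewrite IH1 IH2. Qed.

(* The unrooted tree obtained by joining c and t along their roots, rooted at
   its boundary edge l. *)
Definition root_at (l : nat) (c t : btree) : btree :=
  if l \in leaves t then reroot_at l c t else reroot_at l t c.

Lemma root_atC l c t : ~~ ((l \in leaves c) && (l \in leaves t)) ->
  (l \in leaves c) || (l \in leaves t) -> root_at l c t = root_at l t c.
Proof.
by rewrite /root_at; case: (l \in leaves c); case: (l \in leaves t).
Qed.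

(** Moving the cut along the path to [l] does not change the unrooted tree, so a later cut at [l']
    gives the same result. *)
Lemma root_at_reroot l l' c t : uniq (leaves c ++ leaves t) -> l \in leaves t ->
  l' \in leaves c ++ leaves t ->
  root_at l' c t = root_at l' (reroot_at l c t) (Leaf l).
Proof.
elim: t c => [k|t1 IH1 t2 IH2] c; first by rewrite mem_seq1 => _ /eqP ->.
rewrite /= mem_cat => uniq_l in_l in_l'.
have [in1|nin1] /= := boolP (l \in leaves t1).
  have U : uniq (leaves (Node t2 c) ++ leaves t1).
    by rewrite /= -catA uniq_catC -catA.
  have L : l' \in leaves (Node t2 c) ++ leaves t1.
    by move: in_l'; rewrite /= !mem_cat; do ![case: (_ \in _)].
  by rewrite -(IH1 _ U in1 L) /root_at /= mem_cat; case: (l' \in leaves t1) => //=.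
move: in_l; rewrite (negbTE nin1) /= => in2.
have U : uniq (leaves (Node c t1) ++ leaves t2) by rewrite /= -catA.
have L : l' \in leaves (Node c t1) ++ leaves t2 by rewrite /= -catA.
rewrite -(IH2 _ U in2 L); move: uniq_l in_l'.
rewrite catA cat_uniq => /and3P[uniq1 /hasPn no2 _].
move: uniq1; rewrite cat_uniq => /and3P[_ /hasPn no1 _].
have := no1 l'; have := no2 l'; rewrite /root_at /= !mem_cat.
case: (l' \in leaves t1) => /=; case: (l' \in leaves t2) => //=;
  case: (l' \in leaves c) => //= H2 H1 _.
- by have := H2 isT.
- by have := H2 isT.
- by have := H1 isT.
Qed.

Lemma perm_reroot_at l c t : l \in leaves t ->
  perm_eq (l :: leaves (reroot_at l c t)) (leaves c ++ leaves t).
Proof.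
elim: t c => [k|t1 IH1 t2 IH2] c /=.
  by rewrite mem_seq1 => /eqP <-; rewrite perm_sym cats1 perm_rcons.
rewrite mem_cat; case: ifP => [in1 _|_ /= in2].
  apply: perm_trans (IH1 _ in1) _ => /=.
  by rewrite -catA perm_catC -catA.
by apply: perm_trans (IH2 _ in2) _ => /=; rewrite -catA.
Qed.

Lemma relabel_reroot_at f l c t : {in l :: leaves t &, injective f} ->
  reroot_at (f l) (relabel f c) (relabel f t) = relabel f (reroot_at l c t).
Proof.
elim: t c => [//|t1 IH1 t2 IH2] c inj_f /=.
have -> : (f l \in leaves (relabel f t1)) = (l \in leaves t1).
  rewrite leaves_relabel; apply/mapP/idP => [[k in_k]|in_l]; last by exists l.
  move/inj_f => -> //; first by rewrite mem_head.
  by rewrite /= inE mem_cat in_k orbT.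
case: ifP => _.
  rewrite -IH1 //; apply: sub_in2 inj_f => k.
  by rewrite !inE mem_cat => /orP[->|->] //; rewrite !orbT.
rewrite -IH2 //; apply: sub_in2 inj_f => k.
by rewrite !inE mem_cat => /orP[->|->] //; rewrite !orbT.
Qed.

Lemma relabel_root_at f l c t : {in l :: leaves c ++ leaves t &, injective f} ->
  root_at (f l) (relabel f c) (relabel f t) = relabel f (root_at l c t).
Proof.
move=> inj_f; rewrite /root_at.
have -> : (f l \in leaves (relabel f t)) = (l \in leaves t).
  rewrite leaves_relabel; apply/mapP/idP => [[k in_k]|in_l]; last by exists l.
  move/inj_f => -> //; first by rewrite mem_head.
  by rewrite inE mem_cat in_k !orbT.
case: ifP => _; apply: relabel_reroot_at; apply: sub_in2 inj_f => k;
  by rewrite !inE mem_cat => /orP[->|->] //; rewrite !orbT.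
Qed.

Lemma relabel_comp f g t : relabel f (relabel g t) = relabel (f \o g) t.
Proof. by elim: t => //= t1 -> t2 ->. Qed.

Lemma relabel_id t : relabel id t = t.
Proof. by elim: t => //= t1 -> t2 ->. Qed.

Lemma eq_in_relabel f g t : {in leaves t, f =1 g} -> relabel f t = relabel g t.
Proof.
elim: t => [l|t1 IH1 t2 IH2] /= eq_fg; first by rewrite eq_fg ?mem_seq1.
rewrite IH1 ?IH2 // => l in_l; apply: eq_fg; by rewrite mem_cat in_l ?orbT.
Qed.

Lemma leaves_reroot_at l c t : l \in leaves t ->
  leaves (reroot_at l c t) = drop (index l (leaves t)).+1 (leaves t)
    ++ leaves c ++ take (index l (leaves t)) (leaves t).
Proof.
elim: t c => [k|t1 IH1 t2 IH2] c /=.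
  by rewrite mem_seq1 eq_sym => ->; rewrite cats0.
rewrite mem_cat index_cat; case: ifP => [in1 _|nin1 /= in2].
  have lt_i : index l (leaves t1) < size (leaves t1) by rewrite index_mem.
  rewrite IH1 //= drop_cat take_cat lt_i.
  case: ifP => [_|/negbT ge_i]; first by rewrite -!catA.
  rewrite -leqNgt in ge_i.
  have -> : (index l (leaves t1)).+1 = size (leaves t1).
    by apply/eqP; rewrite eqn_leq lt_i ge_i.
  by rewrite subnn drop0 drop_size -!catA.
rewrite IH2 //= take_cat ltnNge leq_addr /= addKn.
by rewrite drop_cat -addnS ltnNge leq_addr /= addKn -!catA.
Qed.

(** * The relabelling action on trees *)

Section TreeAct.
Variable n : nat.
Implicit Types (s t : 'S_n.+1) (a b : tree n).

Lemma label_map_ord s (i : 'I_n.+1) : label_map s i = s^-1 i.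
Proof. by rewrite /label_map inord_val. Qed.

Lemma label_mapE s (i : 'I_n.+1) : label_map s (s i) = i.
Proof. by rewrite label_map_ord permK. Qed.

Lemma label_map_inj s : {in [pred l | l <= n] &, injective (label_map s)}.
Proof.
move=> k l; rewrite !inE => le_k le_l.
rewrite -[k]/(nat_of_ord (Ordinal (le_k : k < n.+1))).
rewrite -[l]/(nat_of_ord (Ordinal (le_l : l < n.+1))) !label_map_ord.
by move/val_inj/perm_inj => [].
Qed.

Lemma label_mapM s t l : label_map (s * t) l = label_map s (label_map t l).
Proof. by rewrite {1 3}/label_map invMg permM label_map_ord. Qed.

Lemma leaves_le a l : l \in leaves a -> l <= n.
Proof. by rewrite mem_leaves => /andP[]. Qed.

Lemma leaves0 a : 0 \notin leaves a.
Proof. by rewrite mem_leaves. Qed.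

Lemma label_in a (i : 'I_n.+1) : (nat_of_ord i \in leaves a) = (i != ord0).
Proof. by rewrite mem_leaves -val_eqE /= lt0n -ltnS ltn_ord andbT. Qed.

Lemma root_at_inj s a l : l <= n ->
  {in l :: leaves a ++ leaves (Leaf 0) &, injective (label_map s)}.
Proof.
have le k : k \in l :: leaves a ++ leaves (Leaf 0) -> l <= n -> k <= n.
  rewrite inE mem_cat mem_seq1 => /orP[/eqP ->|/orP[/leaves_le|/eqP ->]] //.
by move=> le_l j k /le - /(_ le_l) le_j /le - /(_ le_l) le_k; apply: label_map_inj.
Qed.

(** The edge that receives the label 0 is the one labelled [s 0], so the tree can be re-rooted there
    first. In this form the product rule reduces to [root_at_root_at]. *)
Lemma act_btreeE s a : act_btree s a = relabel (label_map s) (root_at (s ord0) a (Leaf 0)).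
Proof.
rewrite -relabel_root_at; last by apply: root_at_inj; rewrite -ltnS ltn_ord.
rewrite label_mapE /act_btree /root_at0 /root_at /= mem_seq1 eq_sym.
have -> : label_map s 0 = s^-1 ord0 by rewrite (label_map_ord s ord0).
by case: eqP => // _; rewrite reroot_at0.
Qed.

Lemma root_at_root_at a (k l : nat) : k <= n -> l <= n ->
  root_at l (root_at k a (Leaf 0)) (Leaf k) = root_at l a (Leaf 0).
Proof.
move=> le_k le_l; rewrite {2}/root_at mem_seq1.
have [-> //|nz_k] := eqVneq k 0.
have uniq0 : uniq (leaves (Leaf 0) ++ leaves a) by rewrite /= uniq_leaves leaves0.
have in0 l' : l' <= n -> l' \in leaves (Leaf 0) ++ leaves a.
  by rewrite mem_cat mem_seq1 mem_leaves lt0n; case: eqP.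
rewrite -root_at_reroot ?in0 //; last by rewrite mem_leaves lt0n nz_k.
have := in0 _ le_l; rewrite mem_cat => in_l; apply: root_atC => //.
apply/negP => /andP[]; rewrite mem_seq1 => /eqP ->.
by rewrite (negbTE (leaves0 a)).
Qed.

Lemma tree_act_id a : tree_act 1 a = a.
Proof.
apply: val_inj; rewrite /= act_btreeE perm1 /root_at mem_seq1 eqxx /=.
rewrite -[RHS]relabel_id; apply: eq_in_relabel => l /leaves_le le_l.
by rewrite /label_map invg1 perm1 inordK.
Qed.

Lemma tree_actM s t a : tree_act (s * t) a = tree_act s (tree_act t a).
Proof.
have le (i : 'I_n.+1) : i <= n by rewrite -ltnS.
apply: val_inj; rewrite /= [RHS](act_btreeE s (tree_act t a)) /= !act_btreeE permM.
set A := root_at (t ord0) a (Leaf 0).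
have leA k : k \in leaves A -> k <= n.
  rewrite /A /root_at mem_seq1; case: eqVneq => [_ /leaves_le //|nz_t] in_k.
  have in_t : (t ord0 : nat) \in leaves a by rewrite label_in -val_eqE.
  have := perm_mem (perm_reroot_at (Leaf 0) in_t) k.
  by rewrite inE in_k orbT /= inE => /esym /orP[/eqP ->|/leaves_le].
have -> : root_at (s ord0) (relabel (label_map t) A) (Leaf 0) =
    relabel (label_map t) (root_at (t (s ord0)) A (Leaf (t ord0))).
  rewrite -relabel_root_at /= ?label_mapE // => j k in_j in_k.
  apply: label_map_inj; rewrite inE.
    by move: in_j; rewrite inE mem_cat mem_seq1 => /orP[/eqP ->|/orP[/leA|/eqP ->]].
  by move: in_k; rewrite inE mem_cat mem_seq1 => /orP[/eqP ->|/orP[/leA|/eqP ->]].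
rewrite root_at_root_at // relabel_comp; apply: eq_in_relabel => l _.
by rewrite /= label_mapM.
Qed.

Lemma tree_act_sym (s : 'S_n) a : tree_act (lift_perm ord0 ord0 s) a = tree_sym s a.
Proof.
apply: val_inj; rewrite /= /act_btree lift_permV lift_perm_id.
by rewrite /root_at0 eqxx.
Qed.

(* The labels of the boundary edges, in cyclic order from the edge 0 on. *)
Definition boundary a : seq nat := 0 :: leaves a.

Lemma boundary_root_at a l : l <= n ->
  l :: leaves (root_at l a (Leaf 0)) = rot (index l (boundary a)) (boundary a).
Proof.
rewrite /root_at mem_seq1 /boundary /= eq_sym; case: (eqVneq 0 l) => [<- _|nz_l le_l].
  by rewrite rot0.
have in_l : l \in leaves a by rewrite mem_leaves lt0n eq_sym nz_l.
rewrite leaves_reroot_at // /rot /= -cat_cons; congr (_ ++ _).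
by rewrite [RHS](drop_nth 0) ?index_mem // nth_index.
Qed.

Lemma boundary_act s a :
  boundary (tree_act s a) =
  map (label_map s) (rot (index (nat_of_ord (s ord0)) (boundary a)) (boundary a)).
Proof.
have le : s ord0 <= n by rewrite -ltnS.
rewrite -boundary_root_at // /= label_mapE -leaves_relabel.
by rewrite /boundary /= act_btreeE.
Qed.

End TreeAct.
(** Substitution of trees for leaves. Grafting and relabelling are both instances, which reduces
    identities between re-rooted grafts to a check on each leaf. *)
Fixpoint bsub (f : nat -> btree) (t : btree) : btree :=
  match t with Leaf l => f l | Node t1 t2 => Node (bsub f t1) (bsub f t2) end.

Definition graft_at m i (y : btree) (l : nat) : btree :=
  if l == i.+1 then relabel (addn i) y else Leaf (shift_label m i l).

Lemma graft_bsub m i t y : graft m i t y = bsub (graft_at m i y) t.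
Proof. by elim: t => //= t1 -> t2 ->. Qed.

Lemma bsub_relabel f g t : bsub f (relabel g t) = bsub (f \o g) t.
Proof. by elim: t => //= t1 -> t2 ->. Qed.

Lemma relabel_bsub f g t : relabel g (bsub f t) = bsub (relabel g \o f) t.
Proof. by elim: t => //= t1 -> t2 ->. Qed.

Lemma bsub_leaf t : bsub Leaf t = t.
Proof. by elim: t => //= t1 -> t2 ->. Qed.

Lemma eq_in_bsub f g t : {in leaves t, f =1 g} -> bsub f t = bsub g t.
Proof.
elim: t => [l|t1 IH1 t2 IH2] /= eq_fg; first by rewrite eq_fg ?mem_seq1.
rewrite IH1 ?IH2 // => l in_l; apply: eq_fg; by rewrite mem_cat in_l ?orbT.
Qed.

Lemma mem_bsub f l t : (l \in leaves (bsub f t)) = has (fun k => l \in leaves (f k)) (leaves t).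
Proof. by elim: t => [k|t1 IH1 t2 IH2] /=; rewrite ?orbF // mem_cat has_cat IH1 IH2. Qed.

(** The path to [l] in the substituted tree runs through [t] to the leaf [k] and then inside [f k];
    re-rooting is done along these two pieces in turn. *)
Lemma reroot_at_bsub f l k c t : k \in leaves t ->
  {in leaves t, forall j, (l \in leaves (f j)) = (j == k)} ->
  reroot_at l (bsub f c) (bsub f t) = reroot_at l (bsub f (reroot_at k c t)) (f k).
Proof.
elim: t c => [j|t1 IH1 t2 IH2] c /=; first by rewrite mem_seq1 => /eqP ->.
move=> in_k fE.
have fE1 : {in leaves t1, forall j, (l \in leaves (f j)) = (j == k)}.
  by move=> j in_j; apply: fE; rewrite mem_cat in_j.
have fE2 : {in leaves t2, forall j, (l \in leaves (f j)) = (j == k)}.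
  by move=> j in_j; apply: fE; rewrite mem_cat in_j orbT.
have -> : (l \in leaves (bsub f t1)) = (k \in leaves t1).
  rewrite mem_bsub; apply/hasP/idP => [[j in_j]|in1]; last by exists k; rewrite ?fE1.
  by rewrite fE1 // => /eqP <-.
move: in_k; rewrite mem_cat; case: ifP => /= [in1 _|_ in2].
  by rewrite -IH1.
by rewrite -IH2.
Qed.

Lemma label_map_zcyc n l : l <= n -> label_map (zcyc n) l = if l == 0 then n else l.-1.
Proof.
move=> le_l; rewrite /label_map; set i : 'I_n.+1 := inord l.
have -> : i = zcyc n (inord (if l == 0 then n else l.-1)).
  apply: val_inj; rewrite permE /= !inordK //; last by case: ifP; lia.
  by case: eqP => [->|?]; rewrite ?modnn // prednK ?modn_small //; lia.
by rewrite permK inordK //; case: ifP; lia.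
Qed.

Lemma zcyc0 n : 0 < n -> zcyc n ord0 = 1%N :> nat.
Proof. by move=> n_gt0; rewrite permE /= modn_small. Qed.

Lemma act_zcyc n (x : tree n) : 0 < n ->
  act_btree (zcyc n) x = relabel (label_map (zcyc n)) (reroot_at 1 (Leaf 0) x).
Proof.
by move=> n_gt0; rewrite /= act_btreeE zcyc0 // /root_at mem_seq1.
Qed.

Lemma mem_reroot1 n (x : tree n) l : 0 < n ->
  (l \in leaves (reroot_at 1 (Leaf 0) x)) = (l != 1%N) && (l <= n).
Proof.
move=> n_gt0; have in1 : 1%N \in leaves x by rewrite mem_leaves.
have P := perm_reroot_at (Leaf 0) in1; have := perm_mem P l.
have : uniq (1%N :: leaves (reroot_at 1 (Leaf 0) x)).
  by rewrite (perm_uniq P) /= uniq_leaves leaves0.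
rewrite /= inE => /andP[nin1 _]; rewrite inE mem_leaves.
have [->|neq] /= := eqVneq l 1%N; first by rewrite (negbTE nin1).
by move=> ->; rewrite lt0n; case: eqP => // ->.
Qed.

(** [zcyc] cuts at the edge labelled 1. As [i] is not the first input, this edge belongs to [x], and
    [y] is only carried along. *)
Lemma tree_act_circ n m (i j : 'I_n) (x : tree n) (y : tree m) : j.+1 = i :> nat ->
  tree_act (zcyc _) (tree_circ i x y) = tree_circ j (tree_act (zcyc n) x) y.
Proof.
move=> def_i; have lt_i := ltn_ord i; have n_gt0 : 0 < n by lia.
have N_gt0 : 0 < (n + m).-1 by lia.
apply: val_inj; rewrite /= (act_zcyc (tree_circ i x y)) // act_zcyc //= !graft_bsub.
rewrite bsub_relabel.
have -> : Leaf 0 = bsub (graft_at m i y) (Leaf 0) by [].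
rewrite (@reroot_at_bsub _ _ 1%N) ?mem_leaves //; last first.
  move=> l; rewrite mem_leaves => l_n; rewrite /graft_at; case: eqP => [->|neq].
    rewrite leaves_relabel eqSS; apply/mapP/eqP => [[k in_k]|]; last by lia.
    by move: in_k; rewrite mem_leaves; lia.
  by rewrite mem_seq1 /shift_label eq_sym; case: ifP; lia.
have -> : graft_at m i y 1%N = Leaf 1 by rewrite /graft_at /shift_label eqSS -def_i.
rewrite /= relabel_bsub; apply: eq_in_bsub => l.
rewrite mem_reroot1 // => /andP[neq_l le_l] /=.
rewrite /graft_at (label_map_zcyc le_l).
have [def_l|neq_l'] := eqVneq l i.+1.
  rewrite ifT; last by rewrite def_l def_i.
  rewrite relabel_comp; apply: eq_in_relabel => k; rewrite mem_leaves => k_m.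
  by rewrite /= label_map_zcyc; [case: ifP|]; lia.
rewrite ifF; last by case: ifP; lia.
rewrite /= label_map_zcyc /shift_label; last by case: ifP; lia.
congr Leaf; have [->|nz_l] := eqVneq l 0.
  by rewrite /= [n <= j](_ : _ = false) //; lia.
case: (leqP l i) => le_li; first by rewrite (negbTE nz_l) ifT //; lia.
by rewrite !ifF //; lia.
Qed.

Lemma tree_val_cast k k' (e : k = k') (x : tree k) :
  tree_val (ecast i (tree i) e x) = tree_val x.
Proof. by case: k' / e. Qed.

Lemma tree_act_circ1 n m (i : 'I_n) (j : 'I_m) (x : tree n) (y : tree m)
    (e : (m + n).-1 = (n + m).-1) : i = 0 :> nat -> j.+1 = m ->
  tree_act (zcyc _) (tree_circ i x y) =
  ecast k (tree k) e (tree_circ j (tree_act (zcyc m) y) (tree_act (zcyc n) x)).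
Proof.
move=> i0 def_m; have lt_i := ltn_ord i; have n_gt0 : 0 < n by lia.
have m_gt0 : 0 < m by lia.
have N_gt0 : 0 < (n + m).-1 by lia.
apply: val_inj; rewrite /= tree_val_cast (act_zcyc (tree_circ i x y)) //=.
rewrite !act_zcyc // !graft_bsub i0.
set f := graft_at m 0 y; set x' := reroot_at 1 (Leaf 0) x.
set y' := reroot_at 1 (Leaf 0) y.
have f1 : f 1%N = y.
  by rewrite /f /graft_at eqxx -[RHS]relabel_id; apply: eq_in_relabel.
have -> : Leaf 0 = bsub f (Leaf 0) by [].
rewrite (@reroot_at_bsub _ _ 1%N) ?mem_leaves //; last first.
  move=> l; rewrite mem_leaves => l_n.
  have [->|neq] := eqVneq l 1%N; first by rewrite f1 mem_leaves.
  by rewrite /f /graft_at (negbTE neq) mem_seq1 /shift_label; case: ifP; lia.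
(* Here the edge 1 lies in [y]. After re-rooting, [y'] has a leaf 0 in the place of its former root,
   and [g] puts the re-rooted [x] there, which exchanges the roles of the two trees. *)
rewrite f1 -/x'; pose g l := if l == 0 then bsub f x' else Leaf l.
have gy : bsub g y = y.
  rewrite -[RHS]bsub_leaf; apply: eq_in_bsub => l.
  by rewrite mem_leaves /g; case: eqP => // ->.
rewrite -{1}gy -[bsub f x']/(bsub g (Leaf 0)) (@reroot_at_bsub _ _ 1%N) ?mem_leaves //; last first.
  by move=> l; rewrite mem_leaves /g; case: eqP => [->|_ _] //; rewrite mem_seq1 eq_sym.
rewrite /= -/y' relabel_bsub bsub_relabel; apply: eq_in_bsub => l.
rewrite mem_reroot1 // => /andP[neq_l le_l] /=; rewrite label_map_zcyc // /g /graft_at.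
have [_|nz_l] := eqVneq l 0.
  rewrite ifT; last by rewrite def_m.
  rewrite relabel_bsub relabel_comp -[in RHS](bsub_leaf x') relabel_bsub.
  apply: eq_in_bsub => k; rewrite mem_reroot1 // => /andP[neq_k le_k] /=.
  rewrite /f /graft_at (negbTE neq_k) /= (label_map_zcyc le_k) /shift_label.
  case: (eqVneq k 0) => [->|nz_k].
    by rewrite label_map_zcyc //=; congr Leaf; lia.
  rewrite ifF ?label_map_zcyc; [|by lia..].
  by rewrite ifF; [congr Leaf|]; lia.
rewrite ifF /=; last by lia.
by rewrite label_map_zcyc /shift_label ?(negbTE nz_l) ?ifT //; lia.
Qed.

Lemma btree_size_gt0 t : 0 < size (leaves t).
Proof. by elim: t => //= t1 IH1 t2 IH2; rewrite size_cat ltn_addr. Qed.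

Lemma tree_gt0 n (x : tree n) : 0 < n.
Proof. by rewrite -(size_leaves x) btree_size_gt0. Qed.

Lemma tree_cyclic : cyclic_axioms (ob_ops PaRB) tree_act.
Proof.
split=> /=.
- exact: tree_act_id.
- exact: tree_actM.
- exact: tree_act_sym.
- by apply: val_inj; rewrite /= (act_zcyc tree_one) //= label_map_zcyc.
- by move=> n m i j x y; apply: tree_act_circ.
- by move=> n m i j x y e; apply: tree_act_circ1.
(* A tree has at least one leaf, so there is no [y] of arity 0. *)
- by move=> n i j x y; have := tree_gt0 y.
Qed.
(** * The cyclic structure *)

Section RootPos.
Variable n : nat.
Implicit Types (s t : 'S_n.+1) (a b : tree n) (f g : mor n).

Lemma size_boundary a : size (boundary a) = n.+1.
Proof. by rewrite /= size_leaves. Qed.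

Lemma boundary_uniq a : uniq (boundary a).
Proof. by rewrite /= uniq_leaves leaves0. Qed.

Definition root_pos s a : nat := index (nat_of_ord (s ord0)) (boundary a).

Lemma mem_boundary a (i : 'I_n.+1) : nat_of_ord i \in boundary a.
Proof. by rewrite inE label_in -val_eqE /=; case: (_ == _). Qed.

Lemma nth_root_pos s a : nth 0 (boundary a) (root_pos s a) = s ord0.
Proof. exact/nth_index/mem_boundary. Qed.

Lemma root_pos_le s a : root_pos s a <= n.
Proof. by rewrite -ltnS -(size_boundary a) index_mem mem_boundary. Qed.

Lemma root_posP s a q : q <= n -> nth 0 (boundary a) q = s ord0 -> root_pos s a = q.
Proof. by move=> le_q nth_q; rewrite /root_pos -nth_q index_uniq ?boundary_uniq ?size_boundary. Qed.

Lemma nth_boundary_act s a j : j <= n ->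
  nth 0 (boundary (tree_act s a)) (rot_pos n (root_pos s a) j) =
  label_map s (nth 0 (boundary a) j).
Proof.
move=> le_j; have le_q := root_pos_le s a.
rewrite boundary_act -/(root_pos s a) (nth_map 0); last first.
  by rewrite size_rot size_boundary ltnS rot_pos_le.
congr (label_map s _); move: (root_pos s a) le_q => q le_q.
rewrite /rot nth_cat size_drop size_boundary /rot_pos; case: (leqP q j) => [le_qj|lt_jq].
  by rewrite ifT ?nth_drop ?subnKC //; lia.
rewrite ifF; last by lia.
by rewrite nth_take; [congr nth|]; lia.
Qed.

Lemma nth_boundary_mor f j : j <= n ->
  nth 0 (boundary (mtgt f)) (hat (mrib f) j) = nth 0 (boundary (msrc f)) j.
Proof.
case: j => // j lt_j; rewrite /= -[j]/(nat_of_ord (Ordinal lt_j)) npos_ord.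
exact/tree_permP/mor_perm.
Qed.

Lemma root_pos_mor s f : root_pos s (mtgt f) = hat (mrib f) (root_pos s (msrc f)).
Proof.
by apply: root_posP; rewrite ?hat_le ?root_pos_le // nth_boundary_mor ?nth_root_pos ?root_pos_le.
Qed.

Lemma mor_act_subproof s f :
  ribbon_perm (rebase (root_pos s (msrc f)) (mrib f)) ==
  (tree_perm (tree_act s (msrc f)))^-1 * tree_perm (tree_act s (mtgt f)).
Proof.
apply/tree_permP => r; set q := root_pos s (msrc f).
have le_q : q <= n := root_pos_le s (msrc f).
rewrite -!(npos_ord, nth_behead) -[LHS]/(nth 0 (boundary (tree_act s (mtgt f))) (npos _ r).+1).
rewrite -[RHS]/(nth 0 (boundary (tree_act s (msrc f))) r.+1) -[(npos _ r).+1]/(hat _ r.+1).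
have lt_r := ltn_ord r; have := unrot_posK le_q lt_r.
have := unrot_pos_le le_q lt_r; move: (unrot_pos _ _ _) => j le_j <-.
by rewrite hat_rebase // -root_pos_mor !nth_boundary_act ?hat_le // nth_boundary_mor.
Qed.

Definition mor_act s f : mor n := Mor (mor_act_subproof s f).

Lemma root_posM s t a :
  root_pos s (tree_act t a) = rot_pos n (root_pos t a) (root_pos (s * t) a).
Proof.
apply: root_posP; first by rewrite rot_pos_le ?root_pos_le.
by rewrite nth_boundary_act ?root_pos_le // nth_root_pos permM label_mapE.
Qed.

Lemma mor_act_id f : mor_act 1 f = f.
Proof.
apply: mor_eq; rewrite /= ?tree_act_id // (@root_posP _ _ 0) ?rebase0 //.
by rewrite perm1.
Qed.

Lemma mor_actM s t f : mor_act (s * t) f = mor_act s (mor_act t f).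
Proof.
apply: mor_eq; rewrite /= ?tree_actM // root_posM rebase_rebase //;
  exact: root_pos_le.
Qed.

Lemma mor_act_sym (s : 'S_n) f : mor_act (lift_perm ord0 ord0 s) f = mor_sym s f.
Proof.
apply: mor_eq; rewrite /= ?tree_act_sym // (@root_posP _ _ 0) ?rebase0 //.
by rewrite lift_perm_id.
Qed.

Lemma mor_act_idt s a : mor_act s (mor_id a) = mor_id (tree_act s a).
Proof. by apply: mor_eq; rewrite //= rebase1 // root_pos_le. Qed.

Lemma mor_act_comp s g f : mtgt f = msrc g ->
  mor_act s (mor_comp g f) = mor_comp (mor_act s g) (mor_act s f).
Proof.
move=> fg; have fg' : mtgt (mor_act s f) = msrc (mor_act s g) by rewrite /= fg.
apply: mor_eq; rewrite ?(msrc_comp fg') ?(mtgt_comp fg') ?(mrib_comp fg') /=.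
- by rewrite msrc_comp.
- by rewrite mtgt_comp.
- by rewrite msrc_comp // mrib_comp // rebaseM ?root_pos_le // -root_pos_mor fg.
Qed.

End RootPos.

Lemma nth_boundary_tree_perm n (a : tree n) (i : 'I_n) :
  nth 0 (boundary a) (tree_perm a i).+1 = i.+1.
Proof. exact: nth_tree_perm. Qed.

Lemma tree_perm_boundary n (a : tree n) (i : 'I_n) q :
  q < n -> nth 0 (boundary a) q.+1 = i.+1 -> tree_perm a i = q :> nat.
Proof.
move=> lt_q /= nth_q; rewrite tree_permE -nth_q index_uniq ?size_leaves //.
exact: uniq_leaves.
Qed.

(** The new root is the strand of input 1, which lies outside the block inserted at a later input:
    this is [rebase_circ_outer], with labels translated into positions. *)
Lemma mor_act_circ n m (i j : 'I_n) (f : mor n) (g : mor m) : j.+1 = i :> nat ->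
  mor_act (zcyc _) (mor_circ i f g) = mor_circ j (mor_act (zcyc n) f) g.
Proof.
move=> def_i; have m_gt0 := tree_gt0 (msrc g).
have lt_i := ltn_ord i; have n_gt0 : 0 < n by lia.
apply: mor_eq; rewrite /= ?(tree_act_circ _ _ def_i) //.
pose a := msrc f; pose p := tree_perm a i; pose q := tree_perm a (Ordinal n_gt0).
have neq : q != p by rewrite (inj_eq perm_inj) -val_eqE /=; lia.
have qE : root_pos (zcyc n) a = q.+1.
  by apply: root_posP => //; rewrite nth_boundary_tree_perm zcyc0.
have lt_p := ltn_ord p; have lt_q := ltn_ord q.
have QE : root_pos (zcyc (n + m).-1) (tree_circ i a (msrc g)) = (outer_pos m p q).+1.
  apply: root_posP.
    by move: neq; rewrite -val_eqE /outer_pos /=; case: ifP; lia.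
  have [_ out] := nth_graft i a (msrc g).
  rewrite zcyc0 /=; last by lia.
  rewrite out // nth_tree_perm /shift_label /= ifT //; lia.
have pE : tree_perm (tree_act (zcyc n) a) j = (rot_pos n q.+1 p.+1).-1 :> nat.
  have gt0 : 0 < rot_pos n q.+1 p.+1.
    by move: neq; rewrite -val_eqE /rot_pos /=; case: ifP; lia.
  have le := @rot_pos_le n q.+1 p.+1 (ltn_ord q) (ltn_ord p).
  apply: tree_perm_boundary; first by lia.
  by rewrite prednK // -qE nth_boundary_act ?nth_boundary_tree_perm ?label_map_zcyc.
rewrite -/a QE qE; have := rebase_circ_outer (erefl (n + m).-1) m_gt0 (mrib f) (mrib g) neq pE.
by [].
Qed.

Lemma mrib_cast k k' (e : k = k') (f : mor k) :
  [/\ msrc (ecast i (mor i) e f) = ecast i (tree i) e (msrc f),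
      mtgt (ecast i (mor i) e f) = ecast i (tree i) e (mtgt f)
    & mrib (ecast i (mor i) e f) = ecast i (ribbon i) e (mrib f)].
Proof. by case: k' / e. Qed.

(** Input 1 of the composite is input 1 of [g], so the new root lies inside the inserted block, and
    [rebase_circ_inner] applies. The last input of the rotated [g] stands in the position
    [rev_ord k] of its old root. *)
Lemma mor_act_circ1 n m (i : 'I_n) (j : 'I_m) (f : mor n) (g : mor m)
    (e : (m + n).-1 = (n + m).-1) : i = 0 :> nat -> j.+1 = m ->
  mor_act (zcyc _) (mor_circ i f g) =
  ecast k (mor k) e (mor_circ j (mor_act (zcyc m) g) (mor_act (zcyc n) f)).
Proof.
move=> i0 def_m; have lt_i := ltn_ord i; have n_gt0 : 0 < n by lia.
have m_gt0 : 0 < m by lia.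
case: (mrib_cast e (mor_circ j (mor_act (zcyc m) g) (mor_act (zcyc n) f))) => Es Et Er.
apply: mor_eq; first by rewrite Es; apply: tree_act_circ1.
  by rewrite Et; apply: tree_act_circ1.
rewrite {Es Et}Er /=; pose a := msrc f; pose b := msrc g.
pose p := tree_perm a i; pose k := tree_perm b (Ordinal m_gt0).
have lt_p := ltn_ord p; have lt_k := ltn_ord k.
have pE : root_pos (zcyc n) a = p.+1.
  by apply: root_posP => //; rewrite nth_boundary_tree_perm zcyc0 ?i0.
have kE : root_pos (zcyc m) b = k.+1.
  by apply: root_posP => //; rewrite nth_boundary_tree_perm zcyc0.
have QE : root_pos (zcyc (n + m).-1) (tree_circ i a b) = (p + k).+1.
  apply: root_posP; first by lia.
  have [inn _] := nth_graft i a b.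
  rewrite zcyc0 /=; last by lia.
  by rewrite inn nth_tree_perm i0.
have rE : tree_perm (tree_act (zcyc m) b) j = rev_ord k.
  apply: val_inj => /=; apply: tree_perm_boundary; first by lia.
  have -> : (m - k.+1).+1 = rot_pos m k.+1 0 by rewrite /rot_pos ltn0; lia.
  by rewrite -kE nth_boundary_act // label_map_zcyc.
rewrite -/a -/b QE pE kE rE.
exact: (rebase_circ_inner (erefl (n + m).-1) e n_gt0 m_gt0 p k (mrib f) (mrib g)).
Qed.

Lemma mor_cyclic : cyclic_axioms (arr_ops PaRB) mor_act.
Proof.
split=> /=.
- exact: mor_act_id.
- exact: mor_actM.
- exact: mor_act_sym.
- by rewrite mor_act_idt (act_one tree_cyclic).
- by move=> n m i j f g; apply: mor_act_circ.
- by move=> n m i j f g e; apply: mor_act_circ1.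
- by move=> n i j f g; have := tree_gt0 (msrc g).
Qed.

Lemma PaRB_cyclic : cyclic_structure PaRB tree_act mor_act.
Proof.
split=> //=.
- exact: mor_act_idt.
- exact: mor_act_comp.
- exact: tree_cyclic.
- exact: mor_cyclic.
Qed.

(** * Values on the generating morphisms *)

Lemma label_map_s0 n l : l <= n.+1 ->
  label_map (s0 n) l = if l == 0 then 1%N else if l == 1%N then 0 else l.
Proof.
move=> le_l; rewrite /label_map /s0 tpermV; case: tpermP => [E|E|E0 E1].
- by have := congr1 val E; rewrite /= inordK // => ->.
- by have := congr1 val E; rewrite /= inordK // => ->.
rewrite inordK //; case: eqP => [l0|_].
  by case: E0; apply: val_inj; rewrite /= inordK // l0.
case: eqP => [l1|//].
by case: E1; apply: val_inj; rewrite /= inordK // l1.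
Qed.

Lemma s0_0 n : s0 n ord0 = 1%N :> nat.
Proof. by rewrite /s0 tpermL. Qed.

Lemma tree1 (a : tree 1) : a = tree_one.
Proof.
apply: val_inj => /=; have := treeP a; case: a => -[l|t1 t2] /= _.
  by move/perm_small_eq => /(_ isT) [->].
move/perm_size; rewrite size_cat /=.
by have := btree_size_gt0 t1; have := btree_size_gt0 t2; lia.
Qed.

Lemma tau_spin : mrib tau = spin 1 0.
Proof. by rewrite spinE; apply: ribbon_eq => // p; rewrite !ffunE; case: p => [[]]. Qed.

Lemma mor_act_tau : mor_act (s0 0) tau = tau.
Proof.
apply: mor_eq; rewrite /= ?(tree1 (tree_act _ _)) //.
rewrite (@root_posP _ _ _ 1) ?s0_0 //.
have -> : Ribbon 1 [ffun=> 1%R] = spin 1 0 by rewrite -tau_spin.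
rewrite rebase_spin // eqxx /full_spin monoid.expg1 swingE fup0 mul1g.
by [].
Qed.

Lemma tree_act_s0_mu : tree_act (s0 1) mu = mu21.
Proof.
apply: val_inj; rewrite [LHS](act_btreeE (s0 1) mu) s0_0 /root_at /=.
by rewrite !label_map_s0.
Qed.

Lemma tree_act_s0_mu21 : tree_act (s0 1) mu21 = mu.
Proof.
apply: val_inj; rewrite [LHS](act_btreeE (s0 1) mu21) s0_0 /root_at /=.
by rewrite !label_map_s0.
Qed.

Lemma beta12_cross : mrib beta12 = cross 2 0.
Proof.
rewrite crossE /= /flat; congr Ribbon; rewrite /sigma /gen to_word1 //.
by congr (wbraid [:: (_, _)]); apply: val_inj.
Qed.

Lemma mor_act_beta12 : mor_act (s0 1) beta12 =
  mor_comp (mor_circ ord_max (mor_id mu) (mor_inv tau)) (mor_inv beta12).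
Proof.
have match_mu : mtgt (mor_inv beta12) = msrc (mor_circ ord_max (mor_id mu) (mor_inv tau)).
  exact: val_inj.
apply: mor_eq; rewrite ?(msrc_comp match_mu) ?(mtgt_comp match_mu) ?(mrib_comp match_mu).
- exact: tree_act_s0_mu.
- by rewrite [LHS]tree_act_s0_mu21; apply: val_inj.
have -> : mrib (mor_inv beta12) = (cross 2 0)^-1 by rewrite -beta12_cross.
have -> : mrib (mor_act (s0 1) beta12) = (swing 2 0 1)^-1.
  have <- : rebase 1 (cross 2 0) = (swing 2 0 1)^-1 by rewrite rebase_cross ?turn_eq.
  have E : root_pos (s0 1) mu = 1%N by apply: root_posP; rewrite ?s0_0.
  by rewrite -beta12_cross /= E.
set p := tree_perm mu ord_max.
have -> : mrib (mor_circ ord_max (mor_id mu) (mor_inv tau)) =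
    circ_to (erefl : (2 + 1).-1 = 2) p 1 (spin 1 0)^-1 by rewrite -tau_spin.
rewrite circ_toVr circ_to1_spin // swingE invgM fup1.
by have -> : p = 1%N :> nat by rewrite /p tree_permE.
Qed.

Lemma mor_act_alpha123 : mor_act (s0 2) alpha123 = mor_inv alpha231.
Proof.
have lm l : l < 3 -> label_map (lift_perm ord0 ord0 (perm (@ordS_inj 3))^-1) l.+1 = (l.+1 %% 3).+1.
  move=> lt_l; rewrite /label_map lift_permV invgK.
  have -> : inord l.+1 = lift ord0 (Ordinal lt_l) :> 'I_4.
    by apply: val_inj; rewrite /= inordK.
  by rewrite lift_perm_lift permE.
apply: mor_eq.
- apply: val_inj; rewrite [LHS](act_btreeE (s0 2) (tree_circ ord0 mu mu)) s0_0 /root_at /=.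
  by rewrite !label_map_s0 // !lm.
- apply: val_inj; rewrite [LHS](act_btreeE (s0 2) (tree_circ ord_max mu mu)) s0_0 /root_at /=.
  by rewrite !label_map_s0 // !lm.
by rewrite /= invg1 rebase1 // root_pos_le.
Qed.
(** * Generation and uniqueness *)

(** Two bracketings of the same word are linked by reassociations, via the right comb. Making the
    linking relation inductive lets a morphism with trivial ribbon braid be decomposed along its
    derivation. *)
Inductive assoc_eq : btree -> btree -> Prop :=
| assoc_refl t : assoc_eq t t
| assoc_sym t u : assoc_eq t u -> assoc_eq u t
| assoc_trans t u v : assoc_eq t u -> assoc_eq u v -> assoc_eq t v
| assoc_node t t' u u' :
    assoc_eq t t' -> assoc_eq u u' -> assoc_eq (Node t u) (Node t' u')
| assoc_assoc t u v : assoc_eq (Node (Node t u) v) (Node t (Node u v)).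

Lemma assoc_leaves t u : assoc_eq t u -> leaves t = leaves u.
Proof.
elim=> {t u} //= [t u v _ -> _ -> //|t t' u u' _ -> _ -> //|t u v].
by rewrite catA.
Qed.

Fixpoint comb (l : nat) (s : seq nat) : btree :=
  if s is l' :: s' then Node (Leaf l) (comb l' s') else Leaf l.

Lemma leaves_comb l s : leaves (comb l s) = l :: s.
Proof. by elim: s l => //= l' s IH l; rewrite IH. Qed.

Lemma assoc_comb t l s : leaves t = l :: s -> assoc_eq t (comb l s).
Proof.
elim: t l s => [k|t1 IH1 t2 IH2] l s /=; first by case=> -> <-; apply: assoc_refl.
have := btree_size_gt0 t1; have := btree_size_gt0 t2.
case E1: (leaves t1) => [//|l1 s1]; case E2: (leaves t2) => [//|l2 s2] _ _ [<- <-].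
apply: assoc_trans (assoc_node (IH1 _ _ E1) (IH2 _ _ E2)) _.
elim: s1 l1 {E1 IH1} => [|k s1 IH] l1 /=; first exact: assoc_refl.
apply: assoc_trans (assoc_assoc _ _ _) _.
exact: assoc_node (assoc_refl _) (IH _).
Qed.

Lemma leaves_assoc t u : leaves t = leaves u -> assoc_eq t u.
Proof.
have := btree_size_gt0 t; case E: (leaves t) => [//|l s] _ /esym E'.
exact: assoc_trans (assoc_comb E) (assoc_sym (assoc_comb E')).
Qed.

Lemma graft_above m i k t y : i < k -> {in leaves t, forall l, 0 < l} ->
  graft m i (relabel (addn k) t) y = relabel (addn (k + m).-1) t.
Proof.
move=> lt_ik pos; have -> : relabel (addn (k + m).-1) t = bsub (Leaf \o addn (k + m).-1) t.
  by elim: t {pos} => //= t1 -> t2 ->.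
rewrite graft_bsub bsub_relabel; apply: eq_in_bsub => l /pos l_gt0 /=.
rewrite /graft_at ifF; last by lia.
by rewrite /shift_label ifF; [congr Leaf|]; lia.
Qed.

Lemma relabel_addn0 t : relabel (addn 0) t = t.
Proof. by rewrite -[RHS]relabel_id; apply: eq_in_relabel. Qed.

Lemma tree_perm_eq n (a b : tree n) : leaves a = leaves b -> tree_perm a = tree_perm b.
Proof. by move=> E; apply/permP => i; apply: val_inj; rewrite /= !tree_permE E. Qed.

Lemma leaves_tree_perm n (a b : tree n) : tree_perm a = tree_perm b -> leaves a = leaves b.
Proof.
move=> E; apply: (@eq_from_nth _ 0) => [|i]; rewrite !size_leaves // => lt_i.
rewrite -[i]/(nat_of_ord (Ordinal lt_i)) -[Ordinal lt_i](permKV (tree_perm a)).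
by rewrite nth_tree_perm E nth_tree_perm.
Qed.

Lemma mor_symK n (s : 'S_n) (f : mor n) : mor_sym s (mor_sym s^-1 f) = f.
Proof.
rewrite -!mor_act_sym -mor_actM -lift_permV mulgV.
exact: mor_act_id.
Qed.

Lemma mor_invK n (f : mor n) : mor_inv (mor_inv f) = f.
Proof. by apply: mor_eq => //=; rewrite invgK. Qed.

Section Generation.
Variable P : forall n, mor n -> Prop.
Hypothesis P_id : forall n (a : tree n), P (mor_id a).
Hypothesis P_comp : forall n (g f : mor n), mtgt f = msrc g -> P g -> P f -> P (mor_comp g f).
Hypothesis P_inv : forall n (f : mor n), P f -> P (mor_inv f).
Hypothesis P_circ : forall n m (i : 'I_n) (f : mor n) (g : mor m),
  P f -> P g -> P (mor_circ i f g).
Hypothesis P_sym : forall n (s : 'S_n) (f : mor n), P f -> P (mor_sym s f).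
Hypothesis P_tau : P tau.
Hypothesis P_beta : P beta12.
Hypothesis P_alpha : P alpha123.

Lemma P_circ_to n m N (e : (n + m).-1 = N) (i : 'I_n) (f : mor n) (g : mor m) (h : mor N) :
  graft m i (msrc f) (msrc g) = msrc h -> graft m i (mtgt f) (mtgt g) = mtgt h ->
  circ_to e (tree_perm (msrc f) i) (mrib f) (mrib g) = mrib h ->
  P f -> P g -> P h.
Proof.
case: N / e h => h Es Et Er Pf Pg; have -> : h = mor_circ i f g; last exact: P_circ.
by apply: mor_eq; [apply: val_inj|apply: val_inj|]; rewrite /= -?Es -?Et -?Er.
Qed.

Lemma leaves_gt0 n (a : tree n) : {in leaves a, forall l, 0 < l}.
Proof. by move=> l; rewrite mem_leaves => /andP[]. Qed.

(** The morphism is [mu] with [f2] inserted at the second input and then [f1] at the first; in this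
    order the index of the input still to be filled does not change. *)
Lemma P_node n1 n2 n (f1 : mor n1) (f2 : mor n2) (f : mor n) : n1 + n2 = n ->
  Node (msrc f1) (relabel (addn n1) (msrc f2)) = msrc f ->
  Node (mtgt f1) (relabel (addn n1) (mtgt f2)) = mtgt f ->
  mrib f1 = 1 -> mrib f2 = 1 -> mrib f = 1 -> P f1 -> P f2 -> P f.
Proof.
move=> def_n Es Et E1 E2 E P1 P2.
have n1_gt0 := tree_gt0 (msrc f1); have n2_gt0 := tree_gt0 (msrc f2).
have e : ((2 + n2).-1 + n1).-1 = n by lia.
have lt0 : 0 < (2 + n2).-1 by lia.
pose g : mor (2 + n2).-1 := mor_circ ord_max (mor_id mu) f2.
have graftE (a1 : tree n1) (a2 : tree n2) :
    graft n1 0 (graft n2 1 mu a2) a1 = Node a1 (relabel (addn n1) a2).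
  by rewrite /= relabel_addn0 graft_above //; apply: leaves_gt0.
apply: (P_circ_to (e := e) (i := Ordinal lt0) (f := g) (g := f1)) => //.
- by rewrite -Es -graftE.
- by rewrite -Et -graftE.
- rewrite E1 E; have -> : mrib g = 1.
    have -> : mrib g = circ_to (erefl (2 + n2).-1) (tree_perm mu ord_max) 1 1.
      by rewrite -E2.
    exact: circ_to11.
  exact: circ_to11.
exact: P_circ.
Qed.

Lemma P_node3 n1 n2 n3 n (a1 : tree n1) (a2 : tree n2) (a3 : tree n3) (f : mor n) :
  n1 + n2 + n3 = n ->
  Node (Node a1 (relabel (addn n1) a2)) (relabel (addn (n1 + n2)) a3) = msrc f ->
  Node a1 (Node (relabel (addn n1) a2) (relabel (addn (n1 + n2)) a3)) = mtgt f ->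
  mrib f = 1 -> P f.
Proof.
move=> def_n Es Et E.
have n1_gt0 := tree_gt0 a1; have n2_gt0 := tree_gt0 a2; have n3_gt0 := tree_gt0 a3.
have e : (((3 + n3).-1 + n2).-1 + n1).-1 = n by lia.
have lt0 : 0 < ((3 + n3).-1 + n2).-1 by lia.
have lt1 : 1 < (3 + n3).-1 by lia.
pose g : mor (3 + n3).-1 := mor_circ ord_max alpha123 (mor_id a3).
pose h : mor ((3 + n3).-1 + n2).-1 := mor_circ (Ordinal lt1) g (mor_id a2).
have rib1 k m (i : 'I_k) : ribbon_circ i (1 : ribbon k) (1 : ribbon m) = 1.
  exact: (circ_to11 (erefl (k + m).-1) i).
have rh : mrib h = 1 by rewrite -(rib1 _ _ (tree_perm (msrc g) (Ordinal lt1))) -(rib1 _ _ (tree_perm (msrc alpha123) ord_max)).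
have pos1 := @leaves_gt0 _ a2; have pos2 := @leaves_gt0 _ a3.
have E3 : (((2 + n2).-1 + n1).-1 = n1 + n2)%N by lia.
apply: (P_circ_to (e := e) (i := Ordinal lt0) (f := h) (g := mor_id a1)) => //.
- by rewrite -Es /= relabel_addn0 !graft_above // E3.
- by rewrite -Et /= relabel_addn0 !graft_above // E3.
- by rewrite E rh; apply: circ_to11.
by do 2!apply: P_circ => //.
Qed.

Lemma P_cast n n' (e : n = n') (f : mor n) : P f -> P (ecast i (mor i) e f).
Proof. by case: n' / e. Qed.

Lemma shift_subproof n o t : leaves t = iota o.+1 n ->
  perm_eq (leaves (relabel (subn^~ o) t)) (iota 1 n).
Proof.
move=> E; rewrite leaves_relabel E -[o.+1]addn1 addnC -[1 + o]addnC iotaDl -map_comp.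
by rewrite (@eq_map _ _ _ id) ?map_id // => k /=; rewrite addKn.
Qed.

Lemma straight_subproof n (a b : tree n) : leaves a = leaves b ->
  ribbon_perm (1 : ribbon n) == (tree_perm a)^-1 * tree_perm b.
Proof. by move=> /tree_perm_eq ->; rewrite ribbon_perm1 mulVg. Qed.

Definition straight n (a b : tree n) (E : leaves a = leaves b) : mor n :=
  Mor (straight_subproof E).

(** Subtrees carry the consecutive labels [o + 1], .., [o + n]. The offset [o] lets the induction
    descend into them, while the morphism itself has standard labels. *)
Lemma P_assoc t u : assoc_eq t u -> forall o n (f : mor n), leaves t = iota o.+1 n ->
  relabel (subn^~ o) t = msrc f -> relabel (subn^~ o) u = mtgt f -> mrib f = 1 -> P f.
Proof.
elim=> {t u}.
- move=> t o n f _ Es Et Er; have -> : f = mor_id (msrc f); last exact: P_id.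
  by apply: mor_eq => //=; apply: val_inj; rewrite /= -Es -Et.
- move=> t u tu IH o n f E Es Et Er; rewrite -(mor_invK f); apply: P_inv.
  by apply: (IH o) => //=; rewrite ?Er ?invg1 // (assoc_leaves tu).
- move=> t u v tu IH uv IH' o n f E Es Et Er.
  have Eu : leaves u = iota o.+1 n by rewrite -(assoc_leaves tu).
  pose b : tree n := Tree (shift_subproof Eu).
  have E1 : leaves (msrc f) = leaves b.
    by rewrite -Es /= !leaves_relabel (assoc_leaves tu).
  have E2 : leaves b = leaves (mtgt f).
    by rewrite -Et /= !leaves_relabel (assoc_leaves uv).
  have -> : f = mor_comp (straight E2) (straight E1).
    by apply: mor_eq; rewrite ?msrc_comp ?mtgt_comp ?mrib_comp //= mulg1.
  apply: P_comp => //; first exact: (IH' o).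
  exact: (IH o).
- move=> t t' u u' tt' IH uu' IH' o n f /= E Es Et Er.
  pose n1 := size (leaves t); pose n2 := size (leaves u).
  have def_n : n1 + n2 = n by rewrite -size_cat E size_iota.
  have E1 : leaves t = iota o.+1 n1.
    by have := congr1 (take n1) E; rewrite take_size_cat // -def_n iotaD take_size_cat ?size_iota.
  have E2 : leaves u = iota (o + n1).+1 n2.
    by have := congr1 (drop n1) E; rewrite drop_size_cat // -def_n iotaD drop_size_cat ?size_iota.
  have E1' : leaves t' = iota o.+1 n1 by rewrite -(assoc_leaves tt').
  have E2' : leaves u' = iota (o + n1).+1 n2 by rewrite -(assoc_leaves uu').
  pose a1 : tree n1 := Tree (shift_subproof E1); pose b1 : tree n1 := Tree (shift_subproof E1').
  pose a2 : tree n2 := Tree (shift_subproof E2); pose b2 : tree n2 := Tree (shift_subproof E2').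
  have F1 : leaves a1 = leaves b1 by rewrite /= !leaves_relabel (assoc_leaves tt').
  have F2 : leaves a2 = leaves b2 by rewrite /= !leaves_relabel (assoc_leaves uu').
  apply: (@P_node n1 n2 n (straight F1) (straight F2)) => //=.
  + rewrite -Es /= relabel_comp; congr Node; apply: eq_in_relabel => l.
    by rewrite E2 mem_iota /=; lia.
  + rewrite -Et /= relabel_comp; congr Node; apply: eq_in_relabel => l.
    by rewrite E2' mem_iota /=; lia.
  + exact: (IH o).
  + exact: (IH' (o + n1)).
move=> t u v o n f /= E Es Et Er.
pose n1 := size (leaves t); pose n2 := size (leaves u); pose n3 := size (leaves v).
have def_n : n1 + n2 + n3 = n by rewrite -!size_cat E size_iota.
have E12 : leaves t ++ leaves u = iota o.+1 (n1 + n2).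
  have := congr1 (take (n1 + n2)) E; rewrite take_size_cat ?size_cat // => ->.
  by rewrite -def_n iotaD take_size_cat ?size_iota.
have E1 : leaves t = iota o.+1 n1.
  by have := congr1 (take n1) E12; rewrite take_size_cat // iotaD take_size_cat ?size_iota.
have E2 : leaves u = iota (o + n1).+1 n2.
  by have := congr1 (drop n1) E12; rewrite drop_size_cat // iotaD drop_size_cat ?size_iota.
have E3 : leaves v = iota (o + (n1 + n2)).+1 n3.
  have := congr1 (drop (n1 + n2)) E; rewrite drop_size_cat ?size_cat // => ->.
  by rewrite -def_n iotaD drop_size_cat ?size_iota.
apply: (@P_node3 n1 n2 n3 n (Tree (shift_subproof E1)) (Tree (shift_subproof E2))
  (Tree (shift_subproof E3))) => //=.
- rewrite -Es /= !relabel_comp; congr (Node (Node _ _) _);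
    apply: eq_in_relabel => l; rewrite ?E2 ?E3 mem_iota /=; lia.
- rewrite -Et /= !relabel_comp; congr (Node _ (Node _ _));
    apply: eq_in_relabel => l; rewrite ?E2 ?E3 mem_iota /=; lia.
Qed.

(** A trivial braid forces source and target to spell the same word. A symmetry turns this word into
    1, .., n, and the two brackets are then linked by associators. *)
Lemma P_straight n (f : mor n) : mrib f = 1 -> P f.
Proof.
move=> f1; pose s := tree_perm (msrc f); rewrite -(mor_symK s f); apply: P_sym.
have Es : leaves (msrc (mor_sym s^-1 f)) = iota 1 n.
  apply: (@eq_from_nth _ 0) => [|i]; rewrite size_leaves ?size_iota // => lt_i.
  have sE : tree_perm (msrc (mor_sym s^-1 f)) = 1 by rewrite tree_sym_perm mulVg.
  have := nth_tree_perm (msrc (mor_sym s^-1 f)) (Ordinal lt_i).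
  by rewrite sE perm1 => ->; rewrite nth_iota.
have Et : leaves (mtgt (mor_sym s^-1 f)) = leaves (msrc (mor_sym s^-1 f)).
  apply: leaves_tree_perm; rewrite !tree_sym_perm; have := mor_perm f.
  by rewrite f1 ribbon_perm1 => /eqP E; rewrite -[tree_perm (mtgt f)](mulKVg s) -E mulg1.
have sub0 t : relabel (subn^~ 0) t = t.
  by rewrite -[RHS]relabel_id; apply: eq_in_relabel => l _; rewrite subn0.
by apply: (P_assoc (leaves_assoc (esym Et)) (o := 0)) => //=; rewrite ?sub0.
Qed.

(* Morphisms with the same ribbon braid differ by relabelling the inputs and by
   morphisms with trivial ribbon braid. *)
Lemma P_ribbon n (g f : mor n) : mrib g = mrib f -> P g -> P f.
Proof.
move=> gf Pg; pose s := tree_perm (msrc f) * (tree_perm (msrc g))^-1.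
pose g' := mor_sym s g.
have Es : tree_perm (msrc g') = tree_perm (msrc f).
  by rewrite tree_sym_perm mulgKV.
have Et : tree_perm (mtgt g') = tree_perm (mtgt f).
  apply: (mulgI (tree_perm (msrc f))^-1); rewrite -{1}Es -(eqP (mor_perm g')).
  by rewrite -(eqP (mor_perm f)) -gf.
have Ls := leaves_tree_perm (esym Es); have Lt := leaves_tree_perm Et.
have -> : f = mor_comp (straight Lt) (mor_comp g' (straight Ls)).
  by apply: mor_eq; rewrite ?(msrc_comp, mtgt_comp, mrib_comp) //= mulg1 mul1g.
apply: P_comp; rewrite ?mtgt_comp //; first exact: P_straight.
by apply: P_comp => //; [apply: P_sym|apply: P_straight].
Qed.

Lemma comb_subproof n : perm_eq (leaves (comb 1 (iota 2 n))) (iota 1 n.+1).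
Proof. by rewrite leaves_comb. Qed.

Lemma PaRB_generated n (f : mor n) : P f.
Proof.
have [x def_x] : exists x, mrib f = x by exists (mrib f).
elim/ribbon_ind: x f def_x => [|x y IHx IHy|x IH|k lt_k|r lt_r] f def_x.
- exact: P_straight.
(* To split [f] an intermediate object is required: [c] has the bracketing of [a] and the letters in
   the order reached after [y]. *)
- pose a := msrc f; pose s := tree_perm a * ribbon_perm y * (tree_perm a)^-1.
  pose c := tree_sym s a.
  have Ec : tree_perm c = tree_perm a * ribbon_perm y by rewrite tree_sym_perm mulgKV.
  have G1 : ribbon_perm y == (tree_perm a)^-1 * tree_perm c by rewrite Ec mulKg.
  have G2 : ribbon_perm x == (tree_perm c)^-1 * tree_perm (mtgt f).
    have := eqP (mor_perm f); rewrite def_x ribbon_permM Ec invMg -mulgA => <-.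
    by rewrite mulKg.
  have -> : f = mor_comp (Mor G2) (Mor G1).
    by apply: mor_eq; rewrite ?msrc_comp ?mtgt_comp ?mrib_comp.
  by apply: P_comp => //; [apply: IHx|apply: IHy].
- rewrite -(mor_invK f); apply: P_inv; apply: IH.
  by rewrite /= def_x invgK.
- have e : (n.-1 + 2).-1 = n by lia.
  have e1 : n.-2.+1 = n.-1 by lia.
  (* The braiding is inserted at position [k] of some object of arity [n.-1], here a right comb;
     [P_ribbon] then adjusts bracketing and labels. *)
  pose c : tree n.-1 := ecast i (tree i) e1 (Tree (comb_subproof n.-2)).
  have lt_k' : k < n.-1 by lia.
  pose g := mor_circ ((tree_perm c)^-1 (Ordinal lt_k')) (mor_id c) beta12.
  have rg : ecast i (ribbon i) e (mrib g) = cross n k.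
    rewrite -[LHS]/(circ_to e (tree_perm c ((tree_perm c)^-1 (Ordinal lt_k'))) 1 (mrib beta12)).
    by rewrite permKV beta12_cross circ_to1_cross //= addn0.
  case: (mrib_cast e g) => _ _ Er.
  apply: (@P_ribbon _ (ecast i (mor i) e g)); first by rewrite Er rg.
  exact/P_cast/P_circ.
have e : (n + 1).-1 = n by lia.
pose a := msrc f.
pose g := mor_circ ((tree_perm a)^-1 (Ordinal lt_r)) (mor_id a) tau.
have rg : ecast i (ribbon i) e (mrib g) = spin n r.
  rewrite -[LHS]/(circ_to e (tree_perm a ((tree_perm a)^-1 (Ordinal lt_r))) 1 (mrib tau)).
  by rewrite permKV tau_spin circ_to1_spin //= addn0.
case: (mrib_cast e g) => _ _ Er.
apply: (@P_ribbon _ (ecast i (mor i) e g)); first by rewrite Er rg.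
exact/P_cast/P_circ.
Qed.

End Generation.

(** * Cosets of the permutations fixing 0, and uniqueness *)

Lemma perm_fix0 n (u : 'S_n.+1) : u ord0 = ord0 -> exists s, u = lift_perm ord0 ord0 s.
Proof.
move=> u0; pose f (i : 'I_n) := odflt i (unlift ord0 (u (lift ord0 i))).
have fE i : lift ord0 (f i) = u (lift ord0 i).
  rewrite /f; case: unliftP => [j ->//|E].
  by have := perm_inj (etrans E (esym u0)) => /(congr1 val).
have f_inj : injective f.
  by move=> i j /(congr1 (lift ord0)); rewrite !fE => /perm_inj /lift_inj.
exists (perm f_inj); apply/permP => i; case: (unliftP ord0 i) => [j ->|->].
  by rewrite lift_perm_lift permE fE.
by rewrite lift_perm_id.
Qed.

(** The symmetries fixing 0 act in a prescribed way, so an action is known on a morphism once it is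
    known for one permutation with each value at 0. *)
Lemma perm_coset0 n (s t : 'S_n.+1) : s ord0 = t ord0 ->
  exists u, s = lift_perm ord0 ord0 u * t.
Proof.
move=> st; have [|u E] := @perm_fix0 n (s * t^-1).
  by rewrite permM st permK.
by exists u; rewrite -E mulgKV.
Qed.

Lemma zcycX n k : k <= n -> (zcyc n ^+ k) ord0 = k :> nat.
Proof.
elim: k => [|k IH] le_k; first by rewrite perm1.
by rewrite expgSr permM permE /= IH ?modn_small // ltnW.
Qed.

Lemma perm_zcyc n (s : 'S_n.+1) : exists u k, s = lift_perm ord0 ord0 u * zcyc n ^+ k.
Proof.
have [|u ->] := @perm_coset0 n s (zcyc n ^+ s ord0); last by exists u, (s ord0).
by apply: val_inj; rewrite /= zcycX // -ltnS.
Qed.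

Definition beta12_swap : mor 2 := mor_sym (tperm ord0 ord_max) beta12.
Definition tau_out : mor 2 := mor_circ ord0 tau (mor_id mu).
Definition tau_in (i : 'I_2) : mor 2 := mor_circ i (mor_id mu) (mor_inv tau).

Lemma tree_swap_mu :
  tree_sym (tperm ord0 ord_max) mu = mu21 /\ tree_sym (tperm ord0 ord_max) mu21 = mu.
Proof.
have lm l : 0 < l < 3 -> label_map (lift_perm ord0 ord0 (tperm ord0 ord_max : 'S_2)) l = 3 - l.
  case: l => // l lt_l; rewrite /label_map lift_permV tpermV.
  have lt_l' : l < 2 by [].
  have -> : inord l.+1 = lift ord0 (Ordinal lt_l') :> 'I_3.
    by apply: val_inj; rewrite /= inordK.
  rewrite lift_perm_lift /=; case: l lt_l lt_l' => [|[|l]] // lt_l lt_l'.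
    have -> : Ordinal lt_l' = ord0 by apply: val_inj.
    by rewrite tpermL.
  have -> : Ordinal lt_l' = ord_max by apply: val_inj.
  by rewrite tpermR.
by split; apply: val_inj; rewrite /= !lm.
Qed.

Lemma src_tau_in i : msrc (tau_in i) = mu.
Proof. by apply: val_inj; case: i => -[|[|]]. Qed.

Lemma tgt_tau_in i : mtgt (tau_in i) = mu.
Proof. by apply: val_inj; case: i => -[|[|]]. Qed.

Lemma src_tau_out : msrc tau_out = mu. Proof. exact: val_inj. Qed.
Lemma tgt_tau_out : mtgt tau_out = mu. Proof. exact: val_inj. Qed.

Lemma mrib_tau_in i : mrib (tau_in i) = (spin 2 i)^-1.
Proof.
have -> : mrib (tau_in i) = circ_to (erefl : (2 + 1).-1 = 2) (tree_perm mu i) 1 (spin 1 0)^-1.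
  by rewrite -tau_spin.
rewrite circ_toVr circ_to1_spin // tree_permE addn0.
by congr (spin 2 _)^-1; case: i => -[|[|]].
Qed.

Lemma mrib_tau_out : mrib tau_out = full_spin 2.
Proof.
have -> : mrib tau_out = circ_to (erefl : (1 + 2).-1 = 2) (tree_perm tree_one ord0) (spin 1 0) 1.
  by rewrite -tau_spin.
have E : tree_perm tree_one ord0 = 0 :> nat by rewrite tree_permE.
by rewrite circ_to_spin // circ_to_full_spinr // !E.
Qed.

(* The full twist of two ribbons is a twist of the root, corrected by twists of
   the two inputs. *)
Lemma beta12_square : mor_comp beta12_swap beta12 =
  mor_comp tau_out (mor_comp (tau_in ord0) (tau_in ord_max)).
Proof.
case: tree_swap_mu => sym_mu sym_mu21.
have c1 : mtgt (tau_in ord_max) = msrc (tau_in ord0) by rewrite tgt_tau_in src_tau_in.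
have c2 : mtgt (mor_comp (tau_in ord0) (tau_in ord_max)) = msrc tau_out.
  by rewrite (mtgt_comp c1) tgt_tau_in src_tau_out.
have c3 : mtgt beta12 = msrc beta12_swap by rewrite /= sym_mu.
apply: mor_eq; rewrite ?(msrc_comp c3) ?(mtgt_comp c3) ?(mrib_comp c3)
  ?(msrc_comp c2) ?(mtgt_comp c2) ?(mrib_comp c2) ?(msrc_comp c1) ?(mrib_comp c1).
- by rewrite src_tau_in.
- by rewrite tgt_tau_out /= sym_mu21.
rewrite mrib_tau_out !mrib_tau_in -[mrib beta12_swap]/(mrib beta12) beta12_cross.
rewrite /full_spin monoid.expg2 swingE fup1 -!mulgA add0n; congr (_ * _).
have C : cross 2 0 * spin 2 0 = spin 2 1 * cross 2 0 by rewrite cross_spin.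
by rewrite -invgM spinC invgM mulKVg mulgA -C mulgK.
Qed.

Section CyclicStructure.
Variable act : forall n : nat, 'S_n.+1 -> mor n -> mor n.
Hypothesis act_cyclic : cyclic_structure PaRB tree_act act.

Lemma arr_actM n (s t : 'S_n.+1) f : act (s * t) f = act s (act t f).
Proof. exact: act_mul (cyclic_arr act_cyclic) n s t f. Qed.

Lemma arr_act1 n (f : mor n) : act 1 f = f.
Proof. exact: act_1 (cyclic_arr act_cyclic) n f. Qed.

Lemma arr_act_sym n (s : 'S_n) f : act (lift_perm ord0 ord0 s) f = mor_sym s f.
Proof. exact: act_sym (cyclic_arr act_cyclic) n s f. Qed.

Lemma arr_act_src n (s : 'S_n.+1) f : msrc (act s f) = tree_act s (msrc f).
Proof. exact: (@Defs.act_dom PaRB _ _ act_cyclic n s f). Qed.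

Lemma arr_act_tgt n (s : 'S_n.+1) f : mtgt (act s f) = tree_act s (mtgt f).
Proof. exact: (@act_cod PaRB _ _ act_cyclic n s f). Qed.

Lemma arr_act_comp n (s : 'S_n.+1) (g f : mor n) : mtgt f = msrc g ->
  act s (mor_comp g f) = mor_comp (act s g) (act s f).
Proof. exact: (@act_cmp PaRB _ _ act_cyclic n s g f). Qed.

Lemma arr_act_idt n (s : 'S_n.+1) (a : tree n) : act s (mor_id a) = mor_id (tree_act s a).
Proof. exact: (@act_idt PaRB _ _ act_cyclic n s a). Qed.

Lemma arr_act_inv n (s : 'S_n.+1) f : act s (mor_inv f) = mor_inv (act s f).
Proof.
have := arr_act_comp s (g := mor_inv f) (f := f) erefl.
rewrite mor_comp_invl arr_act_idt => /(congr1 (@mrib n)).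
rewrite mrib_comp; last by rewrite arr_act_src arr_act_tgt.
move=> /= E; apply: mor_eq; rewrite /= ?arr_act_src ?arr_act_tgt //.
by apply: (mulIg (mrib (act s f))); rewrite mulVg -E.
Qed.

Hypothesis act_alpha : act (s0 2) alpha123 = mor_inv alpha231.

Let c : 'S_3 := (perm (@ordS_inj 3))^-1.
Let d : 'S_4 := s0 2 * lift_perm ord0 ord0 c.

(** The symmetric part of [d] produces [alpha231], and the involution [s0] takes it back to the
    inverse of [alpha123], since it sends [alpha123] to the inverse of [alpha231]. *)
Lemma arr_act_alpha_d : act d alpha123 = mor_inv alpha123.
Proof.
rewrite /d arr_actM arr_act_sym -/alpha231 -[alpha231]mor_invK arr_act_inv.
by rewrite -act_alpha -arr_actM /s0 tperm2 arr_act1.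
Qed.

Lemma arr_act_alpha_dd : act (d * d) alpha123 = alpha123.
Proof. by rewrite arr_actM arr_act_alpha_d arr_act_inv arr_act_alpha_d mor_invK. Qed.
End CyclicStructure.

Section Uniqueness.
Variables act act' : forall n : nat, 'S_n.+1 -> mor n -> mor n.
Hypotheses (H : cyclic_structure PaRB tree_act act) (H' : cyclic_structure PaRB tree_act act').
Hypotheses (act_tau : act (s0 0) tau = tau) (act'_tau : act' (s0 0) tau = tau).
Hypothesis act_beta : act (s0 1) beta12 = act' (s0 1) beta12.
Hypotheses (act_alpha : act (s0 2) alpha123 = mor_inv alpha231)
  (act'_alpha : act' (s0 2) alpha123 = mor_inv alpha231).

Let agree n (f : mor n) := forall s, act s f = act' s f.

Lemma agree_coset n (f : mor n) (s t : 'S_n.+1) : s ord0 = t ord0 -> act t f = act' t f -> act s f = act' s f.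
Proof.
by move=> /perm_coset0 [u ->] E; rewrite !arr_actM // E !arr_act_sym.
Qed.

Lemma agree_id n (a : tree n) : agree (mor_id a).
Proof. by move=> s; rewrite !arr_act_idt. Qed.

Lemma agree_comp n (g f : mor n) : mtgt f = msrc g -> agree g -> agree f -> agree (mor_comp g f).
Proof. by move=> fg Ag Af s; rewrite !arr_act_comp // Ag Af. Qed.

Lemma agree_inv n (f : mor n) : agree f -> agree (mor_inv f).
Proof. by move=> Af s; rewrite !arr_act_inv // Af. Qed.

Lemma agree_sym n (s : 'S_n) (f : mor n) : agree f -> agree (mor_sym s f).
Proof.
move=> Af t; rewrite -[in LHS](arr_act_sym H) -[in RHS](arr_act_sym H').
by rewrite -(arr_actM H) -(arr_actM H').
Qed.

Lemma agree_act n (s : 'S_n.+1) (f : mor n) : agree f -> agree (act s f).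
Proof. by move=> Af t; rewrite [in RHS]Af -(arr_actM H) -(arr_actM H') Af. Qed.

(** Powers of [zcyc] represent all cosets, and each factor [zcyc] is moved inside the composition by
    a cyclic axiom. The induction on the exponent quantifies over arities and morphisms because
    these axioms rotate the factors and, for the first input, exchange them. *)
Lemma agree_circ n m (i : 'I_n) (f : mor n) (g : mor m) :
  agree f -> agree g -> agree (mor_circ i f g).
Proof.
have agree_cast k N N' (e : N = N') (h : mor N) :
    act (zcyc N ^+ k) h = act' (zcyc N ^+ k) h ->
    act (zcyc N' ^+ k) (ecast i (mor i) e h) = act' (zcyc N' ^+ k) (ecast i (mor i) e h).
  by case: N' / e.
have agreeX k : forall n m (i : 'I_n) (f : mor n) (g : mor m), agree f -> agree g ->
    act (zcyc _ ^+ k) (mor_circ i f g) = act' (zcyc _ ^+ k) (mor_circ i f g).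
  elim: k => [|k IH] {}n {}m {}i {}f {}g Af Ag; first by rewrite !arr_act1.
  rewrite !expgSr !arr_actM //; have lt_i := ltn_ord i; have m_gt0 := tree_gt0 (msrc g).
  have [i0|nz_i] := eqVneq (i : nat) 0.
    have lt_j : m.-1 < m by rewrite prednK.
    have e : (m + n).-1 = (n + m).-1 by rewrite addnC.
    have C := act_circ1 (cyclic_arr H) (i := i) (j := Ordinal lt_j) f g e i0 (prednK m_gt0).
    have C' := act_circ1 (cyclic_arr H') (i := i) (j := Ordinal lt_j) f g e i0 (prednK m_gt0).
    rewrite /= in C C'; rewrite C C' -Af -Ag.
    by apply/agree_cast/IH; apply: agree_act.
  have lt_j : i.-1 < n by lia.
  have def_i : (Ordinal lt_j).+1 = i :> nat by rewrite /= prednK // lt0n.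
  have C := act_circ (cyclic_arr H) f g def_i.
  have C' := act_circ (cyclic_arr H') f g def_i.
  by rewrite /= in C C'; rewrite C C' -Af IH //; apply: agree_act.
move=> Af Ag s; have [u [k ->]] := perm_zcyc s.
by rewrite !arr_actM // !arr_act_sym // agreeX.
Qed.

Lemma agree_tau : agree tau.
Proof.
move=> s; have [E|nE] := eqVneq (s ord0) ord0.
  by apply: (@agree_coset _ _ _ 1); rewrite ?perm1 // !arr_act1.
apply: (@agree_coset _ _ _ (s0 0)); last by rewrite act_tau act'_tau.
apply: val_inj; rewrite /= s0_0; case: (s ord0) nE => -[|[|k]] //.
Qed.

Lemma mor_comp_injl n (g g' f : mor n) : mtgt f = msrc g -> mtgt f = msrc g' ->
  mor_comp g f = mor_comp g' f -> g = g'.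
Proof.
move=> fg fg' E; apply: mor_eq; first by rewrite -fg.
  by have := congr1 (@mtgt n) E; rewrite !mtgt_comp.
by have := congr1 (@mrib n) E; rewrite !mrib_comp // => /mulIg.
Qed.

(** The cosets for 0 and 1 are settled by the symmetries and by hypothesis. For 2 the value of [s0]
    on [beta12_swap] is required: [beta12_square] expresses its product with [beta12] by twists, and
    the value on [beta12] can be cancelled. *)
Lemma agree_beta : agree beta12.
Proof.
have agree_b : act (s0 1) beta12_swap = act' (s0 1) beta12_swap.
  have src_b : mtgt beta12 = msrc beta12_swap by rewrite /= tree_swap_mu.1.
  apply: (@mor_comp_injl _ _ _ (act (s0 1) beta12)).
  - by rewrite (arr_act_tgt H) (arr_act_src H) src_b.
  - by rewrite (arr_act_tgt H) (arr_act_src H') src_b.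
  rewrite -(arr_act_comp H) // act_beta -(arr_act_comp H') // beta12_square.
  have agree_t i : agree (tau_in i).
    exact: (@agree_circ 2 1 i _ _ (@agree_id _ _) (agree_inv agree_tau)).
  have c1 : mtgt (tau_in ord_max) = msrc (tau_in ord0) by rewrite tgt_tau_in src_tau_in.
  apply: agree_comp.
  - by rewrite (mtgt_comp c1) tgt_tau_in src_tau_out.
  - exact: (@agree_circ 1 2 ord0 _ _ agree_tau (@agree_id _ _)).
  exact: agree_comp.
pose t : 'S_2 := tperm ord0 ord_max.
move=> s; case: (s ord0 =P ord0) => [E|/eqP nz_s].
  by apply: (@agree_coset _ _ _ 1); rewrite ?perm1 // (arr_act1 H) (arr_act1 H').
have [E|/eqP ne_s] := s ord0 =P s0 1 ord0; first exact: agree_coset E act_beta.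
apply: (@agree_coset _ _ _ (s0 1 * lift_perm ord0 ord0 t)).
  have E2 : (s0 1 * lift_perm ord0 ord0 t) ord0 = 2 :> nat.
    by rewrite permM tpermL lift_perm_lift tpermL.
  apply: val_inj; rewrite [RHS]E2; move: ne_s nz_s; rewrite -!val_eqE /= s0_0.
  by case: (s ord0) => -[|[|[|]]].
by rewrite !arr_actM // !arr_act_sym.
Qed.

Lemma agree_alpha : agree alpha123.
Proof.
pose c : 'S_3 := (perm (@ordS_inj 3))^-1.
pose d : 'S_4 := s0 2 * lift_perm ord0 ord0 c.
have cE (i j : 'I_3) : ordS j = i -> c i = j.
  by move=> <-; apply: (@perm_inj _ (perm (@ordS_inj 3))); rewrite permKV permE.
have d0 : d ord0 = lift ord0 (ord_max : 'I_3).
  by rewrite permM tpermL lift_perm_lift (cE _ ord_max) //; apply: val_inj.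
have dd0 : (d * d) ord0 = 2 :> nat.
  rewrite permM d0 permM tpermD // lift_perm_lift.
  by rewrite (cE _ (Ordinal (isT : 1 < 3))) //; apply: val_inj.
(* The four cosets are represented by [1], [s0 2], [d] and [d * d], which send 0 to 0, 1, 3 and
   2. *)
move=> s; case: (s ord0 =P ord0) => [E|/eqP s_0].
  by apply: (@agree_coset _ _ _ 1); rewrite ?perm1 // (arr_act1 H) (arr_act1 H').
have [E|/eqP s_1] := s ord0 =P s0 2 ord0.
  by apply: agree_coset E _; rewrite act_alpha act'_alpha.
have [E|/eqP s_3] := s ord0 =P d ord0.
  apply: agree_coset E _.
  by rewrite (arr_act_alpha_d H act_alpha) (arr_act_alpha_d H' act'_alpha).
apply: (@agree_coset _ _ _ (d * d)).
  apply: val_inj; rewrite [RHS]dd0; move: s_0 s_1 s_3; rewrite d0 -!val_eqE /= s0_0.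
  by case: (s ord0) => -[|[|[|[|]]]].
by rewrite (arr_act_alpha_dd H act_alpha) (arr_act_alpha_dd H' act'_alpha).
Qed.

Lemma agree_all n (f : mor n) : agree f.
Proof.
apply: PaRB_generated.
- exact: agree_id.
- exact: agree_comp.
- exact: agree_inv.
- exact: agree_circ.
- exact: agree_sym.
- exact: agree_tau.
- exact: agree_beta.
- exact: agree_alpha.
Qed.
End Uniqueness.

Local Close Scope group_scope.

Theorem proposition4p12 :
  exists! act : forall n : nat, 'S_n.+1 -> mor n -> mor n,
    [/\ cyclic_structure PaRB tree_act act,
        act 1 (s0 0) tau = tau,
        act 2 (s0 1) beta12 =
          mor_comp (mor_circ ord_max (mor_id mu) (mor_inv tau)) (mor_inv beta12)
      & act 3 (s0 2) alpha123 = mor_inv alpha231 ].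
Proof.
exists mor_act; split.
  split; [exact: PaRB_cyclic|exact: mor_act_tau|exact: mor_act_beta12|exact: mor_act_alpha123].
move=> act [Hact tauE betaE alphaE].
apply: functional_extensionality_dep => n; apply: functional_extensionality_dep => s.
apply: functional_extensionality_dep => f.
apply: agree_all (PaRB_cyclic) Hact mor_act_tau tauE _ mor_act_alpha123 alphaE n f s.
by rewrite betaE mor_act_beta12.
Qed.
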